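(* Given integers $\mu,\nu>0$, the solutions of $$\partial^\mu\bar\partial^\nu u(z,\bar z)=A(z,\bar z)$$ with $A(z,\bar z)\in C^\alpha(D)$ can be given by $$u(z,\bar z)=g_0(z)+\int_D\Big(\sum_{j=1}^{\nu-1}G(z,\zeta,j)g_j(\zeta)+G(z,\zeta,\nu)\bar f_0(\zeta)+\sum_{i=1}^{\mu-1}G(z,\zeta,\nu,i)\bar f_i(\zeta)+G(z,\zeta,\nu,\mu)A(\zeta,\bar\zeta)\Big)d\bar\zeta\wedge d\zeta,$$ where $f_i,g_j\in H(D)$, $i=0,\dots,\mu-1$, $j=0,\dots,\nu-1$.
   Context: Fix $R>0$ and $0<\alpha<1$. $D=\{z\in\mathbb{C}: |z|\le R\}$ is the closed disk, on which the equation is considered. Unless otherwise stated, functions are complex valued and integrable on $D$. $\partial=\partial/\partial z$, $\bar\partial=\partial/\partial\bar z$. $C^\alpha(D)$ is the set of functions $f$ on $D$ with $\sup\{|f(z)-f(z')|/|z-z'|^\alpha : z,z'\in D,\ z\ne z'\}<\infty$. $H(D)$ is the set of all holomorphic functions on $D$, and $\bar f_i$ is the complex conjugate of $f_i$. The 2-form $d\bar\zeta\wedge d\zeta$ equals $2i\,dx\,dy$ for $\zeta=x+iy$. For positive integers $l,\mu,\nu$ the kernels are $$G(z,\zeta,l)=\frac{(-1)^l(\bar\zeta-\bar z)^{l-1}}{2\pi i\,(l-1)!\,(\zeta-z)},\qquad G(z,\zeta,\mu,\nu)=\frac{(-1)^\mu}{2\pi i\,(\mu-1)!\,(\nu-1)!}C_3(z,\zeta,\mu,\nu),$$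 where for $a,b\in D$, $a\ne b$, with $\ln$ the principal branch (there $R^2-a\bar b$ has positive real part) and $0^0=1$, $$C_1(a,b,k)=\sum_{l=1}^{k-1}\Big(\frac{-b^l}{l}\Big)\Big(\sum_{j=0}^{k-1-l}\binom{k-1}{j}a^{k-1-j}(-b)^j\Big)\ (k>1),\qquad C_1(a,b,1)=0,$$ $$C_2(a,b,l,\nu)=\sum_{\substack{0\le p\le l,\ 0\le q\le \nu-1\\ p\le q}}\binom{l}{p}\binom{\nu-1}{q}R^{2p}(-\bar b)^{l-p}(-b)^{\nu-1-q}a^{q-p},$$ $$C_3(a,b,\mu,\nu)=(\bar b-\bar a)^{\mu-1}\Big(C_1(a,b,\nu)+(a-b)^{\nu-1}\ln\frac{R^2-a\bar b}{|a-b|^2}\Big)+\sum_{l=1}^{\mu-1}\binom{\mu-1}{l}(\bar b-\bar a)^{\mu-1-l}\Big(\frac{-1}{l}(\bar a-\bar b)^l(a-b)^{\nu-1}-\frac1l C_2(a,b,l,\nu)\Big)\ (\mu>1),$$ $$C_3(a,b,1,\nu)=C_1(a,b,\nu)+(a-b)^{\nu-1}\ln\frac{R^2-a\bar b}{|a-b|^2}.$$ *)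

(* Defs.v *)
From HB Require Import structures.
From mathcomp Require Import all_boot all_order all_algebra.
From mathcomp Require Import all_classical all_reals all_analysis.
From mathcomp Require Import complex.

Set Implicit Arguments.
Unset Strict Implicit.
Unset Printing Implicit Defensive.

Import Order.TTheory GRing.Theory Num.Theory.
Import numFieldNormedType.Exports.
Import Normc.

Local Open Scope classical_set_scope.
Local Open Scope complex_scope.
Local Open Scope ring_scope.

Definition cdisk (R : realType) (r : R) : set R[i] := [set z | normc z <= r].

(* [v] is real-differentiable at [z] relative to [D], with differential
   a dz + b dzbar; so a and b are the Wirtinger derivatives of [v] at [z].
   Working relative to [D] gives a meaning to them at boundary points: when
   [D] is a closed disk of positive radius, a and b are unique for z in D.
   [R[i]^o] is R[i] with the topology of the complex modulus. *)
Definition is_wirtinger (R : realType) (D : set R[i]) (v : R[i] -> R[i])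
    (z a b : R[i]) : Prop :=
  (fun w : R[i] =>
      (v w - (v z + a * (w - z) + b * (w - z)^*)) / (w - z) : R[i]^o)
    @ within D (z : R[i]^o)^' --> (0 : R[i]^o).

Definition is_del (R : realType) (D : set R[i]) (v w : R[i] -> R[i]) : Prop :=
  forall z, D z -> exists b, is_wirtinger D v z (w z) b.

Definition is_delbar (R : realType) (D : set R[i])
    (v w : R[i] -> R[i]) : Prop :=
  forall z, D z -> exists a, is_wirtinger D v z a (w z).

(* The n-th iterate of a differential operator given by its graph [op];
   functions are identified when they agree on [D]. *)
Fixpoint is_iter (R : realType) (D : set R[i])
    (op : (R[i] -> R[i]) -> (R[i] -> R[i]) -> Prop)
    (n : nat) (v w : R[i] -> R[i]) : Prop :=
  if n is n'.+1 then exists v', op v v' /\ is_iter D op n' v' w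
  else forall z, D z -> v z = w z.

(* u solves del^mu delbar^nu u = A on D: the successive derivatives exist at
   every point of D. *)
Definition is_solution (R : realType) (D : set R[i]) (mu nu : nat)
    (A u : R[i] -> R[i]) : Prop :=
  exists w, is_iter D (is_delbar D) nu u w /\ is_iter D (is_del D) mu w A.

Definition holomorphic_on (R : realType) (D : set R[i])
    (f : R[i] -> R[i]) : Prop :=
  forall z, D z -> exists l : R[i],
    (fun w : R[i] => (f w - f z) / (w - z) : R[i]^o)
      @ within D (z : R[i]^o)^' --> (l : R[i]^o).

Definition holder_on (R : realType) (D : set R[i]) (alpha : R)
    (f : R[i] -> R[i]) : Prop :=
  has_ubound [set q : R | exists z z', [/\ D z, D z', z != z' &
    q = normc (f z - f z') / (normc (z - z') `^ alpha)]].

(* Principal argument, in ]-pi, pi], and principal logarithm. *)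
Definition carg (R : realType) (w : R[i]) : R :=
  if 0 <= complex.Im w then acos (complex.Re w / normc w)
  else - acos (complex.Re w / normc w).

Definition cln (R : realType) (w : R[i]) : R[i] :=
  ln (normc w) +i* carg w.

(* Integral over D against the 2-form dzetabar /\ dzeta = 2 i dx dy. *)
Definition integral_form (R : realType) (D : set R[i])
    (F : R[i] -> R[i]) : R[i] :=
  let mu2 := (@lebesgue_measure R \x @lebesgue_measure R)%E in
  let D2 := [set p : R * R | D (p.1 +i* p.2)] in
  2 * 'i * ((\int[mu2]_(p in D2) complex.Re (F (p.1 +i* p.2)))
            +i* (\int[mu2]_(p in D2) complex.Im (F (p.1 +i* p.2)))).

Definition C1 (R : realType) (a b : R[i]) (k : nat) : R[i] :=
  \sum_(1 <= l < k) (- (b ^+ l / l%:R)) *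
    \sum_(0 <= j < k - l) 'C(k.-1, j)%:R * a ^+ (k.-1 - j) * (- b) ^+ j.

Definition C2 (R : realType) (r : R) (a b : R[i]) (l nu : nat) : R[i] :=
  \sum_(0 <= p < l.+1) \sum_(0 <= q < nu | (p <= q)%N)
    'C(l, p)%:R * 'C(nu.-1, q)%:R * r%:C ^+ (2 * p) * (- b^*) ^+ (l - p) *
    (- b) ^+ (nu.-1 - q) * a ^+ (q - p).

Definition C3 (R : realType) (r : R) (a b : R[i]) (mu nu : nat) : R[i] :=
  (b^* - a^*) ^+ mu.-1 *
    (C1 a b nu + (a - b) ^+ nu.-1 *
       cln (((r ^+ 2)%:C - a * b^*) / (normc (a - b) ^+ 2)%:C)) +
  \sum_(1 <= l < mu) 'C(mu.-1, l)%:R * (b^* - a^*) ^+ (mu.-1 - l) *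
    (- 1 / l%:R * (a^* - b^*) ^+ l * (a - b) ^+ nu.-1
     - 1 / l%:R * C2 r a b l nu).

(* Kernels G(z, zeta, l) and G(z, zeta, mu, nu). Their values at zeta = z are
   meaningless, and irrelevant since they are only integrated in zeta. *)
Definition G1 (R : realType) (z zeta : R[i]) (l : nat) : R[i] :=
  (-1) ^+ l * (zeta^* - z^*) ^+ l.-1 /
    (2 * (pi : R)%:C * 'i * (l.-1)`!%:R * (zeta - z)).

Definition G2 (R : realType) (r : R) (z zeta : R[i]) (mu nu : nat) : R[i] :=
  (-1) ^+ mu / (2 * (pi : R)%:C * 'i * (mu.-1)`!%:R * (nu.-1)`!%:R) *
    C3 r z zeta mu nu.

(* Main.v *)
From HB Require Import structures.
Require Import Defs.
From mathcomp Require Import all_boot all_order all_algebra.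
From mathcomp Require Import all_classical all_reals all_analysis.
From mathcomp Require Import measurable_realfun complex ring lra.
Set Implicit Arguments.
Unset Strict Implicit.
Unset Printing Implicit Defensive.
Import Order.TTheory GRing.Theory Num.Theory.
Import numFieldNormedType.Exports.
Import Normc.
Local Open Scope classical_set_scope.
Local Open Scope complex_scope.
Local Open Scope ring_scope.

(** The operator delbar has an explicit right inverse on the closed disk D, the
    Cauchy transform, and the theorem results from iterating it.

    Let T_0 phi = phi and, for n > 0, let T_n phi be the integral of
    G(z, zeta, n) phi(zeta) over D. If phi is bounded, measurable and Hoelder
    continuous at each point of D, then T_(n+1) phi is differentiable at every
    point of D, boundary points included, and delbar T_(n+1) phi = T_n phi
    ([cauchy_iterS]). For n > 0 one differentiates under the integral sign. For
    n = 0 one first subtracts the constant phi(z) from phi, which makes this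
    possible at z; the constant is dealt with by the fact that T_1 maps the
    function 1 to the conjugate of z on D ([cint_inv]), which is proved by
    computing the integral of the Cauchy kernel in coordinates.

    For w of the same kind, delbar^n u = w therefore forces
    u = sum_(j < n) T_j g_j + T_n w with g_j holomorphic ([dbar_decomposition]):
    by induction this holds for delbar u, and raising the indices of the T_j
    gives a function with the same delbar as u. Applied to the conjugate of a function w with del^mu w = A, this says that
    w is the sum of the conjugates of T_i f_i for i < mu and of the conjugate of
    T_mu (conj A).

    It remains to solve delbar^nu u = w for such w, and this is what the kernels
    with four arguments are made for: delbar^nu sends the integral of
    G(z, zeta, nu, i) phi(zeta) to the conjugate of T_i (conj phi)
    ([kernel_potential_dbar]). Indeed, up to a constant, the kernel is
      conj(z - zeta)^(nu - 1) (z - zeta)^(i - 1)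
        ln ((r^2 - z conj(zeta)) / |z - zeta|^2)
    plus polynomials in conj z of degree less than nu whose coefficients are
    holomorphic in z. These are annihilated by delbar^nu, the numerator in the
    logarithm is holomorphic in z, and the rest of the logarithm contributes
    (z - zeta)^(i - 1) / conj(z - zeta), a conjugated Cauchy kernel. The f_i being
    given, u and the sum of these integrals have the same delbar^nu, so their
    difference is a sum of T_j g_j with j < nu. Read backwards, the same
    computations show that all such functions are solutions.

    The analysis is in [cint_wd], which justifies all differentiations under the
    integral sign, at boundary points too. It uses the majorants
    |x - w|^(alpha - 2), integrable in the plane, and has to cope with
    majorants whose singularities at z and at w collide as w tends to z
    ([integral_small_seq]). *)

Arguments normc : simpl never.

(** * Modulus and conjugation *)

Section ComplexModulus.
Variable R : realType.
Local Notation C := R[i].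
Implicit Types x y z : C.

Lemma normE z : `|z| = (normc z)%:C.
Proof. by []. Qed.

Lemma normc_ge0 z : 0 <= normc z.
Proof. by rewrite -lecR -normE; exact: normr_ge0. Qed.

Lemma normcD x y : normc (x + y) <= normc x + normc y.
Proof. by rewrite -lecR rmorphD /= -!normE ler_normD. Qed.

Lemma normcN x : normc (- x) = normc x.
Proof. by apply: complexI; rewrite -!normE normrN. Qed.

Lemma normcB x y : normc (x - y) = normc (y - x).
Proof. by rewrite -normcN opprB. Qed.

Lemma normc_conj z : normc (z^*) = normc z.
Proof. by apply: complexI; rewrite -!normE normcJ. Qed.

Lemma conjcD x y : (x + y)^* = x^* + y^*. Proof. exact: rmorphD. Qed.
Lemma conjcB x y : (x - y)^* = x^* - y^*. Proof. exact: rmorphB. Qed.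
Lemma conjcM x y : (x * y)^* = x^* * y^*. Proof. exact: rmorphM. Qed.
Lemma conjcX x n : (x ^+ n)^* = x^* ^+ n. Proof. exact: rmorphXn. Qed.
Lemma conjcV x : (x^-1)^* = (x^*)^-1. Proof. exact: fmorphV. Qed.

Lemma normcX z n : normc (z ^+ n) = normc z ^+ n.
Proof. by apply: complexI; rewrite rmorphXn /= -!normE normrX. Qed.

Lemma normc_eq0 z : (normc z == 0) = (z == 0).
Proof. by rewrite -(inj_eq (@complexI R)) -normE normr_eq0. Qed.

Lemma normc_gt0 z : (0 < normc z) = (z != 0).
Proof. by rewrite lt0r normc_eq0 normc_ge0 andbT. Qed.

Lemma normc_real (t : R) : normc t%:C = `|t|.
Proof. by rewrite /normc /= expr0n addr0 sqrtr_sqr. Qed.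

Lemma ler_dist_normc x y : `|normc x - normc y| <= normc (x - y).
Proof.
rewrite ler_norml; apply/andP; split.
  by have := normcD (y - x) x; rewrite subrK normcB; lra.
by have := normcD (x - y) y; rewrite subrK; lra.
Qed.

Lemma sqr_normc_ReIm z : normc z ^+ 2 = complex.Re z ^+ 2 + complex.Im z ^+ 2.
Proof. by case: z => a b; rewrite /normc /= sqr_sqrtr // addr_ge0 ?sqr_ge0. Qed.

Lemma ler_Re_normc z : `|complex.Re z| <= normc z.
Proof. by rewrite -lecR -normE normc_ge_Re. Qed.

Lemma ler_Im_normc z : `|complex.Im z| <= normc z.
Proof.
rewrite -(ler_pXn2r (n := 2)) ?nnegrE ?normc_ge0 // sqr_normc_ReIm real_normK ?num_real //.
by rewrite lerDr sqr_ge0.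
Qed.

Lemma normc_le_ReIm z : normc z <= `|complex.Re z| + `|complex.Im z|.
Proof.
rewrite -(ler_pXn2r (n := 2)) ?nnegrE ?normc_ge0 ?addr_ge0 //.
rewrite sqr_normc_ReIm sqrrD !real_normK ?num_real //.
by rewrite addrAC lerDl mulrn_wge0 // mulr_ge0.
Qed.

Lemma mulcJ z : z * z^* = (normc z ^+ 2)%:C.
Proof. by rewrite -sqr_normc normE -rmorphXn. Qed.

End ComplexModulus.

(** * Real differentiability relative to a set *)

Section RealDifferentiation.
Variable R : realType.
Local Notation C := R[i].
Implicit Types (D : set C) (v : C -> C) (a b z w : C).

Definition littleo D z (e : C -> C) := forall eps : R, 0 < eps ->
  exists2 d : R, 0 < d &
  forall w, D w -> normc (w - z) < d -> normc (e w) <= eps * normc (w - z).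

(** [is_wirtinger] without division by [w - z], so that the rules of calculus
    become ring identities up to small terms. *)
Definition wd D v z a b :=
  littleo D z (fun w => v w - v z - a * (w - z) - b * (w - z)^*).

(** The limits of difference quotients are taken in [R[i]], where positive radii
    and tolerances are elements of [R[i]] that happen to be real. *)
Lemma cvg_quotient_littleo D z (e : C -> C) (q : C -> C) (l : C) : e z = 0 ->
  (forall w, w != z -> q w - l = e w / (w - z)) ->
  (q : C -> R[i]^o) @ within D (z : R[i]^o)^' --> (l : R[i]^o) <-> littleo D z e.
Proof.
move=> ez qe; split.
- move=> /cvgrPdist_le + eps e0 => /(_ eps%:C); rewrite ltcR => /(_ e0).
  rewrite near_withinE; rewrite /dnbhs near_withinE => /nbhs_ballP [d /= d0 H].
  have /complex_realP [d' dE] : d \is Num.real by rewrite realE ltW.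
  rewrite {}dE ltcR in d0 H; exists d' => // w Dw wz.
  have [->|wz0] := eqVneq w z; first by rewrite ez subrr normc0 mulr0.
  have /(_ _ wz0 Dw) := H w _.
  rewrite -ball_normE /= -normrN opprB normE ltcR => /(_ wz).
  rewrite -normrN opprB qe // normE lecR normcM normcV ler_pdivrMr //.
  by rewrite normc_gt0 subr_eq0.
- move=> H; apply/cvgrPdist_le => eps e0.
  have /complex_realP [e' eE] : eps \is Num.real by rewrite realE ltW.
  rewrite {}eE ltcR in e0 *; have [d d0 {}H] := H _ e0.
  rewrite near_withinE; rewrite /dnbhs near_withinE; apply/nbhs_ballP.
  exists d%:C; rewrite /= ?ltcR // => w.
  rewrite -ball_normE /= -normrN opprB normE ltcR => wz wz0 Dw.
  rewrite -normrN opprB qe // normE lecR normcM normcV ler_pdivrMr ?H //.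
  by rewrite normc_gt0 subr_eq0.
Qed.

Lemma is_wirtingerP D v z a b : is_wirtinger D v z a b <-> wd D v z a b.
Proof.
rewrite /is_wirtinger /wd; apply: cvg_quotient_littleo.
  by rewrite !subrr rmorph0 !mulr0 !subr0.
by move=> w _; rewrite subr0; congr (_ / _); ring.
Qed.

Lemma holomorphic_onP D v : holomorphic_on D v <->
  forall z, D z -> exists l, wd D v z l 0.
Proof.
have H z l : (fun w : C => (v w - v z) / (w - z) : R[i]^o)
      @ within D (z : R[i]^o)^' --> (l : R[i]^o) <-> wd D v z l 0.
  apply: cvg_quotient_littleo; first by rewrite !subrr rmorph0 !mulr0 !subr0.
  move=> w; rewrite -subr_eq0 => wz; rewrite mul0r subr0.
  by rewrite [RHS]mulrBl mulfK.
by split=> h z Dz; have [l /H] := h z Dz; exists l.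
Qed.

Lemma littleo0 D z : littleo D z (fun=> 0).
Proof.
by move=> e e0; exists 1 => // w _ _; rewrite normc0 mulr_ge0 ?normc_ge0 ?ltW.
Qed.

Lemma littleo_ext D z e1 e2 : (forall w, D w -> e1 w = e2 w) ->
  littleo D z e1 -> littleo D z e2.
Proof.
by move=> E H e e0; have [d d0 h] := H e e0; exists d => // w Dw; rewrite -E //; exact: h.
Qed.

Lemma littleoD D z e1 e2 : littleo D z e1 -> littleo D z e2 ->
  littleo D z (fun w => e1 w + e2 w).
Proof.
move=> H1 H2 e e0; have e20 : 0 < e / 2 by lra.
have [d1 d10 h1] := H1 _ e20; have [d2 d20 h2] := H2 _ e20.
exists (Num.min d1 d2); first by rewrite lt_min d10.
move=> w Dw; rewrite lt_min => /andP[w1 w2].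
by have := normcD (e1 w) (e2 w); have := h1 _ Dw w1; have := h2 _ Dw w2; lra.
Qed.

Lemma littleoM D z e f (K d : R) : 0 < d ->
  (forall w, D w -> normc (w - z) < d -> normc (f w) <= K) ->
  littleo D z e -> littleo D z (fun w => f w * e w).
Proof.
move=> d0 fK H eps eps0; have K0 : 0 < `|K| + 1 by have := normr_ge0 K; lra.
have [d1 d10 h1] := H (eps / (`|K| + 1)) (divr_gt0 eps0 K0).
exists (Num.min d d1); first by rewrite lt_min d0.
move=> w Dw; rewrite lt_min => /andP[w1 w2].
rewrite normcM; have := h1 _ Dw w2; have := fK _ Dw w1 => A B.
have -> : eps * normc (w - z) = (`|K| + 1) * (eps / (`|K| + 1) * normc (w - z)).
  by field; apply: lt0r_neq0.
by apply: ler_pM; rewrite ?normc_ge0 //; have := ler_norm K; lra.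
Qed.

Lemma littleoZ D z e c : littleo D z e -> littleo D z (fun w => c * e w).
Proof. by apply: (@littleoM _ _ _ _ (normc c) 1). Qed.

Lemma littleo_quad D z e (K d : R) : 0 < d ->
  (forall w, D w -> normc (w - z) < d -> normc (e w) <= K * normc (w - z) ^+ 2) ->
  littleo D z e.
Proof.
move=> d0 eK eps eps0; have K0 : 0 < `|K| + 1 by have := normr_ge0 K; lra.
exists (Num.min d (eps / (`|K| + 1))); first by rewrite lt_min d0 divr_gt0.
move=> w Dw; rewrite lt_min => /andP[w1]; rewrite ltr_pdivlMr // => w2.
apply: le_trans (eK _ Dw w1) _; rewrite expr2 mulrA ler_wpM2r ?normc_ge0 //.
apply: le_trans (ltW w2); rewrite mulrC ler_wpM2l ?normc_ge0 //.
by have := ler_norm K; lra.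
Qed.

(** A differentiable function is Lipschitz at the point, which is all that is
    needed to control the quadratic terms in products and inverses. *)
Lemma wd_lip D v z a b : wd D v z a b -> exists (K : R) (d : R), [/\ 0 <= K, 0 < d &
  forall w, D w -> normc (w - z) < d -> normc (v w - v z) <= K * normc (w - z)].
Proof.
move=> H; have [d d0 h] := H 1 ltr01.
exists (1 + normc a + normc b), d; split=> //.
  by rewrite !addr_ge0 ?normc_ge0.
move=> w Dw wz; have := h _ Dw wz.
set e := (X in normc X <= _) => eh.
have -> : v w - v z = e + a * (w - z) + b * (w - z)^* by rewrite /e; ring.
apply: (le_trans (normcD _ _)); rewrite !mulrDl lerD //; last first.
  by rewrite normcM normc_conj.
by apply: (le_trans (normcD _ _)); rewrite lerD // normcM.
Qed.

Lemma wd_ext D v v' z a b : D z -> (forall w, D w -> v w = v' w) ->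
  wd D v z a b -> wd D v' z a b.
Proof. by move=> Dz E; apply: littleo_ext => w Dw; rewrite !E. Qed.

Lemma wd_cst D c z : wd D (fun=> c) z 0 0.
Proof. by apply: littleo_ext (littleo0 D z) => w _; rewrite subrr !mul0r !subr0. Qed.

Lemma wd_id D z : wd D id z 1 0.
Proof. by apply: littleo_ext (littleo0 D z) => w _; rewrite mul1r subrr mul0r subr0. Qed.

Lemma wd_conj D v z a b : wd D v z a b -> wd D (fun w => (v w)^*) z b^* a^*.
Proof.
move=> H e e0; have [d d0 h] := H e e0; exists d => // w Dw wz.
rewrite -normc_conj; have := h w Dw wz; congr (normc _ <= _).
by rewrite !(conjcB, conjcM, conjCK); ring.
Qed.

Lemma wdD D v v' z a b a' b' : wd D v z a b -> wd D v' z a' b' ->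
  wd D (fun w => v w + v' w) z (a + a') (b + b').
Proof. by move=> H H'; apply: littleo_ext (littleoD H H') => w _; ring. Qed.

Lemma wdM D v v' z a b a' b' : wd D v z a b -> wd D v' z a' b' ->
  wd D (fun w => v w * v' w) z (a * v' z + v z * a') (b * v' z + v z * b').
Proof.
move=> H H'; have [K [d [K0 d0 h]]] := wd_lip H'.
have bv w : D w -> normc (w - z) < Num.min d 1 -> normc (v' w) <= K + normc (v' z).
  move=> Dw; rewrite lt_min => /andP[w1 w2].
  have -> : v' w = (v' w - v' z) + v' z by ring.
  apply: (le_trans (normcD _ _)); rewrite lerD //.
  apply: (le_trans (h _ Dw w1)); rewrite -[leRHS]mulr1 ler_wpM2l //; exact: ltW.
have d1 : 0 < Num.min d 1 by rewrite lt_min d0 /=.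
have T1 := littleoM d1 bv H.
have T2 := littleoZ (v z) H'.
have T3 : littleo D z (fun w => (a * (w - z) + b * (w - z)^*) * (v' w - v' z)).
  apply: (littleo_quad (K := (normc a + normc b) * K) d0) => w Dw wz.
  rewrite normcM expr2 mulrACA; apply: ler_pM; rewrite ?normc_ge0 ?h //.
  apply: (le_trans (normcD _ _)); rewrite !normcM normc_conj mulrDl //.
by apply: littleo_ext (littleoD (littleoD T1 T2) T3) => w _; ring.
Qed.

Lemma wdZ D v z a b c : wd D v z a b -> wd D (fun w => c * v w) z (c * a) (c * b).
Proof. by move=> H; have := wdM (wd_cst D c z) H; rewrite !mul0r !add0r. Qed.

Lemma wdN D v z a b : wd D v z a b -> wd D (fun w => - v w) z (- a) (- b).
Proof.
move=> H; apply: littleo_ext (littleoZ (-1) H) => w _; ring.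
Qed.

Lemma wdB D v v' z a b a' b' : wd D v z a b -> wd D v' z a' b' ->
  wd D (fun w => v w - v' w) z (a - a') (b - b').
Proof. by move=> H /wdN; apply: wdD. Qed.

Lemma wd_comp_real (g : C -> R) (f : R -> R) (l : R) D z a b :
  wd D (fun w => (g w)%:C) z a b -> is_derive (g z) (1 : R) f l ->
  wd D (fun w => (f (g w))%:C) z (l%:C * a) (l%:C * b).
Proof.
move=> H [fd fl].
have [K [d [K0 d0 h]]] := wd_lip H.
have dg w : (g w)%:C - (g z)%:C = (g w - g z)%:C :> C by rewrite rmorphB.
suff T : littleo D z (fun w => (f (g w))%:C - (f (g z))%:C - l%:C * ((g w)%:C - (g z)%:C)).
  apply: littleo_ext (littleoD T (littleoZ l%:C H)) => w _; ring.
move=> eps eps0; have K1 : 0 < K + 1 by lra.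
have /cvgrPdist_le /(_ (eps / (K + 1)) (divr_gt0 eps0 K1)) := fd.
rewrite -/(derive f (g z) 1) fl /dnbhs near_withinE => /nbhs_ballP [r r0 B].
exists (Num.min d (r / (K + 1))); first by rewrite lt_min d0 divr_gt0.
move=> w Dw; rewrite lt_min => /andP[w1]; rewrite ltr_pdivlMr // => w2.
have gwz : `|g w - g z| <= K * normc (w - z).
  by have := h _ Dw w1; rewrite dg normc_real.
rewrite !dg -!rmorphB -rmorphM -rmorphB normc_real.
have [gE|gN] := eqVneq (g w) (g z).
  by rewrite gE !subrr mulr0 subr0 normr0 mulr_ge0 ?normc_ge0 // ltW.
have gN0 : g w - g z != 0 by rewrite subr_eq0.
have := B (g w - g z) _ gN0; rewrite -ball_normE /= sub0r normrN => /(_ _)/wrap [].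
  have := normc_ge0 (w - z); nra.
rewrite /= [(_ - _)%:A]mulr1 subrK.
rewrite -[_ *: _]/((g w - g z)^-1 * (f (g w) - f (g z))).
set t := (X in `|X| <= _) => tb.
have -> : f (g w) - f (g z) - l * (g w - g z) = - t * (g w - g z).
  by rewrite /t; field.
rewrite normrM normrN; apply: (le_trans (ler_pM _ _ tb gwz)) => //.
rewrite mulrA; apply: ler_wpM2r; first exact: normc_ge0.
by rewrite mulrAC ler_pdivrMr // ler_wpM2l ?ltW //; lra.
Qed.

Lemma wdV D v z a b : v z != 0 -> wd D v z a b ->
  wd D (fun w => (v w)^-1) z (- a / v z ^+ 2) (- b / v z ^+ 2).
Proof.
move=> vz0 H; have [K [d [K0 d0 h]]] := wd_lip H.
have nv : 0 < normc (v z) by rewrite normc_gt0.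
pose d' := Num.min d (normc (v z) / 2 / (K + 1)).
have K1 : 0 < K + 1 by lra.
have d'0 : 0 < d' by rewrite lt_min d0 /= !divr_gt0.
have lb w : D w -> normc (w - z) < d' -> normc (v z) / 2 <= normc (v w).
  move=> Dw; rewrite lt_min => /andP[w1]; rewrite ltr_pdivlMr // => w2.
  have := h _ Dw w1; have := normcD (v z - v w) (v w); rewrite subrK normcB.
  have := normc_ge0 (w - z); nra.
have bv w : D w -> normc (w - z) < d' -> normc (- ((v w)^-1 * (v z)^-1)) <= 2 / normc (v z) / normc (v z).
  move=> Dw wz; have L := lb _ Dw wz; rewrite normcN normcM !normcV.
  rewrite ler_wpM2r ?invr_ge0 ?normc_ge0 //.
  have -> : 2 / normc (v z) = (normc (v z) / 2)^-1 by field; apply: lt0r_neq0.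
  by rewrite lef_pV2 // posrE; lra.
have T1 := littleoM d'0 bv H.
have T2 : littleo D z (fun w => (a * (w - z) + b * (w - z)^*) * (v w - v z) * ((v w)^-1 * (v z)^-1 ^+2)).
  apply: (littleo_quad (K := (normc a + normc b) * K * (2 / normc (v z) / normc (v z)/normc (v z))) d'0) => w Dw wz.
  have w1 : normc (w - z) < d by move: wz; rewrite lt_min => /andP[].
  rewrite !normcM [leRHS]mulrAC; apply: ler_pM; rewrite ?mulr_ge0 ?normc_ge0 //.
    rewrite expr2 mulrACA; apply: ler_pM; rewrite ?normc_ge0 ?h //.
    by apply: (le_trans (normcD _ _)); rewrite !normcM normc_conj mulrDl.
  have := bv _ Dw wz; rewrite normcN normcM !normcV => B.
  by rewrite ?normcV mulrA ler_wpM2r ?invr_ge0 ?normc_ge0.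
have [d'' d''0 E] : exists2 d'' : R, 0 < d'' & forall w, D w -> normc (w - z) < d'' -> v w != 0.
  exists d' => // w Dw wz; rewrite -normc_gt0; apply: lt_le_trans (lb _ Dw wz); lra.
move=> eps eps0; have [e1 e10 F] := littleoD T1 T2 eps0.
exists (Num.min e1 d''); first by rewrite lt_min e10.
move=> w Dw; rewrite lt_min => /andP[w1 w2]; have := F _ Dw w1.
congr (normc _ <= _); have vw0 := E _ Dw w2.
field; exact/andP.
Qed.

End RealDifferentiation.

(** * Affine changes of variable on the line *)

Section AffineChange.
Variable R : realType.
Local Notation mu := (@lebesgue_measure R).
Variables (a b : R).
Hypothesis a0 : a != 0.
Let phi : measurableTypeR R -> measurableTypeR R := fun x => a * x + b.

Let mphi : measurable_fun [set: measurableTypeR R] phi.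
Proof. by apply: measurable_funD => //; exact: measurable_funM. Qed.

Let phi_mixin := isMeasurableFun.Build _ _ _ _ phi mphi.
Let phi_mfun : {mfun measurableTypeR R >-> measurableTypeR R} :=
  HB.pack phi phi_mixin.

(** Both sides are measures in [A]; by uniqueness of Lebesgue measure it is
    enough to compare them on half-open intervals. *)
Lemma lebesgue_measure_affine (A : set (measurableTypeR R)) : measurable A ->
  (mu A = `|a|%:E * pushforward mu phi A)%E.
Proof.
move=> mA; have na : 0 < `|a| by rewrite normr_gt0.
rewrite (lebesgue_measure_unique (mu := mscale (`|a|)%:nng (pushforward mu phi_mfun))) //.
move=> _ [[x y]] /= _ <-; rewrite /mscale /= /pushforward lebesgue_measure_itv /=.
have H : mu (phi @^-1` `]x, y]) = (if x < y then ((y - x) / `|a|)%:E else 0%E).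
  have [ap|an] : 0 < a \/ a < 0 by case: (ltgtP a 0) a0; auto.
  - rewrite (_ : _ @^-1` _ = `](x - b) / a, (y - b) / a]%classic); last first.
      apply/seteqP; split=> t; rewrite /= !in_itv /= /phi ltr_pdivrMr // ler_pdivlMr // mulrC; lra.
    rewrite lebesgue_measure_itv /= lte_fin ltr_pM2r ?invr_gt0 // ltrD2r.
    by case: ifP => // _; rewrite -EFinB gtr0_norm //; congr EFin; field.
  - rewrite (_ : _ @^-1` _ = `[(y - b) / a, (x - b) / a[%classic); last first.
      apply/seteqP; split=> t; rewrite /= !in_itv /= /phi ltr_ndivlMr // ler_ndivrMr // mulrC; lra.
    rewrite lebesgue_measure_itv /= lte_fin ltr_nM2r ?invr_lt0 // ltrD2r.
    by case: ifP => // _; rewrite -EFinB ltr0_norm //; congr EFin; field.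
rewrite {}H lte_fin; case: ifP => // _; rewrite ?mule0 //.
by rewrite -EFinM -EFinB; congr EFin; field; apply: lt0r_neq0.
Qed.

Lemma ge0_integral_affine (f : R -> \bar R) : measurable_fun setT f ->
  (forall x, 0 <= f x)%E ->
  (\int[mu]_x f x = `|a|%:E * \int[mu]_x f (a * x + b)%R)%E.
Proof.
move=> mf f0.
rewrite (eq_measure_integral (mscale (`|a|)%:nng (pushforward mu phi_mfun))); last first.
  by move=> A mA _; exact: lebesgue_measure_affine.
rewrite ge0_integral_mscale //=.
by congr (_ * _)%E; rewrite ge0_integral_pushforward.
Qed.

End AffineChange.

(** * A weak singularity on the line *)

Section SingularLine.
Variable R : realType.
Local Notation mu := (@lebesgue_measure R).
Variables (be de : R).
Hypotheses (be0 : 0 < be) (be1 : be < 1) (de0 : 0 < de).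

Let g (x : R) : R := if (0 < x) && (x <= de) then x `^ (be - 1) else 0.

Let gE : EFin \o g = (fun x => (x `^ (be - 1))%:E) \_ `]0, de].
Proof.
apply/funext => x; rewrite patchE /g /=.
case: ifPn => [H|H]; first by rewrite ifT // inE /= in_itv.
by rewrite ifF //; apply/negbTE; rewrite notin_setE /= in_itv /=; exact/negP.
Qed.

Let mg : measurable_fun [set: R] (EFin \o g).
Proof.
rewrite gE; apply/(measurable_restrictT _ _).1 => //.
by apply/measurable_EFinP; apply: measurable_funTS; exact: measurable_powR.
Qed.

Let g0 x : (0 <= (EFin \o g) x)%E.
Proof. by rewrite lee_fin /g; case: ifP => // _; exact: powR_ge0. Qed.

Let int_g : (\int[mu]_x (EFin \o g) x <= (de `^ be / be)%:E)%E.
Proof.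
rewrite gE -integral_mkcond.
(* away from 0 the fundamental theorem of calculus applies *)
pose F n : set R := [set` `[de / n.+1%:R, de]].
have FE : `]0, de]%classic = \bigcup_n F n.
  apply/seteqP; split=> x /=.
    rewrite in_itv /= => /andP[x0 xd].
    exists (Num.trunc (de / x)) => //; rewrite /F /= in_itv /= xd andbT.
    rewrite ler_pdivrMr ?ltr0n // mulrC -ler_pdivrMr //.
    by apply/ltW/truncnS_gt.
  case=> n _; rewrite /F /= !in_itv /= => /andP[nx ->]; rewrite andbT.
  by apply: lt_le_trans nx; rewrite divr_gt0 // ltr0n.
have H : (\int[mu]_(x in F n) (x `^ (be - 1))%:E @[n --> \oo] -->
   \int[mu]_(x in \bigcup_n F n) (x `^ (be - 1))%:E)%E.
  apply: ge0_nondecreasing_set_cvg_integral.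
  - move=> n m nm; apply/subsetPset => x; rewrite /F /= !in_itv /= => /andP[nx ->].
    rewrite andbT; apply: le_trans nx; rewrite ler_wpM2l ?(ltW de0) //.
    by rewrite lef_pV2 ?posrE ?ltr0n // ler_nat.
  - by move=> n; exact: measurable_itv.
  - move=> n; apply/measurable_EFinP; apply: measurable_funTS; exact: measurable_powR.
  - by move=> n x _; rewrite lee_fin powR_ge0.
rewrite FE -(cvg_lim _ H) //; apply: lime_le; first by apply/cvg_ex; eexists; exact: H.
apply: nearW => n; case: n => [|n].
  by rewrite /F divr1 set_itv1 integral_set1 lee_fin divr_ge0 ?powR_ge0 ?ltW.
have dn : 0 < de / n.+2%:R by rewrite divr_gt0 // ltr0n.
have dnd : de / n.+2%:R < de.
  by rewrite ltr_pdivrMr ?ltr0n // -[ltLHS]mulr1 ltr_pM2l // ltr1n.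
have pos x : x \in `[de / n.+2%:R, de] -> 0 < x.
  by rewrite in_itv /= => /andP[+ _]; apply: lt_le_trans.
have dF (x : R) : 0 < x -> is_derive x (1 : R) (fun x : R => x `^ be / be) (x `^ (be - 1)).
  move=> x0; have -> : (fun x : R => x `^ be / be) = (be^-1 \*: (fun y : R => (y `^ be : R^o))).
    by apply/funext => y; rewrite mulrC.
  have d := is_derive1_powR be x0.
  apply: is_derive_eq; rewrite -[LHS]/(be^-1 * _) mulrA mulVf ?mul1r //.
  exact: lt0r_neq0.
rewrite /F (@continuous_FTC2 _ _ (fun x => x `^ be / be)) //.
- by rewrite -EFinB lee_fin lerBlDr lerDl divr_ge0 ?powR_ge0 ?ltW.
- apply: continuous_in_subspaceT => x; rewrite inE /= => /pos x0.
  by apply: differentiable_continuous; apply/derivable1_diffP; apply: derivable_powR; rewrite in_itv /= x0.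
- have ct (x : R) : 0 < x -> {for x, continuous (fun x : R => x `^ be / be)}.
    by move=> /dF [d _]; apply: differentiable_continuous; exact/derivable1_diffP.
  split.
  + by move=> x; move/subset_itv_oo_cc/pos/dF => [].
  + by apply: cvg_at_right_filter; exact: ct.
  + by apply: cvg_at_left_filter; exact: ct.
- by move=> x; move/subset_itv_oo_cc/pos/dF => H'; rewrite derive1E derive_val.
Qed.

(** The value [+oo] at 0 keeps a product of two such functions above the planar
    singularity on the coordinate axes, at no cost for the integral. *)
Definition ksing (x : R) : \bar R :=
  if x == 0 then +oo%E else if `|x| <= de then (`|x| `^ (be - 1))%:E else 0%E.

Lemma ksing_ge0 x : (0 <= ksing x)%E.
Proof. by rewrite /ksing; case: ifP => // _; case: ifP => // _; rewrite lee_fin powR_ge0. Qed.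

Let ksingE : ksing = (fun x => (EFin \o g) x + ((EFin \o g) (- 1 * x + 0)%R + (cst +oo%E \_ [set 0%R]) x))%E.
Proof.
apply/funext => x; rewrite /ksing patchE; case: ifPn => [/eqP ->|x0].
  by rewrite mem_set //= /g ltxx mulr0 addr0 ltxx /= !add0e.
rewrite memNset /=; last exact/eqP.
rewrite adde0 mulN1r addr0 -EFinD /g.
have [xp|xn] : 0 < x \/ x < 0 by case: (ltgtP x 0) x0; auto.
  by rewrite xp gtr0_norm // [0 < - x]oppr_gt0 ltNge (ltW xp) /= addr0; case: ifP.
by rewrite ltr0_norm // [0 < - x]oppr_gt0 xn ltNge (ltW xn) /= add0r; case: ifP.
Qed.

Let mc : measurable_fun [set: R] (cst +oo%E \_ [set 0%R] : R -> \bar R).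
Proof. by apply/(measurable_restrictT _ _).1 => //; exact: measurable_cst. Qed.

Let mgN : measurable_fun [set: R] (fun x => (EFin \o g) (- 1 * x + 0)%R).
Proof.
by apply: measurableT_comp => //; apply: measurable_funD => //.
Qed.

Lemma measurable_ksing : measurable_fun [set: R] ksing.
Proof.
by rewrite ksingE; apply: emeasurable_funD => //; apply: emeasurable_funD.
Qed.

(** Two half-lines and a null point. *)
Lemma integral_ksing : (\int[mu]_x ksing x <= (2 * (de `^ be / be))%:E)%E.
Proof.
have c0 x : (0 <= (cst +oo%E \_ [set 0%R] : R -> \bar R) x)%E.
  by rewrite patchE; case: ifP => _; rewrite ?lexx ?leey.
rewrite ksingE ge0_integralD //; last 2 first.
- by move=> x _; rewrite adde_ge0.
- exact: emeasurable_funD.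
rewrite ge0_integralD //; first last.
rewrite -integral_mkcond integral_set1 adde0.
have := ge0_integral_affine 0 (a := -1) _ mg g0.
rewrite oppr_eq0 oner_eq0 normrN1 mul1e => /(_ isT) <-.
by rewrite mulr_natl mulr2n EFinD leeD.
Qed.

End SingularLine.

(** * Measurability of complex functions of two real variables *)

(** Lebesgue measure is carried by pairs of reals, the functions by [R[i]]. *)
Definition pc (R : realType) (p : R * R) : R[i] := p.1 +i* p.2.

Section ComplexMeasurability.
Variable R : realType.
Local Notation C := R[i].
Variable E : set (R * R).
Hypothesis mE : measurable E.

Definition cmeas (F : C -> C) := measurable_fun E (fun p => complex.Re (F (pc p))) /\
  measurable_fun E (fun p => complex.Im (F (pc p))).

Lemma cmeas_ext (F G : C -> C) : (forall p, E p -> F (pc p) = G (pc p)) ->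
  cmeas F -> cmeas G.
Proof.
move=> FG [m1 m2]; split; [apply: eq_measurable_fun m1|apply: eq_measurable_fun m2];
by move=> p; rewrite inE => /FG ->.
Qed.

Lemma cmeas_cst c : cmeas (fun=> c).
Proof. by split; exact: measurable_cst. Qed.

Lemma cmeas_id : cmeas id.
Proof. by split; apply: measurable_funTS => /=; [exact: measurable_fst|exact: measurable_snd]. Qed.

Lemma cmeas_conj F : cmeas F -> cmeas (fun z => (F z)^*).
Proof.
move=> [m1 m2]; split.
  by apply: eq_measurable_fun m1 => p _ /=; case: (F _).
apply: eq_measurable_fun (measurable_funN m2) => p _ /=; by case: (F _).
Qed.

Lemma cmeasD F G : cmeas F -> cmeas G -> cmeas (fun z => F z + G z).
Proof.
move=> [m1 m2] [n1 n2]; split.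
  by apply: eq_measurable_fun (measurable_funD m1 n1) => p _ /=; case: (F _) (G _) => ? ? [].
by apply: eq_measurable_fun (measurable_funD m2 n2) => p _ /=; case: (F _) (G _) => ? ? [].
Qed.

Lemma cmeasM F G : cmeas F -> cmeas G -> cmeas (fun z => F z * G z).
Proof.
move=> [m1 m2] [n1 n2]; split.
  by apply: eq_measurable_fun (measurable_funB (measurable_funM m1 n1) (measurable_funM m2 n2)) => p _ /=; case: (F _) (G _) => ? ? [].
by apply: eq_measurable_fun (measurable_funD (measurable_funM m1 n2) (measurable_funM m2 n1)) => p _ /=; case: (F _) (G _) => ? ? [].
Qed.

Lemma cmeasN F : cmeas F -> cmeas (fun z => - F z).
Proof.
move=> /(cmeasM (cmeas_cst (-1))); apply: cmeas_ext => p _.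
by rewrite mulN1r.
Qed.

Lemma cmeasB F G : cmeas F -> cmeas G -> cmeas (fun z => F z - G z).
Proof. by move=> mF /cmeasN; exact: cmeasD. Qed.

Lemma cmeasX F n : cmeas F -> cmeas (fun z => F z ^+ n).
Proof.
move=> mF; elim: n => [|n IH]; first exact: cmeas_cst.
by apply: cmeas_ext (cmeasM mF IH) => p _; rewrite exprS.
Qed.

Lemma cmeas_real (h : C -> R) : measurable_fun E (fun p => h (pc p)) ->
  cmeas (fun z => (h z)%:C).
Proof. by move=> mh; split=> //=; exact: measurable_cst. Qed.

Lemma measurable_normc F : cmeas F -> measurable_fun E (fun p => normc (F (pc p))).
Proof.
move=> [m1 m2].
apply: (eq_measurable_fun (fun p => Num.sqrt (complex.Re (F (pc p)) ^+ 2 + complex.Im (F (pc p)) ^+ 2))).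
  by move=> p _; rewrite /normc; case: (F _).
apply: measurableT_comp.
  by apply: continuous_measurable_fun; exact: sqrt_continuous.
by apply: measurable_funD; apply: measurable_funX.
Qed.

Lemma measurable_fun_inv (h : R * R -> R) : measurable_fun E h ->
  measurable_fun E (fun p => (h p)^-1).
Proof.
(* the real power of exponent -1 is the inverse only on nonnegative reals *)
move=> mh; apply: (eq_measurable_fun (fun p => h p * (h p ^+ 2) `^ (-1))).
  move=> p _; rewrite powR_inv1 ?sqr_ge0 //.
  by have [->|h0] := eqVneq (h p) 0; [rewrite invr0 mul0r|field].
apply: measurable_funM => //.
exact: measurableT_comp (measurable_powR (-1)) (measurable_funX 2 mh).
Qed.

Lemma cmeasV F : cmeas F -> cmeas (fun z => (F z)^-1).
Proof.
move=> mF; have m2 := measurable_fun_inv (measurable_funX 2 (measurable_normc mF)).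
apply: cmeas_ext (cmeasM (cmeas_conj mF) (cmeas_real (h := fun z => normc (F z) ^- 2) m2)) => p _.
have -> : (normc (F (pc p)) ^- 2)%:C = (F (pc p) * (F (pc p))^*)^-1 by rewrite mulcJ fmorphV.
have [->|F0] := eqVneq (F (pc p)) 0.
  by rewrite !mul0r invr0 mulr0.
field; rewrite F0 /=; by rewrite conjC_eq0.
Qed.

Lemma cmeas_ln F : cmeas F -> cmeas (fun z => (ln (normc (F z)))%:C).
Proof.
by move=> mF; apply: cmeas_real; apply: measurableT_comp (@measurable_ln R) (measurable_normc mF).
Qed.

End ComplexMeasurability.

(** * A weak singularity in the plane *)

Section SingularPlane.
Variable R : realType.
Local Notation C := R[i].
Local Notation mu := (@lebesgue_measure R).
Local Notation mu2 := (mu \x mu)%E.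
Variable be : R.
Hypotheses (be0 : 0 < be) (be1 : be < 1).

(** The common majorant of all singular kernels. For [0 < be] its integral over a
    small box is small uniformly in [c]; for [be < 1 / 2] it dominates
    [|z - c|^-1] on bounded sets, up to a constant. *)
Definition msing (c z : C) : R := normc (z - c) `^ (2 * be - 2).

Lemma msing_ge0 c z : 0 <= msing c z.
Proof. exact: powR_ge0. Qed.

Lemma measurable_msing E c : measurable_fun E (fun p => msing c (pc p)).
Proof.
apply: measurable_funTS; apply: measurableT_comp (measurable_powR _) _.
exact: (measurable_normc (cmeasB (cmeas_id setT) (cmeas_cst setT c))).
Qed.

(** Since |x| |y| <= |x + i y|^2, the planar singularity is at most a product of
    two linear ones, whose integral factors. *)
Lemma msing_le (de : R) c p : 0 < de ->
  `|p.1 - complex.Re c| <= de -> `|p.2 - complex.Im c| <= de ->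
  ((msing c (pc p))%:E <= ksing be de (p.1 - complex.Re c) * ksing be de (p.2 - complex.Im c))%E.
Proof.
move=> de0; case: c => a b /=; set x := p.1 - a; set y := p.2 - b => xd yd.
have kpos t : `|t| <= de -> (0 < ksing be de t)%E.
  move=> td; rewrite /ksing; case: ifPn => // t0; rewrite td lte_fin powR_gt0 //.
  by rewrite normr_gt0.
have [x0|x0] := eqVneq x 0.
  by rewrite {1}/ksing x0 eqxx gt0_mulye ?leey // kpos.
have [y0|y0] := eqVneq y 0.
  by rewrite {2}/ksing y0 eqxx gt0_muley ?leey // kpos.
rewrite /ksing (negbTE x0) (negbTE y0) xd yd -EFinM lee_fin -powRM //.
rewrite /msing; set n := normc _.
have nE : n ^+ 2 = x ^+ 2 + y ^+ 2 by rewrite /n sqr_normc_ReIm.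
have xy0 : 0 < `|x| * `|y| by rewrite mulr_gt0 ?normr_gt0.
have nxy : `|x| * `|y| <= n ^+ 2.
  rewrite nE -(real_normK (num_real x)) -(real_normK (num_real y)).
  have := sqr_ge0 (`|x| - `|y|); nra.
have -> : 2 * be - 2 = 2%:R * (be - 1) by ring.
rewrite powRrM powR_mulrn ?normc_ge0 //.
have -> : be - 1 = - (1 - be) by ring.
rewrite !powRN lef_pV2 ?posrE ?powR_gt0 //; last exact: lt_le_trans nxy.
by apply: ge0_ler_powR; rewrite ?nnegrE ?sqr_ge0 ?subr_ge0 // ltW.
Qed.

(** The bound depends on the size of the box only, not on the position of [c],
    and tends to 0 with [de]. *)
Lemma integral_msing_box (E : set (R * R)) (de : R) c : 0 < de -> measurable E ->
  (forall p, E p -> `|p.1 - complex.Re c| <= de /\ `|p.2 - complex.Im c| <= de) ->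
  (\int[mu2]_(p in E) (msing c (pc p))%:E <= ((2 * (de `^ be / be)) ^+ 2)%:E)%E.
Proof.
move=> de0 mE Ec; pose k1 x := ksing be de (x - complex.Re c).
pose k2 y := ksing be de (y - complex.Im c).
have mk (t : R) : measurable_fun setT (fun x : R => ksing be de (x - t)).
  apply: measurableT_comp; first exact: measurable_ksing.
  by apply: measurable_funB.
have k0 t : (0 <= ksing be de t)%E by exact: ksing_ge0.
have ik (t : R) : (\int[mu]_x ksing be de (x - t)%R <= (2 * (de `^ be / be))%:E)%E.
  have := ge0_integral_affine (- t) (oner_neq0 R) (measurable_ksing be de) k0.
  rewrite normr1 mul1e => E1.
  have -> : (\int[mu]_x ksing be de (x - t)%R = \int[mu]_x ksing be de (1 * x - t)%R)%E.
    by apply: eq_integral => x _; rewrite mul1r.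
  by rewrite -E1; exact: integral_ksing.
have k10 x : (0 <= k1 x)%E by exact: k0.
have k20 x : (0 <= k2 x)%E by exact: k0.
have mkk : measurable_fun setT (fun p : R * R => (k1 p.1 * k2 p.2)%E).
  apply: emeasurable_funM.
    exact: (measurableT_comp (mk _) measurable_fst).
  exact: (measurableT_comp (mk _) measurable_snd).
apply: (@le_trans _ _ (\int[mu2]_(p in E) (k1 p.1 * k2 p.2))%E).
  apply: ge0_le_integral => //.
  - by move=> p _; rewrite lee_fin msing_ge0.
  - by apply/measurable_EFinP; exact: measurable_msing.
  - exact: measurable_funTS.
  - by move=> p /Ec [h1 h2]; exact: msing_le.
apply: (@le_trans _ _ (\int[mu2]_p (k1 p.1 * k2 p.2))%E).
  by apply: ge0_subset_integral => // p _; rewrite mule_ge0.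
rewrite fubini_tonelli1 //; last by move=> p; rewrite mule_ge0.
rewrite /fubini_F /=.
have -> : (\int[mu]_x \int[mu]_y (k1 x * k2 y) = \int[mu]_x (k1 x * \int[mu]_y k2 y))%E.
  by apply: eq_integral => x _; rewrite ge0_integralZl //; exact: mk.
rewrite ge0_integralZr //; [|exact: mk|by apply: integral_ge0].
rewrite expr2 EFinM; apply: lee_pmul; rewrite ?ik //; apply: integral_ge0 => //.
Qed.

End SingularPlane.

(** * Integration in slope coordinates *)

Section SlopeCoordinates.
Variable R : realType.
Local Notation mu := (@lebesgue_measure R).
Local Notation mu2 := (mu \x mu)%E.
Implicit Type f : R * R -> \bar R.

Lemma ge0_integral_plane_affine f (s a b : R) : s != 0 -> measurable_fun setT f ->
  (forall p, 0 <= f p)%E ->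
  (\int[mu2]_p f p = (s ^+ 2)%:E * \int[mu2]_p f (s * p.1 + a, s * p.2 + b)%R)%E.
Proof.
move=> s0 mf f0.
have msh (t : R) : measurable_fun setT (fun x : R => s * x + t).
  by apply: measurable_funD => //; exact: measurable_funM.
have mf2 : measurable_fun setT (fun p : R * R => f (s * p.1 + a, s * p.2 + b)%R).
  apply: measurableT_comp => //; apply: measurable_fun_pair.
    exact: (measurableT_comp (msh a) measurable_fst).
  exact: (measurableT_comp (msh b) measurable_snd).
have mF2 : measurable_fun setT (fubini_F mu (fun p : R * R => f (s * p.1 + a, s * p.2 + b)%R)).
  exact: measurable_fun_fubini_tonelli_F.
rewrite fubini_tonelli1 // [in RHS]fubini_tonelli1 // /fubini_F /=.
have mfx (x : R) : measurable_fun setT (fun y : R => f (x, y)).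
  exact: measurableT_comp mf (measurable_pair1 x).
have mF : measurable_fun setT (fubini_F mu f) by exact: measurable_fun_fubini_tonelli_F.
rewrite (ge0_integral_affine a s0 mF); last by move=> x; exact: integral_ge0.
have -> : (\int[mu]_x fubini_F mu f (s * x + a)%R =
   \int[mu]_x (`|s|%:E * \int[mu]_y f (s * x + a, s * y + b)%R))%E.
  by apply: eq_integral => x _; rewrite /fubini_F (ge0_integral_affine b s0 (mfx _)).
rewrite ge0_integralZl //.
- by rewrite muleA -EFinM -expr2 real_normK ?num_real.
- by move=> x _; exact: integral_ge0.
Qed.

(** Substitute y = x m on each vertical line and exchange the integrals. These
    coordinates do the work of polar ones with linear changes of variable
    only; the hypothesis on [f] is about the one line that they miss. *)
Lemma ge0_integral_slope f : measurable_fun setT f -> (forall p, 0 <= f p)%E ->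
  (forall y, f (0, y)%R = 0%E) ->
  (\int[mu2]_p f p = \int[mu]_m \int[mu]_x (`|x|%:E * f (x, x * m)%R))%E.
Proof.
move=> mf f0 f00.
have mfx (x : R) : measurable_fun setT (fun y : R => f (x, y)).
  exact: measurableT_comp mf (measurable_pair1 x).
have mfm (x : R) : measurable_fun setT (fun m : R => f (x, x * m)%R).
  by apply: measurableT_comp mf _; apply: measurable_fun_pair.
rewrite (fubini_tonelli1 (m1 := mu) (m2 := mu) f mf f0) /fubini_F /=.
have -> : (\int[mu]_x \int[mu]_y f (x, y) =
   \int[mu]_x \int[mu]_m (`|x|%:E * f (x, x * m)%R))%E.
  apply: eq_integral => x _; have [->|x0] := eqVneq x 0.
    by rewrite !integral0_eq // => y _; rewrite ?mul0r ?f00 ?mule0.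
  rewrite (ge0_integral_affine 0 x0 (mfx _)) // ge0_integralZl //; last exact: mfm.
  by congr (_ * _)%E; apply: eq_integral => y _; rewrite addr0.
apply: (@fubini_tonelli _ _ _ _ R mu mu (fun p : R * R => (`|p.1|%:E * f (p.1, p.1 * p.2)%R)%E)).
- apply: emeasurable_funM.
    by apply/measurable_EFinP; apply: measurableT_comp => //; exact: measurable_fst.
  apply: measurableT_comp => //; apply: measurable_fun_pair; first exact: measurable_fst.
  by apply: measurable_funM; [exact: measurable_fst|exact: measurable_snd].
- by move=> p; rewrite mule_ge0.
Qed.

End SlopeCoordinates.

(** * Integrals of rational functions on the line *)

Section RationalIntegrals.
Variable R : realType.
Local Notation mu := (@lebesgue_measure R).

Let q0 (m : R) : 0 < 1 + m ^+ 2.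
Proof. by rewrite ltr_pwDl // sqr_ge0. Qed.
Let qn0 (m : R) : 1 + m ^+ 2 != 0.
Proof. exact: lt0r_neq0. Qed.

Let cq : continuous (fun m : R => (1 + m ^+ 2)^-1).
Proof. exact: continuous_oneDsqrV. Qed.

Lemma integrable_invDsqr : mu.-integrable setT (EFin \o (fun m : R => (1 + m ^+ 2)^-1)).
Proof.
apply/integrableP; split.
  by apply/measurable_EFinP; exact: continuous_measurable_fun.
have -> : (\int[mu]_x `|(EFin \o (fun m : R => (1 + m ^+ 2)^-1)%R) x| =
   \int[mu]_x ((1 + x ^+ 2)^-1)%:E)%E.
  by apply: eq_integral => x _ /=; rewrite ger0_norm // invr_ge0 ltW.
rewrite ge0_symfun_integralT //.
- have -> : [set x : R | (0 <= x)%R] = `[0%R, +oo[%classic.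
    by apply/seteqP; split => x /=; rewrite in_itv /= andbT.
  by have := integral0y_oneDsqr R; rewrite /oneDsqr => ->; rewrite -EFinM ltry.
- by move=> x; rewrite invr_ge0 ltW.
- by move=> x /=; rewrite sqrrN.
Qed.

Lemma integral_invDsqr2 : (\int[mu]_m ((1 + m ^+ 2) ^- 2)%:E = (pi / 2)%:E)%E.
Proof.
have cq2 : continuous (fun m : R => (1 + m ^+ 2) ^- 2).
  have -> : (fun m : R => (1 + m ^+ 2) ^- 2) = (fun m => (1 + m ^+ 2)^-1 * (1 + m ^+ 2)^-1).
    by apply/funext => m; rewrite -exprVn expr2.
  by move=> m; apply: cvgM; exact: cq.
rewrite ge0_symfun_integralT //; last first.
- by move=> x /=; rewrite sqrrN.
- by move=> x; rewrite invr_ge0 exprn_ge0 // ltW.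
have -> : [set x : R | (0 <= x)%R] = `[0%R, +oo[%classic.
  by apply/seteqP; split => x /=; rewrite in_itv /= andbT.
pose F (m : R) := 2^-1 * (m * (1 + m ^+ 2)^-1 + atan m).
have dF (m : R) : is_derive m (1 : R) F ((1 + m ^+ 2) ^- 2).
  rewrite /F; apply: is_derive_eq => //=.
  rewrite /GRing.scale /=; field; exact: qn0.
have cF (m : R) : {for m, continuous F}.
  by have [d _] := dF m; apply: differentiable_continuous; exact/derivable1_diffP.
rewrite (@ge0_continuous_FTC2y _ _ F _ (pi / 4)) //.
- have F0 : F 0 = 0 by rewrite /F mul0r atan0 addr0 mulr0.
  by rewrite F0 -EFinB -EFinM; congr EFin; field.
- by move=> x _; rewrite invr_ge0 exprn_ge0 // ltW.
- by apply: continuous_subspaceT.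
- have -> : (pi : R) / 4 = 2^-1 * (0 + pi / 2) by field.
  apply: cvgMr; apply: cvgD; last exact: cvgy_atan.
  apply/cvgrPdist_le => e e0; near=> m.
  have m0 : 0 < m by near: m; exact: nbhs_pinfty_gt.
  have me : e^-1 <= m by near: m; apply: nbhs_pinfty_ge; exact: num_real.
  rewrite sub0r normrN ger0_norm; last by rewrite divr_ge0 ?(ltW m0) ?(ltW (q0 _)).
  rewrite ler_pdivrMr //.
  have : 1 <= e * m by rewrite mulrC -ler_pdivrMr // div1r.
  nra.
- by apply: cvg_at_right_filter; exact: cF.
- by move=> x _; rewrite derive1E; have [_ ->] := dF x.
Unshelve. all: by end_near. Qed.

Lemma integral_odd (h : R -> R) : measurable_fun setT h -> (forall x, h (- x) = - h x) ->
  mu.-integrable setT (EFin \o h) -> (\int[mu]_x (h x)%:E = 0)%E.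
Proof.
move=> mh oh ih; rewrite integralE.
have mhe : measurable_fun setT (EFin \o h) by exact/measurable_EFinP.
have -> : (\int[mu]_x (fun x : R => (h x)%:E)^\- x = \int[mu]_x (fun x : R => (h x)%:E)^\+ x)%E.
  have n1 : (-1 : R) != 0 by rewrite oppr_eq0 oner_eq0.
  rewrite [RHS](ge0_integral_affine 0 n1 (measurable_funepos mhe)) //.
  rewrite normrN1 mul1e; apply: eq_integral => x _.
  by rewrite funenegE funeposE /= addr0 mulN1r oh EFinN.
rewrite subee //.
have := integrable_fin_num (measurableT) (integrable_funepos measurableT ih).
exact.
Qed.

End RationalIntegrals.

(** * The real part of the Cauchy kernel on a disk *)

Section DiskCauchyKernel.
Variables (R : realType) (r : R).
Hypothesis r0 : 0 < r.
Local Notation C := R[i].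
Local Notation mu := (@lebesgue_measure R).
Local Notation mu2 := (mu \x mu)%E.
Local Notation D2 := [set p : R * R | cdisk r (pc p)].

Lemma cdisk_pcE (p : R * R) : cdisk r (pc p) = (p.1 ^+ 2 + p.2 ^+ 2 <= r ^+ 2) :> Prop.
Proof.
rewrite /cdisk /= -(ler_pXn2r (n := 2)) ?nnegrE ?normc_ge0 ?(ltW r0) //.
by rewrite sqr_normc_ReIm.
Qed.

Lemma measurable_le_set (h : R * R -> R) (t : R) : measurable_fun setT h ->
  measurable [set p | h p <= t].
Proof.
move=> mh; have := mh measurableT _ (measurable_itv `]-oo, t]).
by congr measurable; apply/seteqP; split => p /=; rewrite in_itv /=; tauto.
Qed.

Lemma measurable_lt_set (h : R * R -> R) (t : R) : measurable_fun setT h ->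
  measurable [set p | t < h p].
Proof.
move=> mh; have := mh measurableT _ (measurable_itv `]t, +oo[).
by congr measurable; apply/seteqP; split => p /=; rewrite in_itv /= andbT; tauto.
Qed.

Lemma measurable_D2 : measurable D2.
Proof.
apply: measurable_le_set; exact: (measurable_normc (cmeas_id setT)).
Qed.

Let q0 (m : R) : 0 < 1 + m ^+ 2.
Proof. by rewrite ltr_pwDl // sqr_ge0. Qed.

(** The larger root x of (x + a)^2 + (x m + b)^2 = r^2: the abscissa, counted from
    a, at which the ray of slope m going right from a + i b leaves the disk. *)
Definition chord (a b m : R) : R :=
  (- (a + b * m) + Num.sqrt ((a + b * m) ^+ 2 + (1 + m ^+ 2) * (r ^+ 2 - (a ^+ 2 + b ^+ 2))))
    / (1 + m ^+ 2).

Section Chord.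
Variables (a b : R).
Hypothesis ab : a ^+ 2 + b ^+ 2 <= r ^+ 2.

Let sqrt_ge m : `|a + b * m| <= Num.sqrt ((a + b * m) ^+ 2 + (1 + m ^+ 2) * (r ^+ 2 - (a ^+ 2 + b ^+ 2))).
Proof.
by rewrite -sqrtr_sqr ler_wsqrtr // lerDl mulr_ge0 ?(ltW (q0 _)) // subr_ge0.
Qed.

Lemma chord_ge0 m : 0 <= chord a b m.
Proof.
rewrite /chord divr_ge0 ?(ltW (q0 _)) //.
by have := sqrt_ge m; have := ler_norm (a + b * m); lra.
Qed.

Lemma chordP m x : 0 < x ->
  ((x + a) ^+ 2 + (x * m + b) ^+ 2 <= r ^+ 2) = (x <= chord a b m).
Proof.
move=> x0; rewrite /chord ler_pdivlMr //.
have := sqrt_ge m; have q := q0 m.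
set De := (X in Num.sqrt X); set s := Num.sqrt De => sge.
have De0 : 0 <= De.
  by rewrite addr_ge0 ?sqr_ge0 // mulr_ge0 ?(ltW q) // subr_ge0.
have sE : s ^+ 2 = De by rewrite sqr_sqrtr.
have s0 : 0 <= s by exact: sqrtr_ge0.
have n1 := ler_norm (a + b * m); have n2 := ler_norm (- (a + b * m)).
rewrite normrN in n2.
have E : (1 + m ^+ 2) * ((x + a) ^+ 2 + (x * m + b) ^+ 2 - r ^+ 2) =
  (x * (1 + m ^+ 2) + (a + b * m)) ^+ 2 - s ^+ 2 by rewrite sE /De; ring.
have xq : 0 < x * (1 + m ^+ 2) by rewrite mulr_gt0.
apply/idP/idP => H.
- have : (1 + m ^+ 2) * ((x + a) ^+ 2 + (x * m + b) ^+ 2 - r ^+ 2) <= 0.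
    by rewrite mulr_ge0_le0 ?(ltW q) // subr_le0.
  rewrite E subr_le0 => /(ler_wpM2l ler01) H2.
  have : `|x * (1 + m ^+ 2) + (a + b * m)| <= s.
    by rewrite -(ler_pXn2r (n := 2)) ?nnegrE // real_normK ?num_real //; lra.
  by have := ler_norm (x * (1 + m ^+ 2) + (a + b * m)); lra.
- rewrite -subr_le0 -(pmulr_rle0 _ q) E subr_le0.
  by rewrite -[leLHS](real_normK (num_real _)) ler_pXn2r ?nnegrE // ler_norml; lra.
Qed.

Lemma chord_le m : chord a b m <= 2 * r.
Proof.
have := chord_ge0 m; rewrite le_eqVlt => /predU1P[<-|c0]; first by rewrite mulr_ge0 // ltW.
have := chordP m c0; rewrite lexx.
set c := chord _ _ _ => H.
have c2 : (c + a) ^+ 2 <= r ^+ 2 by have := sqr_ge0 (c * m + b); lra.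
have a2 : a ^+ 2 <= r ^+ 2 by have := ab; have := sqr_ge0 b; lra.
have : `|c + a| <= r by rewrite -(ler_pXn2r (n := 2)) ?nnegrE ?(ltW r0) // real_normK ?num_real.
have : `|a| <= r by rewrite -(ler_pXn2r (n := 2)) ?nnegrE ?(ltW r0) // real_normK ?num_real.
have := ler_norm (c + a); have := ler_norm (- a); rewrite normrN; lra.
Qed.

End Chord.

Lemma measurable_chord a b : measurable_fun setT (chord a b).
Proof.
have ms : measurable_fun setT (fun m : R => a + b * m).
  by apply: measurable_funD => //; exact: measurable_funM.
have mq : measurable_fun setT (fun m : R => 1 + m ^+ 2).
  by apply: measurable_funD => //; exact: measurable_funX.
apply: measurable_funM; last by apply: continuous_measurable_fun; exact: continuous_oneDsqrV.
apply: measurable_funD; first exact: measurable_funN.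
apply: measurableT_comp.
  by apply: continuous_measurable_fun; exact: sqrt_continuous.
by apply: measurable_funD; [exact: measurable_funX|exact: measurable_funM].
Qed.

Let S a b := [set p : R * R | 0 < p.1] `&` [set p | (p.1 + a) ^+ 2 + (p.2 + b) ^+ 2 <= r ^+ 2].
Let g (p : R * R) : R := p.1 / (p.1 ^+ 2 + p.2 ^+ 2).
Let gpos a b : R * R -> \bar R := (EFin \o g) \_ (S a b).

Let mS a b : measurable (S a b).
Proof.
apply: measurableI; first by apply: measurable_lt_set; exact: measurable_fst.
apply: measurable_le_set; apply: measurable_funD; apply: measurable_funX.
  by apply: measurable_funD => //; exact: measurable_fst.
by apply: measurable_funD => //; exact: measurable_snd.
Qed.

Let mg : measurable_fun setT g.
Proof.
apply: measurable_funM; first exact: measurable_fst.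
apply: measurable_fun_inv; apply: measurable_funD; apply: measurable_funX.
  exact: measurable_fst.
exact: measurable_snd.
Qed.

Let mgpos a b : measurable_fun setT (gpos a b).
Proof.
apply/(measurable_restrictT _ _).1 => //; apply/measurable_EFinP.
exact: measurable_funTS.
Qed.

Let gpos0 a b p : (0 <= gpos a b p)%E.
Proof.
rewrite /gpos patchE; case: ifPn => //; rewrite inE => -[/= p0 _].
by rewrite lee_fin /g divr_ge0 ?addr_ge0 ?sqr_ge0 // ltW.
Qed.

(** The Jacobian |x| cancels the singularity of x / (x^2 + y^2): along a ray the
    integrand becomes constant. *)
Let int_gpos a b : a ^+ 2 + b ^+ 2 <= r ^+ 2 ->
  (\int[mu2]_p gpos a b p = \int[mu]_m (chord a b m / (1 + m ^+ 2))%:E)%E.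
Proof.
move=> ab; rewrite ge0_integral_slope //; last first.
  by move=> y; rewrite /gpos patchE ifF //; apply/negbTE; rewrite notin_setE => -[/=]; rewrite ltxx.
apply: eq_integral => m _.
have -> : (\int[mu]_x (`|x|%:E * gpos a b (x, x * m)%R) =
  \int[mu]_(x in `]0%R, chord a b m]) ((1 + m ^+ 2)^-1)%:E)%E.
  rewrite [RHS]integral_mkcond; apply: eq_integral => x _; rewrite /gpos !patchE.
  have -> : ((x, x * m) \in S a b) = (x \in `]0, chord a b m]%classic).
    apply/idP/idP; rewrite !inE /S /= in_itv /=.
      by move=> [x0]; rewrite chordP // => ->; rewrite x0.
    by move=> /andP[x0 xc]; split=> //; rewrite chordP.
  case: ifPn => [|_]; last by rewrite mule0.
  rewrite inE /= in_itv /= => /andP[x0 _]; rewrite /g /= -EFinM gtr0_norm //.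
  congr EFin; field; rewrite lt0r_neq0 //= lt0r_neq0 //=.
  have -> : x ^+ 2 + (x * m) ^+ 2 = x ^+ 2 * (1 + m ^+ 2) by ring.
  by rewrite mulr_gt0 // exprn_gt0.
rewrite integral_cst //= lebesgue_measure_itv /= lte_fin.
have := chord_ge0 ab m; rewrite le_eqVlt => /predU1P[<-|c0].
  by rewrite ltxx mule0 mul0r.
by rewrite c0 oppr0 adde0 -EFinM mulrC.
Qed.

Let int_chord_fin a b : a ^+ 2 + b ^+ 2 <= r ^+ 2 ->
  mu.-integrable setT (EFin \o (fun m => chord a b m / (1 + m ^+ 2))).
Proof.
move=> ab; apply: (le_integrable measurableT _ _ (integrableZl measurableT (2 * r) (integrable_invDsqr R))).
- apply/measurable_EFinP; apply: measurable_funM; first exact: measurable_chord.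
  by apply: continuous_measurable_fun; exact: continuous_oneDsqrV.
- move=> m _; have q' : 0 <= (1 + m ^+ 2)^-1 by rewrite invr_ge0 ltW.
  have r2 : 0 <= 2 * r by rewrite mulr_ge0 // ltW.
  have c0 := chord_ge0 ab m.
  rewrite -[X in (`|X| <= _)%E]/((chord a b m * (1 + m ^+ 2)^-1)%:E).
  rewrite -[X in (_ <= `|X|)%E]/((2 * r * (1 + m ^+ 2)^-1)%:E) !abse_EFin lee_fin.
  rewrite (ger0_norm (mulr_ge0 c0 q')) (ger0_norm (mulr_ge0 r2 q')).
  by apply: ler_wpM2r => //; exact: chord_le.
Qed.

(** With s = 1 and s = -1 this gives the positive and the negative part of the
    real part of 1 / (zeta - (a + i b)) on the disk. *)
Let gpos_shift (s a b : R) (p : R * R) : s ^+ 2 = 1 ->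
  gpos (s * a) (s * b) (s * p.1 - s * a, s * p.2 - s * b) =
  ((fun p => maxe (s * g (p.1 - a, p.2 - b))%:E 0%E) \_ D2) p.
Proof.
move=> s1; rewrite /gpos !patchE.
have gs : g (s * p.1 - s * a, s * p.2 - s * b) = s * g (p.1 - a, p.2 - b).
  rewrite /g /= -!mulrBr !exprMn s1 !mul1r; ring.
have DE : D2 p = ((s * p.1 - s * a + s * a) ^+ 2 + (s * p.2 - s * b + s * b) ^+ 2 <= r ^+ 2) :> Prop.
  by rewrite /= cdisk_pcE !subrK !exprMn s1 !mul1r.
have sg : s * g (p.1 - a, p.2 - b) = (s * p.1 - s * a) * ((p.1 - a) ^+ 2 + (p.2 - b) ^+ 2)^-1.
  by rewrite /g /=; ring.
have i0 : 0 <= ((p.1 - a) ^+ 2 + (p.2 - b) ^+ 2)^-1 by rewrite invr_ge0 addr_ge0 ?sqr_ge0.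
case: ifPn => [|pS].
  rewrite inE => -[/= x0 xD]; rewrite mem_set ?DE // gs; apply/esym/max_idPl.
  by rewrite lee_fin sg mulr_ge0 // ltW.
case: ifPn => //; rewrite inE => Dp; apply/esym/max_idPr; rewrite lee_fin sg.
rewrite mulr_le0_ge0 // leNgt; apply/negP => x0.
by move: pS; rewrite notin_setE; apply; split => //=; rewrite -DE.
Qed.

(** The chords in opposite directions carry the same square root, which cancels
    in their difference: what remains is - 2 a / (1 + m^2)^2 plus an odd
    function of m. *)
Lemma integral_Re_inv_disk a b : a ^+ 2 + b ^+ 2 <= r ^+ 2 ->
  (\int[mu2]_(p in D2) (complex.Re (pc p - a +i* b)^-1)%:E = (- (pi * a))%:E)%E.
Proof.
move=> ab; rewrite integralE.
have mab : (- a) ^+ 2 + (- b) ^+ 2 <= r ^+ 2 by rewrite !sqrrN.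
have ReE (p : R * R) : complex.Re (pc p - a +i* b)^-1 = g (p.1 - a, p.2 - b) by [].
have key (s : R) : s ^+ 2 = 1 -> s != 0 -> (s * a) ^+ 2 + (s * b) ^+ 2 <= r ^+ 2 ->
   (\int[mu2]_(p in D2) (maxe (s * g (p.1 - a, p.2 - b)%R)%:E 0) =
    \int[mu]_m (chord (s * a) (s * b) m / (1 + m ^+ 2))%:E)%E.
  move=> s1 s0 sab; rewrite -int_gpos // integral_mkcond.
  rewrite (@ge0_integral_plane_affine _ (gpos (s * a) (s * b)) s (- (s * a)) (- (s * b))) //.
  by rewrite s1 mul1e; apply: eq_integral => p _; rewrite gpos_shift.
have kp := key 1; rewrite expr1n oner_eq0 !mul1r in kp; have {}kp := kp erefl isT ab.
have kn := key (-1); rewrite sqrrN expr1n oppr_eq0 oner_eq0 !mulN1r in kn.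
have {}kn := kn erefl isT mab.
have -> : (\int[mu2]_(p in D2) (fun p => (complex.Re (pc p - a +i* b)^-1)%:E)^\+ p =
  \int[mu]_m (chord a b m / (1 + m ^+ 2))%:E)%E.
  by rewrite -kp; apply: eq_integral => p _; rewrite funeposE ReE mul1r.
have -> : (\int[mu2]_(p in D2) (fun p => (complex.Re (pc p - a +i* b)^-1)%:E)^\- p =
  \int[mu]_m (chord (- a) (- b) m / (1 + m ^+ 2))%:E)%E.
  by rewrite -kn; apply: eq_integral => p _; rewrite funenegE ReE mulN1r.
rewrite -integralB //; [|exact: int_chord_fin|exact: int_chord_fin].
pose h1 (m : R) := (- (2 * a)) * (1 + m ^+ 2) ^- 2.
pose h2 (m : R) := (- (2 * b)) * (m * (1 + m ^+ 2) ^- 2).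
have -> : (\int[mu]_m ((chord a b m / (1 + m ^+ 2))%:E - (chord (- a) (- b) m / (1 + m ^+ 2))%:E)
  = \int[mu]_m ((h1 m)%:E + (h2 m)%:E))%E.
  apply: eq_integral => m _; rewrite -EFinB -EFinD; congr EFin.
  rewrite /chord /h1 /h2 !sqrrN.
  have -> : - a + - b * m = - (a + b * m) by ring.
  rewrite sqrrN; set s := Num.sqrt _; field; exact: lt0r_neq0.
have cq : continuous (fun m : R => (1 + m ^+ 2)^-1) := @continuous_oneDsqrV R.
have mq : measurable_fun setT (fun m : R => (1 + m ^+ 2)^-1) by exact: continuous_measurable_fun.
have mq2 : measurable_fun setT (fun m : R => (1 + m ^+ 2) ^- 2).
  by apply: eq_measurable_fun (measurable_funX 2 mq) => m _; rewrite exprVn.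
have qb (m : R) : 0 <= (1 + m ^+ 2) ^- 2 <= (1 + m ^+ 2) ^- 1.
  rewrite invr_ge0 exprn_ge0 ?(ltW (q0 m)) //= expr1 lef_pV2 ?posrE ?exprn_gt0 //.
  by rewrite -[leLHS]mulr1 expr2 ler_wpM2l ?(ltW (q0 m)) // lerDl sqr_ge0.
have i1 : mu.-integrable setT (EFin \o (fun m : R => (1 + m ^+ 2) ^- 2)).
  apply: (le_integrable measurableT _ _ (integrable_invDsqr R)); first exact/measurable_EFinP.
  by move=> m _; have /andP[l u] := qb m; rewrite /= lee_fin !ger0_norm // invr_ge0 ltW.
have i2 : mu.-integrable setT (EFin \o (fun m : R => m * (1 + m ^+ 2) ^- 2)).
  apply: (le_integrable measurableT _ _ (integrable_invDsqr R)).
    by apply/measurable_EFinP; apply: measurable_funM.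
  move=> m _; have p1 : 0 <= (1 + m ^+ 2)^-1 by rewrite invr_ge0 ltW.
  rewrite /= lee_fin normrM (ger0_norm p1) -exprVn (ger0_norm (exprn_ge0 _ p1)).
  rewrite expr2 mulrA ler_piMl // ler_pdivrMr // mul1r ler_norml.
  have := sqr_ge0 (m - 1); have := sqr_ge0 (m + 1); nra.
have ih1 : mu.-integrable setT (EFin \o h1) := integrableZl measurableT (- (2 * a)) i1.
have ih2 : mu.-integrable setT (EFin \o h2) := integrableZl measurableT (- (2 * b)) i2.
rewrite integralD //.
rewrite [X in (_ + X)%E](_ : _ = 0%E); last first.
  apply: integral_odd => //.
  - by apply: measurable_funM => //; apply: measurable_funM.
  - by move=> m; rewrite /h2 sqrrN; ring.
rewrite adde0 (_ : (\int[mu]_x (h1 x)%:E = (- (2 * a))%:E * \int[mu]_x ((1 + x ^+ 2) ^- 2)%:E)%E); last first.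
  by rewrite -integralZl.
by rewrite integral_invDsqr2 -EFinM; congr EFin; field.
Qed.

End DiskCauchyKernel.

(** * Complex integrals over the disk *)

Section ComplexIntegral.
Variables (R : realType) (r : R).
Hypothesis r0 : 0 < r.
Local Notation C := R[i].
Local Notation mu := (@lebesgue_measure R).
Local Notation mu2 := (mu \x mu)%E.
Local Notation D := (cdisk r).
Local Notation D2 := [set p : R * R | cdisk r (pc p)].
Implicit Types F G : C -> C.

Let mD2 : measurable (D2 : set (measurableTypeR R * measurableTypeR R)) := measurable_D2 r.

Definition cint F : C :=
  (\int[mu2]_(p in D2) complex.Re (F (pc p))) +i*
  (\int[mu2]_(p in D2) complex.Im (F (pc p))).

Definition cintegrable F :=
  mu2.-integrable D2 (EFin \o (fun p => complex.Re (F (pc p)))) /\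
  mu2.-integrable D2 (EFin \o (fun p => complex.Im (F (pc p)))).

Lemma pcK (z : C) : pc (complex.Re z, complex.Im z) = z.
Proof. by case: z. Qed.

Lemma cint_ext F G : (forall z, D z -> F z = G z) -> cint F = cint G.
Proof.
by move=> FG; congr (_ +i* _); apply: eq_Rintegral => p; rewrite inE /= => /FG ->.
Qed.

Lemma cintegrable_ext F G : (forall z, D z -> F z = G z) -> cintegrable F -> cintegrable G.
Proof.
move=> FG [h1 h2]; split; [apply: eq_integrable h1|apply: eq_integrable h2] => //;
by move=> p; rewrite inE /= => /FG ->.
Qed.

Lemma cintegrable_bound F (h : R * R -> R) : cmeas D2 F ->
  mu2.-integrable D2 (EFin \o h) -> (forall p, D2 p -> normc (F (pc p)) <= h p) ->
  cintegrable F.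
Proof.
move=> [m1 m2] ih Fh; split; apply: (le_integrable _ _ _ ih) => //.
- exact/measurable_EFinP.
- move=> p Dp /=; rewrite lee_fin; apply: le_trans (ler_norm _).
  exact: le_trans (ler_Re_normc _) (Fh _ Dp).
- exact/measurable_EFinP.
- move=> p Dp /=; rewrite lee_fin; apply: le_trans (ler_norm _).
  exact: le_trans (ler_Im_normc _) (Fh _ Dp).
Qed.

Lemma cintegrable_cst c : cintegrable (fun=> c).
Proof.
have mb : (mu2 D2 < +oo)%E.
  apply: (@le_lt_trans _ _ (mu2 (`[- r, r]%classic `*` `[- r, r]%classic))).
    apply: le_measure; rewrite ?inE //; first exact: measurableX.
    move=> [x y]; rewrite /= cdisk_pcE //= => xy.
    have sq t : t ^+ 2 <= r ^+ 2 -> t \in `[- r, r].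
      move=> tr; rewrite in_itv /= -ler_norml.
      by rewrite -(ler_pXn2r (n := 2)) ?nnegrE ?(ltW r0) // real_normK ?num_real.
    by split; apply: sq; have := sqr_ge0 x; have := sqr_ge0 y; lra.
  rewrite product_measure1E //.
  have E : mu `[- r, r]%classic = (r - - r)%:E.
    by rewrite lebesgue_measure_itv /= lte_fin gtrN.
  rewrite [X in (X * _)%E](_ : _ = (r - - r)%:E); last exact: E.
  by rewrite [X in (_ * X)%E](_ : _ = (r - - r)%:E) ?ltry; last exact: E.
have H (t : R) : mu2.-integrable D2 (EFin \o (fun=> t)).
  apply/integrableP; split; first exact: measurable_cst.
  by rewrite integral_cst //= lte_mul_pinfty.
by split; exact: H.
Qed.

Lemma cintegrable_cmeas F : cintegrable F -> cmeas D2 F.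
Proof. by move=> [/measurable_int/measurable_EFinP h1 /measurable_int/measurable_EFinP h2]. Qed.

Lemma cintegrableD F G : cintegrable F -> cintegrable G -> cintegrable (fun z => F z + G z).
Proof.
move=> [f1 f2] [g1 g2]; split.
  have H := integrableD mD2 f1 g1; apply: eq_integrable H => // p _ /=.
  by case: (F _) (G _) => ? ? [].
have H := integrableD mD2 f2 g2; apply: eq_integrable H => // p _ /=.
by case: (F _) (G _) => ? ? [].
Qed.

Lemma cintD F G : cintegrable F -> cintegrable G ->
  cint (fun z => F z + G z) = cint F + cint G.
Proof.
move=> [f1 f2] [g1 g2]; rewrite /cint; apply/eqP; rewrite eq_complex /=; apply/andP; split; apply/eqP.
  rewrite -RintegralD //; apply: eq_Rintegral => p _.
  by case: (F _) (G _) => ? ? [].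
rewrite -RintegralD //; apply: eq_Rintegral => p _.
by case: (F _) (G _) => ? ? [].
Qed.

Lemma cintegrableZ c F : cintegrable F -> cintegrable (fun z => c * F z).
Proof.
case: c => a b [f1 f2]; split.
  have H := integrableB mD2 (integrableZl mD2 a f1) (integrableZl mD2 b f2); apply: eq_integrable H => // p _ /=.
  by case: (F _) => ? ?.
have H := integrableD mD2 (integrableZl mD2 a f2) (integrableZl mD2 b f1); apply: eq_integrable H => // p _ /=.
by case: (F _) => ? ?.
Qed.

Lemma cintZ c F : cintegrable F -> cint (fun z => c * F z) = c * cint F.
Proof.
case: c => a b [f1 f2]; rewrite /cint; apply/eqP; rewrite eq_complex /=; apply/andP; split; apply/eqP.
  rewrite -!RintegralZl // -RintegralB //; last 2 first.
  - exact: (integrableZl mD2 a f1).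
  - exact: (integrableZl mD2 b f2).
  by apply: eq_Rintegral => p _; case: (F _).
rewrite -!RintegralZl // -RintegralD //; last 2 first.
- exact: (integrableZl mD2 a f2).
- exact: (integrableZl mD2 b f1).
by apply: eq_Rintegral => p _; case: (F _).
Qed.

Lemma cintegrableB F G : cintegrable F -> cintegrable G -> cintegrable (fun z => F z - G z).
Proof.
move=> fF /(cintegrableZ (-1)) /(cintegrableD fF).
by apply: cintegrable_ext => z _; rewrite mulN1r.
Qed.

Lemma cintB F G : cintegrable F -> cintegrable G ->
  cint (fun z => F z - G z) = cint F - cint G.
Proof.
move=> fF fG; rewrite -mulN1r -cintZ // -cintD //; last exact: cintegrableZ.
by apply: cint_ext => z _; rewrite mulN1r.
Qed.

Lemma cintegrable_conj F : cintegrable F -> cintegrable (fun z => (F z)^*).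
Proof.
move=> [f1 f2]; split; first by apply: eq_integrable f1 => // p _ /=; case: (F _).
have H := integrableZl mD2 (-1) f2; apply: eq_integrable H => // p _ /=.
by rewrite -EFinM mulN1r; case: (F _).
Qed.

Lemma cint_conj F : cintegrable F -> cint (fun z => (F z)^*) = (cint F)^*.
Proof.
move=> [f1 f2]; rewrite /cint; apply/eqP; rewrite eq_complex /=; apply/andP; split; apply/eqP.
  by apply: eq_Rintegral => p _; case: (F _).
rewrite -mulN1r -RintegralZl //.
by apply: eq_Rintegral => p _; case: (F _) => a b /=; rewrite mulN1r.
Qed.

Lemma normc_cint F : cintegrable F ->
  ((normc (cint F))%:E <= 2%:E * \int[mu2]_(p in D2) (normc (F (pc p)))%:E)%E.
Proof.
move=> iF; have [f1 f2] := iF; have [m1 m2] := cintegrable_cmeas iF.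
apply: (@le_trans _ _ (`|complex.Re (cint F)| + `|complex.Im (cint F)|)%:E).
  by rewrite lee_fin normc_le_ReIm.
have mn := measurable_normc (conj m1 m2).
rewrite EFinD -[2%R]/(1 + 1)%R EFinD ge0_muleDl // !mul1e; apply: leeD.
- rewrite /= EFin_normr_Rintegral //.
  apply: le_trans (le_abse_integral _ mD2 (measurable_int mu2 f1)) _.
  apply: ge0_le_integral => //.
  + by apply: measurableT_comp => //; exact/measurable_EFinP.
  + exact/measurable_EFinP.
  + by move=> p _; rewrite lee_fin ler_Re_normc.
- rewrite /= EFin_normr_Rintegral //.
  apply: le_trans (le_abse_integral _ mD2 (measurable_int mu2 f2)) _.
  apply: ge0_le_integral => //.
  + by apply: measurableT_comp => //; exact/measurable_EFinP.
  + exact/measurable_EFinP.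
  + by move=> p _; rewrite lee_fin ler_Im_normc.
Qed.

End ComplexIntegral.

(** * Exceptional points and colliding singularities *)

Section DiagonalAndLimits.
Variables (R : realType) (r : R).
Hypothesis r0 : 0 < r.
Local Notation C := R[i].
Local Notation mu := (@lebesgue_measure R).
Local Notation mu2 := (mu \x mu)%E.
Local Notation D := (cdisk r).
Local Notation D2 := [set p : R * R | cdisk r (pc p)].
Implicit Types F G : C -> C.

Let mD2 : measurable (D2 : set (measurableTypeR R * measurableTypeR R)) := measurable_D2 r.

Let delta (c z : C) : C := (\1_[set (complex.Re c, complex.Im c)] (complex.Re z, complex.Im z))%:C.

Let deltaE c z : z != c -> delta c z = 0.
Proof.
move=> zc; rewrite /delta indicE memNset //= => -[a b].
by move/eqP: zc; apply; rewrite -[z]pcK a b pcK.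
Qed.

Let delta1 c : delta c c = 1.
Proof. by rewrite /delta indicE mem_set. Qed.

Let mpt (x : R * R) : measurable ([set x] : set (measurableTypeR R * measurableTypeR R)).
Proof.
case: x => a b; rewrite (_ : [set (a, b)] = [set a] `*` [set b]); first exact: measurableX.
by apply/seteqP; split => -[x y] /= [-> ->].
Qed.

Let cmeas_delta c : cmeas D2 (delta c).
Proof.
apply: cmeas_real => /=; apply: measurable_funTS.
apply: (eq_measurable_fun (\1_[set (complex.Re c, complex.Im c)] : R * R -> R)).
  by move=> [x y] _.
by apply: measurable_indic; exact: mpt.
Qed.

Let cintegrable_delta c : cintegrable r (delta c).
Proof.
apply: (cintegrable_bound (h := fun=> 1)) => //.
  by have [] := cintegrable_cst r0 1.
move=> p _; rewrite /delta normc_real ger0_norm ?indicE; by case: (_ \in _).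
Qed.

Let cint_delta c : cint r (delta c) = 0.
Proof.
rewrite /cint /delta /=; apply/eqP; rewrite eq_complex /=; apply/andP; split; apply/eqP; last first.
  by rewrite /Rintegral integral0.
rewrite /Rintegral.
have -> : (\int[mu2]_(p in D2) (\1_[set (complex.Re c, complex.Im c)] (p.1, p.2))%:E =
  \int[mu2]_(p in D2) (\1_[set (complex.Re c, complex.Im c)] p)%:E)%E.
  by apply: eq_integral => -[].
rewrite integral_indic //.
rewrite [X in fine X](_ : _ = 0%E) //.
have E : mu2 [set (complex.Re c, complex.Im c)] = 0%E.
  rewrite (_ : [set _] = [set complex.Re c] `*` [set complex.Im c]); last first.
    by apply/seteqP; split => -[x y] /= [-> ->].
  by rewrite product_measure1E // [X in (X * _)%E]lebesgue_measure_set1 mul0e.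
by apply: subset_measure0 E => //; exact: measurableI.
Qed.

(** Two functions that agree off [c] differ by a multiple of the indicator of
    [c], which is measurable and has integral 0. Kernels are thereby free to
    take any value on the diagonal. *)
Lemma offdiag_split c F G : (forall z, D z -> z != c -> F z = G z) ->
  forall z, D z -> G z = F z + (G c - F c) * delta c z.
Proof.
move=> FG z Dz; have [->|zc] := eqVneq z c; first by rewrite delta1; ring.
by rewrite deltaE // mulr0 addr0 FG.
Qed.

Lemma cmeas_offdiag c F G : (forall z, D z -> z != c -> F z = G z) ->
  cmeas D2 F -> cmeas D2 G.
Proof.
move=> /offdiag_split E mF.
apply: cmeas_ext (cmeasD mF (cmeasM (cmeas_cst D2 (G c - F c)) (cmeas_delta c))) => p Dp.
by rewrite [RHS]E.
Qed.

Lemma cintegrable_offdiag c F G : (forall z, D z -> z != c -> F z = G z) ->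
  cintegrable r F -> cintegrable r G.
Proof.
move=> /offdiag_split E iF.
have H := cintegrableD iF (cintegrableZ (G c - F c) (cintegrable_delta c)).
by apply: cintegrable_ext H => z Dz; rewrite [RHS]E.
Qed.

Lemma cint_offdiag c F G : (forall z, D z -> z != c -> F z = G z) ->
  cintegrable r F -> cint r F = cint r G.
Proof.
move=> /offdiag_split E iF; rewrite (cint_ext E) cintD //; last exact: cintegrableZ.
by rewrite cintZ // cint_delta mulr0 addr0.
Qed.

Variable be : R.
Hypotheses (be0 : 0 < be) (be1 : be < 1).

Lemma le_box_disk c p : D2 p ->
  `|p.1 - complex.Re c| <= r + normc c /\ `|p.2 - complex.Im c| <= r + normc c.
Proof.
move=> Dp; have H : normc (pc p - c) <= r + normc c.
  by apply: (le_trans (normcD _ _)); rewrite normcN lerD2r.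
have [h1 h2] := (ler_Re_normc (pc p - c), ler_Im_normc (pc p - c)).
by split; [apply: le_trans H; case: c h1 h2 => ? ? |apply: le_trans H; case: c h1 h2].
Qed.

Lemma integrable_msing c : mu2.-integrable D2 (EFin \o (fun p => msing be c (pc p))).
Proof.
apply/integrableP; split; first by apply/measurable_EFinP; exact: measurable_msing.
have rc : 0 < r + normc c by rewrite ltr_wpDr // normc_ge0.
apply: le_lt_trans (ltry _).
have H := integral_msing_box be0 be1 rc mD2 (@le_box_disk c).
apply: le_trans H; rewrite le_eqVlt; apply/orP; left; apply/eqP.
by apply: eq_integral => p _ /=; rewrite ger0_norm ?msing_ge0.
Qed.

(** The constant is 2^2, as the exponent is at least -2. *)
Lemma msing_le_scale (x y : R) : 0 < x -> x <= 2 * y ->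
  y `^ (2 * be - 2) <= 4 * x `^ (2 * be - 2).
Proof.
move=> x0 xy; have y0 : 0 < y by lra.
have -> : 2 * be - 2 = - (2 * (1 - be)) by ring.
have e0 : 0 <= 2 * (1 - be) by have := be1; lra.
rewrite !powRN -[4]invrK -invfM lef_pV2 ?posrE ?mulr_gt0 ?invr_gt0 ?powR_gt0 //.
rewrite ler_pdivrMl //; apply: le_trans (_ : (2 * y) `^ (2 * (1 - be)) <= _).
  by apply: ge0_ler_powR; rewrite ?nnegrE ?(ltW x0) //; lra.
rewrite powRM ?(ltW y0) // ler_wpM2r ?powR_ge0 //.
have -> : (4 : R) = 2 `^ 2 by rewrite powR_mulrn // expr2; ring.
by apply: ler_powR; have := be0; lra.
Qed.

(** The singularities of [N n] at [z] and at [w n] collide in the limit, so no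
    fixed function dominates the sequence. Where [x] is not much closer to
    [w n] than to [z] the fixed singularity at [z] dominates, and dominated
    convergence applies. The remaining [x] lie within [n.+1%:R^-1] of [w n],
    where the integral of the majorant is small whatever the centre. *)
Lemma integral_small_seq (w : nat -> C) (N : nat -> C -> R) (z : C) (C0 : R) :
  0 <= C0 -> (forall n, normc (w n - z) < n.+1%:R^-1) ->
  (forall n, measurable_fun D2 (fun p => N n (pc p))) ->
  (forall n, N n (w n) = 0) -> (forall n, N n z = 0) ->
  (forall n x, D x -> 0 <= N n x <= C0 * (msing be z x + msing be (w n) x)) ->
  (forall x, D x -> N n x @[n --> \oo] --> (0 : R)) ->
  (\int[mu2]_(p in D2) (N n (pc p))%:E @[n --> \oo] --> 0)%E.
Proof.
move=> C00 wlim mN Nw Nz Nb N0.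
(* the points that are at least twice as close to w n as to z *)
pose A n : set (R * R) := [set p | 2 * normc (pc p - w n) <= normc (pc p - z)].
have mnc c : measurable_fun setT (fun p => normc (pc p - c)).
  exact: (measurable_normc (cmeasB (cmeas_id setT) (cmeas_cst setT c))).
have mA n : measurable (A n : set (measurableTypeR R * measurableTypeR R)).
  rewrite /A (_ : [set _ | _] = [set p | 2 * normc (pc p - w n) - normc (pc p - z) <= 0]).
    apply: measurable_le_set; apply: measurable_funB; last exact: mnc.
    by apply: measurable_funM => //; exact: mnc.
  by apply/seteqP; split => p /=; rewrite subr_le0.
pose f n : R * R -> \bar R := (fun p => (N n (pc p))%:E) \_ (~` A n).
pose g n : R * R -> \bar R := (fun p => (N n (pc p))%:E) \_ (A n).
have mNE n : measurable_fun D2 (fun p => (N n (pc p))%:E) by exact/measurable_EFinP.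
have mf n : measurable_fun D2 (f n).
  apply/(measurable_restrict _ (measurableC (mA n)) mD2).
  by apply: measurable_funS (mNE n) => // p [].
have mg n : measurable_fun D2 (g n).
  apply/(measurable_restrict _ (mA n) mD2).
  by apply: measurable_funS (mNE n) => // p [].
have f0 n p : D2 p -> (0 <= f n p)%E.
  by move=> Dp; rewrite /f patchE; case: ifP => // _; rewrite lee_fin; have /andP[] := Nb n _ Dp.
have g0 n p : D2 p -> (0 <= g n p)%E.
  by move=> Dp; rewrite /g patchE; case: ifP => // _; rewrite lee_fin; have /andP[] := Nb n _ Dp.
have split_int n : (\int[mu2]_(p in D2) (N n (pc p))%:E =
   \int[mu2]_(p in D2) f n p + \int[mu2]_(p in D2) g n p)%E.
  rewrite -(@ge0_integralD _ _ _ mu2 _ mD2 _ _ (f0 n) (mf n) (g0 n) (mg n)).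
  apply: eq_integral => p _; rewrite /f /g !patchE in_setC.
  by case: (p \in A n); rewrite /= ?add0e ?adde0.
have cvgE (u : nat -> R) (l : R) : u n @[n --> \oo] --> l -> (u n)%:E @[n --> \oo] --> l%:E.
  by move=> ul; apply/fine_cvgP; split=> //; exact: nearW.
have Nle n x (c : C) : D x -> x != z -> x != w n ->
    msing be z x + msing be (w n) x <= 5 * msing be c x -> N n x <= 5 * C0 * msing be c x.
  move=> Dx _ _ H; have /andP[_] := Nb n _ Dx => /le_trans; apply.
  by rewrite [5 * C0]mulrC -mulrA ler_wpM2l.
have fcv : (\int[mu2]_(p in D2) f n p @[n --> \oo] --> 0)%E.
  have [] := @dominated_convergence _ _ _ mu2 D2 mD2 f (cst 0%E)
    (fun p => ((5 * C0)%:E * (msing be z (pc p))%:E)%E) mf (measurable_cst _).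
  - apply: aeW => p Dp.
    have -> : (fun n => f n p) = (fun n => (if p \in ~` A n then N n (pc p) else 0)%:E).
      by apply/funext => n; rewrite /f patchE; case: ifP.
    apply: cvgE; apply: (squeeze_cvgr _ (cvg_cst 0) (N0 _ Dp)).
    by apply: nearW => n; have /andP[h _] := Nb n _ Dp; case: ifP => _; rewrite ?lexx ?h.
  - by have := integrableZl mD2 (5 * C0) (integrable_msing z).
  - apply: aeW => p n Dp; rewrite gee0_abs ?f0 // /f patchE -EFinM.
    case: ifPn => [|_]; last by rewrite lee_fin !mulr_ge0 ?msing_ge0.
    rewrite inE /A /= => /negP; rewrite -ltNge => nA; rewrite lee_fin.
    have [->|pz] := eqVneq (pc p) z; first by rewrite Nz !mulr_ge0 ?msing_ge0.
    have [->|pw] := eqVneq (pc p) (w n); first by rewrite Nw !mulr_ge0 ?msing_ge0.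
    apply: Nle => //; rewrite /msing.
    have : 0 < normc (pc p - z) by rewrite normc_gt0 subr_eq0.
    by move=> /msing_le_scale /(_ (ltW nA)); lra.
  - by move=> _ _; rewrite integral0.
have gcv : (\int[mu2]_(p in D2) g n p @[n --> \oo] --> 0)%E.
  pose de n : R := n.+1%:R^-1.
  have de0 n : 0 < de n by rewrite invr_gt0 ltr0n.
  pose box n : set (R * R) := [set p | normc (pc p - w n) <= de n].
  have mbox n : measurable (box n : set (measurableTypeR R * measurableTypeR R)).
    by rewrite /box; apply: measurable_le_set; exact: mnc.
  have gle n : (\int[mu2]_(p in D2) g n p <= (5 * C0 * (2 * (de n `^ be / be)) ^+ 2)%:E)%E.
    have mDb : measurable (D2 `&` box n : set (measurableTypeR R * measurableTypeR R)).
      exact: measurableI.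
    apply: (@le_trans _ _ (\int[mu2]_(p in D2 `&` box n) ((5 * C0)%:E * (msing be (w n) (pc p))%:E))%E).
      rewrite (_ : (\int[mu2]_(p in D2 `&` box n) ((5 * C0)%:E * (msing be (w n) (pc p))%:E)
         = \int[mu2]_(p in D2) ((fun p => (5 * C0)%:E * (msing be (w n) (pc p))%:E) \_ (box n) p))%E); last first.
        by rewrite integral_mkcondr.
      apply: ge0_le_integral => //.
      - by move=> p; exact: g0.
      - exact: mg.
      - apply/(measurable_restrict _ (mbox n) mD2); apply: emeasurable_funM => //.
        apply/measurable_EFinP; exact: measurable_msing.
      - move=> p Dp; rewrite /g !patchE.
        have cpos : (0 <= (5 * C0)%:E * (msing be (w n) (pc p))%:E)%E.
          by rewrite -EFinM lee_fin !mulr_ge0 ?msing_ge0.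
        case: ifPn => [|_]; last by case: ifP.
        rewrite inE /A /= => nA; have pzw := normcD (pc p - w n) (w n - z).
        rewrite addrA subrK in pzw; have wd : normc (w n - z) < de n := wlim n.
        rewrite mem_set; last by rewrite /box /=; move: (de n) wd => ? ?; lra.
        rewrite -EFinM lee_fin.
        have [->|pz] := eqVneq (pc p) z; first by rewrite Nz !mulr_ge0 ?msing_ge0.
        have [->|pw] := eqVneq (pc p) (w n); first by rewrite Nw !mulr_ge0 ?msing_ge0.
        apply: Nle => //; rewrite /msing.
        have pw0 : 0 < normc (pc p - w n) by rewrite normc_gt0 subr_eq0.
        have xy : normc (pc p - w n) <= 2 * normc (pc p - z) by lra.
        by have := msing_le_scale pw0 xy; lra.
    rewrite ge0_integralZl //; last 3 first.
    - by apply/measurable_EFinP; exact: measurable_msing.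
    - by move=> p _; rewrite lee_fin msing_ge0.
    - by rewrite lee_fin mulr_ge0.
    rewrite [leRHS]EFinM; apply: lee_wpmul2l; first by rewrite lee_fin mulr_ge0.
    apply: integral_msing_box => // p [_]; rewrite /box /= => pb.
    have [h1 h2] := (ler_Re_normc (pc p - w n), ler_Im_normc (pc p - w n)).
    by split; [apply: le_trans pb; case: (w n) h1 h2 => ? ? |apply: le_trans pb; case: (w n) h1 h2].
  have lim : (5 * C0 * (2 * (de n `^ be / be)) ^+ 2)%:E @[n --> \oo] --> 0%E.
    apply: cvgE.
    have dl : de n `^ be @[n --> \oo] --> (0 : R).
      apply: ((cvg_at_rightP (fun x : R => x `^ be) 0 0).1 (powR_cvg0 be0)).
      by split => //; exact: cvg_harmonic.
    have -> : (0 : R) = 5 * C0 * ((2 * (0 / be)) * (2 * (0 / be))) by rewrite mul0r !mulr0.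
    under eq_cvg do rewrite expr2.
    apply: cvgMr; apply: cvgM; apply: cvgMr; exact: cvgMl.
  apply: (squeeze_cvge _ (cvg_cst 0%E) lim).
  by apply: nearW => n; rewrite gle andbT; apply: integral_ge0 => p; exact: g0.
under eq_cvg do rewrite split_int.
by have := cvgeD _ fcv gcv; rewrite adde0; apply.
Qed.

End DiagonalAndLimits.

(** * Differentiation under the integral sign *)

Section Kernels.
Variables (R : realType) (r be : R).
Hypotheses (r0 : 0 < r) (be0 : 0 < be) (be2 : be < 1 / 2).
Local Notation C := R[i].
Local Notation mu := (@lebesgue_measure R).
Local Notation mu2 := (mu \x mu)%E.
Local Notation D := (cdisk r).
Local Notation D2 := [set p : R * R | cdisk r (pc p)].
Local Notation m := (msing be).
Implicit Types (F G : C -> C) (K S : C -> C -> C) (z w x c : C) (M : R).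

Let be1 : be < 1.
Proof. by have := be2; lra. Qed.

Let mD2 : measurable (D2 : set (measurableTypeR R * measurableTypeR R)) := measurable_D2 r.

(** What differentiation under the integral sign at [z] asks of a kernel
    [K w x] with Wirtinger derivatives [Ka x] and [Kb x] in [w] at [z]: a weak
    singularity on the diagonal, and difference quotients bounded by weak
    singularities at [z] and at [w]. Nothing is asked on the diagonal itself. *)
Record kdiff_with M z K (Ka Kb : C -> C) : Prop := KDiff {
  kdiff_M0 : 0 <= M;
  kdiff_meas : forall w, D w -> cmeas D2 (K w);
  kdiff_measa : cmeas D2 Ka;
  kdiff_measb : cmeas D2 Kb;
  kdiff_bound : forall w x, D w -> D x -> x != w -> normc (K w x) <= M * m w x;
  kdiff_bounda : forall x, D x -> x != z -> normc (Ka x) <= M * m z x;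
  kdiff_boundb : forall x, D x -> x != z -> normc (Kb x) <= M * m z x;
  kdiff_lip : forall w x, D w -> D x -> x != w -> x != z ->
    normc (K w x - K z x) <= M * normc (w - z) * (m z x + m w x);
  kdiff_wd : forall x, D x -> x != z -> wd D (K^~ x) z (Ka x) (Kb x) }.

Definition kdiff z K Ka Kb := exists M, kdiff_with M z K Ka Kb.

Lemma kbound_cintegrable M c F : cmeas D2 F ->
  (forall x, D x -> x != c -> normc (F x) <= M * m c x) -> cintegrable r F.
Proof.
move=> mF Fb; pose F' x := if x == c then 0 else F x.
have E1 x : D x -> x != c -> F x = F' x by move=> _ xc; rewrite /F' (negbTE xc).
have E2 x : D x -> x != c -> F' x = F x by move=> Dx xc; rewrite -E1.
apply: (cintegrable_offdiag r0 E2).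
have i := integrableZl mD2 M (integrable_msing r0 be0 be1 c).
apply: (cintegrable_bound (h := fun p => M * m c (pc p))).
- exact: cmeas_offdiag E1 mF.
- exact: i.
move=> p Dp; rewrite /F'; case: eqVneq => [->|pc]; last exact: Fb.
by rewrite normc0 /msing subrr normc0 powR0 ?mulr0 //; have := be1; lra.
Qed.

Lemma kdiff_cintegrable z K Ka Kb w : D w -> kdiff z K Ka Kb -> cintegrable r (K w).
Proof. by move=> Dw [M H]; apply: (kbound_cintegrable (c := w) (kdiff_meas H Dw)) => x; exact: (kdiff_bound H Dw). Qed.

Lemma kdiff_cintegrablea z K Ka Kb : kdiff z K Ka Kb -> cintegrable r Ka.
Proof. by move=> [M H]; apply: (kbound_cintegrable (kdiff_measa H)); exact: kdiff_bounda H. Qed.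

Lemma kdiff_cintegrableb z K Ka Kb : kdiff z K Ka Kb -> cintegrable r Kb.
Proof. by move=> [M H]; apply: (kbound_cintegrable (kdiff_measb H)); exact: kdiff_boundb H. Qed.

(** If the expansion at [z] failed, it would fail along a sequence [w n]
    converging to [z]. Divided by [normc (w n - z)], the error terms of the
    kernel tend to 0 pointwise and are bounded by singularities at [z] and
    [w n]; so their integrals tend to 0 by [integral_small_seq]. *)
Lemma cint_wd z K Ka Kb : D z -> kdiff z K Ka Kb ->
  wd D (fun w => cint r (K w)) z (cint r Ka) (cint r Kb).
Proof.
move=> Dz kK; have [M H] := kK; move=> eps eps0.
pose e w x := K w x - K z x - (w - z) * Ka x - (w - z)^* * Kb x.
(* no estimate holds for x = z or x = w: the error is set to 0 there *)
pose e' w x := if (x == z) || (x == w) then 0 else e w x.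
pose T w := cint r (K w) - cint r (K z) - cint r Ka * (w - z) - cint r Kb * (w - z)^*.
have iK w : D w -> cintegrable r (K w) by move=> Dw; exact: kdiff_cintegrable kK.
have iKa := kdiff_cintegrablea kK; have iKb := kdiff_cintegrableb kK.
have ie w : D w -> cintegrable r (e w).
  move=> Dw; apply: cintegrableB; last exact: cintegrableZ.
  apply: cintegrableB; last exact: cintegrableZ.
  by apply: cintegrableB; apply: iK.
have TE w : D w -> T w = cint r (e w).
  move=> Dw; rewrite cintB; [|by apply: cintegrableB; [by apply: cintegrableB; apply: iK|exact: cintegrableZ]|exact: cintegrableZ].
  rewrite cintB; [|by apply: cintegrableB; apply: iK|exact: cintegrableZ].
  by rewrite cintB ?cintZ //; [rewrite /T; ring|exact: iK|exact: iK].
pose e1 w x := if x == z then 0 else e w x.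
have e1E w x : D x -> x != z -> e w x = e1 w x by move=> _ xz; rewrite /e1 (negbTE xz).
have e'E w x : D x -> x != w -> e1 w x = e' w x.
  by move=> _ xw; rewrite /e' /e1 (negbTE xw) orbF.
have ie' w : D w -> cintegrable r (e' w).
  move=> Dw; apply: (cintegrable_offdiag r0 (e'E w)).
  exact: (cintegrable_offdiag r0 (e1E w) (ie _ Dw)).
have Te' w : D w -> T w = cint r (e' w).
  move=> Dw; rewrite TE // (cint_offdiag r0 (e1E w) (ie _ Dw)).
  apply: (cint_offdiag r0 (e'E w)).
  exact: (cintegrable_offdiag r0 (e1E w) (ie _ Dw)).
pose good d := forall w, D w -> normc (w - z) < d -> normc (T w) <= eps * normc (w - z).
have [//|nex] := pselect (exists2 d, 0 < d & good d).
have /choice[w wP] : forall n : nat, exists w, [/\ D w, normc (w - z) < n.+1%:R^-1 &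
    eps * normc (w - z) < normc (T w)].
  move=> n; apply: contrapT => nw; apply: nex; exists n.+1%:R^-1; first by rewrite invr_gt0 ltr0n.
  move=> w Dw wz; rewrite leNgt; apply/negP => ltT; apply: nw; by exists w.
have Dw n : D (w n) by have [] := wP n.
have wz n : w n != z.
  apply/eqP => wnz; have [_ _] := wP n; rewrite wnz /T !subrr rmorph0 !mulr0 !subr0.
  by rewrite normc0 mulr0 ltxx.
have nwz n : 0 < normc (w n - z) by rewrite normc_gt0 subr_eq0.
pose N n x := normc (e' (w n) x) / normc (w n - z).
have mN n : measurable_fun D2 (fun p => N n (pc p)).
  apply: measurable_funM => //.
  exact: (measurable_normc (cintegrable_cmeas (ie' _ (Dw n)))).
have M0 := kdiff_M0 H.
have Nlim : (\int[mu2]_(p in D2) (N n (pc p))%:E @[n --> \oo] --> 0)%E.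
  apply: (integral_small_seq (be := be) r0 be0 be1 (w := w) (z := z) (C0 := 3 * M)) => //.
  - by rewrite mulr_ge0.
  - by move=> n; have [] := wP n.
  - by move=> n; rewrite /N /e' eqxx orbT normc0 mul0r.
  - by move=> n; rewrite /N /e' eqxx normc0 mul0r.
  - move=> n x Dx; rewrite /N divr_ge0 ?normc_ge0 //=.
    have mm : 0 <= m z x + m (w n) x by rewrite addr_ge0 ?msing_ge0.
    rewrite /e'; case: eqVneq => [_|xz] /=; first by rewrite normc0 mul0r !mulr_ge0.
    case: eqVneq => [_|xw] /=; first by rewrite normc0 mul0r !mulr_ge0.
    rewrite ler_pdivrMr // /e.
    have h1 := kdiff_lip H (Dw n) Dx xw xz.
    have h2 := kdiff_bounda H Dx xz; have h3 := kdiff_boundb H Dx xz.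
    apply: (le_trans (normcD _ _)); rewrite normcN normcM normc_conj.
    apply: le_trans (lerD (normcD _ _) (lexx _)) _; rewrite normcN normcM.
    have m0 := msing_ge0 be (w n) x.
    have a1 : normc (w n - z) * normc (Ka x) <= normc (w n - z) * (M * (m z x + m (w n) x)).
      rewrite ler_wpM2l ?normc_ge0 //; apply: le_trans h2 _.
      by rewrite ler_wpM2l // lerDl.
    have a2 : normc (w n - z) * normc (Kb x) <= normc (w n - z) * (M * (m z x + m (w n) x)).
      rewrite ler_wpM2l ?normc_ge0 //; apply: le_trans h3 _.
      by rewrite ler_wpM2l // lerDl.
    by move: a1 a2 h1; set A := m z x + _; nra.
  - move=> x Dx; have [->|xz] := eqVneq x z.
      rewrite (_ : (fun n => N n z) = fun=> 0); first exact: cvg_cst.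
      by apply/funext => n; rewrite /N /e' eqxx normc0 mul0r.
    apply/cvgrPdist_le => eta eta0.
    have [d d0 h] := kdiff_wd H Dx xz eta0.
    near=> n; rewrite sub0r normrN ger0_norm ?divr_ge0 ?normc_ge0 //.
    rewrite ler_pdivrMr // /e' (negbTE xz) /=.
    case: eqVneq => _; first by rewrite normc0 mulr_ge0 ?normc_ge0 // ltW.
    have [_ wn _] := wP n.
    have nd : n.+1%:R^-1 < d by near: n; exact: near_infty_natSinv_lt (PosNum d0).
    have := h _ (Dw n) (lt_trans wn nd).
    by congr (normc _ <= _); rewrite /e; ring.
have [n nP] : exists n, (\int[mu2]_(p in D2) (N n (pc p))%:E < (eps / 2)%:E)%E.
  have e20 : 0 < eps / 2 by lra.
  move/fine_cvgP: Nlim => [fN /cvgrPdist_lt /(_ _ e20) Nl].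
  near \oo => n; exists n.
  have fn : (\int[mu2]_(p in D2) (N n (pc p))%:E)%E \is a fin_num by near: n.
  have : `|0 - fine (\int[mu2]_(p in D2) (N n (pc p))%:E)%E| < eps / 2 by near: n.
  rewrite sub0r normrN => /(le_lt_trans (ler_norm _)).
  by rewrite -lte_fin fineK.
have [_ _] := wP n; rewrite Te' //.
have := normc_cint (ie' _ (Dw n)).
have -> : (\int[mu2]_(p in D2) (normc (e' (w n) (pc p)))%:E =
  (normc (w n - z))%:E * \int[mu2]_(p in D2) (N n (pc p))%:E)%E.
  rewrite -ge0_integralZl //.
  - apply: eq_integral => p _; rewrite -EFinM; congr EFin; rewrite /N; field; exact: lt0r_neq0.
  - by apply/measurable_EFinP; exact: mN.
  - by move=> p _; rewrite lee_fin divr_ge0 ?normc_ge0.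
  - by rewrite lee_fin normc_ge0.
move=> b1 b2; exfalso.
have : ((eps * normc (w n - z))%:E < (eps * normc (w n - z))%:E)%E; last by rewrite ltxx.
apply: (@lt_le_trans _ _ (normc (cint r (e' (w n))))%:E); first by rewrite lte_fin.
apply: le_trans b1 _; rewrite muleA -EFinM.
apply: (@le_trans _ _ ((2 * normc (w n - z))%:E * (eps / 2)%:E)%E).
  by apply: lee_wpmul2l; [rewrite lee_fin mulr_ge0 // normc_ge0|exact: ltW].
by rewrite -EFinM lee_fin le_eqVlt; apply/orP; left; apply/eqP; field.
Unshelve. all: by end_near. Qed.

End Kernels.

(** * Sums and products of kernels *)

Section KernelCalculus.
Variables (R : realType) (r be : R).
Hypotheses (r0 : 0 < r) (be0 : 0 < be) (be2 : be < 1 / 2).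
Local Notation C := R[i].
Local Notation D := (cdisk r).
Local Notation D2 := [set p : R * R | cdisk r (pc p)].
Local Notation m := (msing be).
Local Notation kdiff := (kdiff r be).
Local Notation kdiff_with := (kdiff_with r be).
Implicit Types (F G : C -> C) (K S : C -> C -> C) (z w x c : C) (M : R).

Lemma cdisk_dist w x : D w -> D x -> normc (x - w) <= 2 * r.
Proof. by rewrite /cdisk /= => h1 h2; apply: (le_trans (normcD _ _)); rewrite normcN; lra. Qed.

(** The singularity is bounded below on the disk, so that bounded kernels count
    as weakly singular ones. *)
Lemma msing_lower : exists2 c0, 0 <= c0 & forall w x, D w -> D x -> x != w -> 1 <= c0 * m w x.
Proof.
exists ((2 * r) `^ (2 - 2 * be)); first exact: powR_ge0.
move=> w x Dw Dx xw; have n0 : 0 < normc (x - w) by rewrite normc_gt0 subr_eq0.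
rewrite /msing (_ : 2 * be - 2 = - (2 - 2 * be)); last by ring.
rewrite powRN -ler_pdivrMr ?invr_gt0 ?powR_gt0 // invrK mul1r.
apply: ge0_ler_powR; rewrite ?nnegrE ?normc_ge0 ?cdisk_dist //.
- by have := be2; lra.
- by have := r0; lra.
Qed.

(** Here [be < 1 / 2] enters: the exponent [2 * be - 2] is then below -1. *)
Lemma inv_le_msing : exists2 c1, 0 <= c1 &
  forall w x, D w -> D x -> x != w -> (normc (x - w))^-1 <= c1 * m w x.
Proof.
exists ((2 * r) `^ (1 - 2 * be)); first exact: powR_ge0.
move=> w x Dw Dx xw; have n0 : 0 < normc (x - w) by rewrite normc_gt0 subr_eq0.
rewrite /msing -powR_inv1 ?normc_ge0 //.
have -> : -1 = (1 - 2 * be) + (2 * be - 2) by ring.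
rewrite powRD; last by rewrite (gt_eqF n0) /= implybT.
rewrite ler_wpM2r ?powR_ge0 //.
apply: ge0_ler_powR; rewrite ?nnegrE ?normc_ge0 ?cdisk_dist //.
- by have := be2; lra.
- by have := r0; lra.
Qed.

(** Kernels without singularity, by which weakly singular ones may be
    multiplied. *)
Record kreg_with M z S (Sa Sb : C -> C) : Prop := KReg {
  kreg_M0 : 0 <= M;
  kreg_meas : forall w, D w -> cmeas D2 (S w);
  kreg_measa : cmeas D2 Sa;
  kreg_measb : cmeas D2 Sb;
  kreg_bound : forall w x, D w -> D x -> normc (S w x) <= M;
  kreg_bounda : forall x, D x -> normc (Sa x) <= M;
  kreg_boundb : forall x, D x -> normc (Sb x) <= M;
  kreg_lip : forall w x, D w -> D x -> normc (S w x - S z x) <= M * normc (w - z);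
  kreg_wd : forall x, D x -> wd D (S^~ x) z (Sa x) (Sb x) }.

Definition kreg z S Sa Sb := exists M, kreg_with M z S Sa Sb.

Lemma kreg_mono M M' z S Sa Sb : M <= M' -> kreg_with M z S Sa Sb -> kreg_with M' z S Sa Sb.
Proof.
move=> MM' H; split.
- exact: le_trans (kreg_M0 H) MM'.
- exact: kreg_meas H.
- exact: kreg_measa H.
- exact: kreg_measb H.
- by move=> w x Dw Dx; exact: le_trans (kreg_bound H Dw Dx) MM'.
- by move=> x Dx; exact: le_trans (kreg_bounda H Dx) MM'.
- by move=> x Dx; exact: le_trans (kreg_boundb H Dx) MM'.
- move=> w x Dw Dx; apply: le_trans (kreg_lip H Dw Dx) _.
  by rewrite ler_wpM2r ?normc_ge0.
- exact: kreg_wd H.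
Qed.

Lemma kdiff_mono M M' z K Ka Kb : M <= M' -> kdiff_with M z K Ka Kb -> kdiff_with M' z K Ka Kb.
Proof.
have mono a b : 0 <= a -> M <= M' -> b <= M * a -> b <= M' * a.
  by move=> a0 MM' /le_trans; apply; rewrite ler_wpM2r.
move=> MM' H; split.
- exact: le_trans (kdiff_M0 H) MM'.
- exact: kdiff_meas H.
- exact: kdiff_measa H.
- exact: kdiff_measb H.
- by move=> w x Dw Dx xw; apply: mono (kdiff_bound H Dw Dx xw) => //; exact: msing_ge0.
- by move=> x Dx xz; apply: mono (kdiff_bounda H Dx xz) => //; exact: msing_ge0.
- by move=> x Dx xz; apply: mono (kdiff_boundb H Dx xz) => //; exact: msing_ge0.
- move=> w x Dw Dx xw xz; rewrite -mulrA; apply: mono => //.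
    by rewrite mulr_ge0 ?normc_ge0 ?addr_ge0 ?msing_ge0.
  by rewrite mulrA; exact: kdiff_lip H _ _ Dw Dx xw xz.
- exact: kdiff_wd H.
Qed.

Lemma kreg_common z S Sa Sb S' Sa' Sb' : kreg z S Sa Sb -> kreg z S' Sa' Sb' ->
  exists M, kreg_with M z S Sa Sb /\ kreg_with M z S' Sa' Sb'.
Proof.
move=> [M H] [M' H']; exists (M + M'); have h := kreg_M0 H; have h' := kreg_M0 H'.
by split; [apply: kreg_mono H|apply: kreg_mono H']; lra.
Qed.

Lemma kreg_fun z F : cmeas D2 F -> (exists M, forall x, D x -> normc (F x) <= M) ->
  kreg z (fun _ => F) (fun=> 0) (fun=> 0).
Proof.
move=> mF [M FM]; exists `|M|; split => //; try exact: cmeas_cst.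
- by move=> w x _ /FM /le_trans; apply; exact: ler_norm.
- by move=> x _; rewrite normc0.
- by move=> x _; rewrite normc0.
- by move=> w x _ _; rewrite subrr normc0 mulr_ge0 ?normc_ge0.
- by move=> x _; exact: wd_cst.
Qed.

Lemma kreg_cst z c : kreg z (fun _ _ => c) (fun=> 0) (fun=> 0).
Proof. by apply: kreg_fun; [exact: cmeas_cst|exists (normc c)]. Qed.

Lemma kreg_point z : kreg z (fun _ x => x) (fun=> 0) (fun=> 0).
Proof. by apply: kreg_fun; [exact: cmeas_id|exists r]. Qed.

Lemma kreg_var z : kreg z (fun w _ => w) (fun=> 1) (fun=> 0).
Proof.
exists (r + 1); have r1 := r0; split; try exact: cmeas_cst.
- lra.
- by move=> w _; exact: cmeas_cst.
- by move=> w x; rewrite {1}/cdisk /= => Dw _; lra.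
- by move=> x _; rewrite normc1; lra.
- by move=> x _; rewrite normc0; lra.
- move=> w x _ _; rewrite -{1}[normc _]mul1r ler_wpM2r ?normc_ge0 //; lra.
- by move=> x _; exact: wd_id.
Qed.

Lemma kreg_conj z S Sa Sb : kreg z S Sa Sb ->
  kreg z (fun w x => (S w x)^*) (fun x => (Sb x)^*) (fun x => (Sa x)^*).
Proof.
move=> [M H]; exists M; split.
- exact: kreg_M0 H.
- by move=> w Dw; apply: cmeas_conj; exact: kreg_meas H _ Dw.
- exact: cmeas_conj (kreg_measb H).
- exact: cmeas_conj (kreg_measa H).
- by move=> w x Dw Dx; rewrite normc_conj; exact: kreg_bound H _ _ Dw Dx.
- by move=> x Dx; rewrite normc_conj; exact: kreg_boundb H _ Dx.
- by move=> x Dx; rewrite normc_conj; exact: kreg_bounda H _ Dx.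
- by move=> w x Dw Dx; rewrite -conjcB normc_conj; exact: kreg_lip H _ _ Dw Dx.
- by move=> x Dx; apply: wd_conj; exact: kreg_wd H _ Dx.
Qed.

Lemma kregD z S Sa Sb S' Sa' Sb' : kreg z S Sa Sb -> kreg z S' Sa' Sb' ->
  kreg z (fun w x => S w x + S' w x) (fun x => Sa x + Sa' x) (fun x => Sb x + Sb' x).
Proof.
move=> k k'; have [M [H H']] := kreg_common k k'; exists (M + M).
have M0 := kreg_M0 H; split; first lra.
- by move=> w Dw; apply: cmeasD; [exact: kreg_meas H _ Dw|exact: kreg_meas H' _ Dw].
- by apply: cmeasD; [exact: kreg_measa H|exact: kreg_measa H'].
- by apply: cmeasD; [exact: kreg_measb H|exact: kreg_measb H'].
- by move=> w x Dw Dx; apply: (le_trans (normcD _ _)); apply: lerD; [exact: kreg_bound H _ _ Dw Dx|exact: kreg_bound H' _ _ Dw Dx].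
- by move=> x Dx; apply: (le_trans (normcD _ _)); apply: lerD; [exact: kreg_bounda H _ Dx|exact: kreg_bounda H' _ Dx].
- by move=> x Dx; apply: (le_trans (normcD _ _)); apply: lerD; [exact: kreg_boundb H _ Dx|exact: kreg_boundb H' _ Dx].
- move=> w x Dw Dx; rewrite opprD addrACA mulrDl; apply: (le_trans (normcD _ _)).
  by apply: lerD; [exact: kreg_lip H _ _ Dw Dx|exact: kreg_lip H' _ _ Dw Dx].
- by move=> x Dx; apply: wdD; [exact: kreg_wd H _ Dx|exact: kreg_wd H' _ Dx].
Qed.

Lemma kregM z S Sa Sb S' Sa' Sb' : D z -> kreg z S Sa Sb -> kreg z S' Sa' Sb' ->
  kreg z (fun w x => S w x * S' w x) (fun x => Sa x * S' z x + S z x * Sa' x)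
   (fun x => Sb x * S' z x + S z x * Sb' x).
Proof.
move=> Dz k k'; have [M [H H']] := kreg_common k k'; exists (M * M + M * M).
have M0 := kreg_M0 H.
have bM a b : normc a <= M -> normc b <= M -> normc (a * b) <= M * M.
  by move=> ha hb; rewrite normcM ler_pM ?normc_ge0.
have bMD a b c d : normc a <= M -> normc b <= M -> normc c <= M -> normc d <= M ->
    normc (a * b + c * d) <= M * M + M * M.
  by move=> *; apply: (le_trans (normcD _ _)); apply: lerD; apply: bM.
have [bS bS'] := (kreg_bound H, kreg_bound H').
split.
- by rewrite addr_ge0 ?mulr_ge0.
- by move=> w Dw; apply: cmeasM; [exact: kreg_meas H _ Dw|exact: kreg_meas H' _ Dw].
- apply: cmeasD; apply: cmeasM.
  + exact: kreg_measa H.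
  + exact: kreg_meas H' _ Dz.
  + exact: kreg_meas H _ Dz.
  + exact: kreg_measa H'.
- apply: cmeasD; apply: cmeasM.
  + exact: kreg_measb H.
  + exact: kreg_meas H' _ Dz.
  + exact: kreg_meas H _ Dz.
  + exact: kreg_measb H'.
- move=> w x Dw Dx; apply: le_trans (bM _ _ (bS _ _ Dw Dx) (bS' _ _ Dw Dx)) _.
  by rewrite lerDl mulr_ge0.
- by move=> x Dx; apply: bMD; rewrite ?bS ?bS' ?(kreg_bounda H) ?(kreg_bounda H').
- by move=> x Dx; apply: bMD; rewrite ?bS ?bS' ?(kreg_boundb H) ?(kreg_boundb H').
- move=> w x Dw Dx.
  have -> : S w x * S' w x - S z x * S' z x =
    (S w x - S z x) * S' w x + S z x * (S' w x - S' z x) by ring.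
  apply: (le_trans (normcD _ _)); rewrite !normcM mulrDl; apply: lerD.
    by rewrite mulrAC; apply: ler_pM; rewrite ?normc_ge0 ?(kreg_lip H) ?bS'.
  by rewrite -mulrA; apply: ler_pM; rewrite ?normc_ge0 ?(kreg_lip H') ?bS.
- by move=> x Dx; apply: wdM; [exact: kreg_wd H _ Dx|exact: kreg_wd H' _ Dx].
Qed.

Lemma kreg_ext z S Sa Sb S' Sa' Sb' : D z -> (forall w x, D w -> D x -> S w x = S' w x) ->
  (forall x, D x -> Sa x = Sa' x) -> (forall x, D x -> Sb x = Sb' x) ->
  kreg z S Sa Sb -> kreg z S' Sa' Sb'.
Proof.
move=> Dz E Ea Eb [M H]; exists M; split.
- exact: kreg_M0 H.
- by move=> w Dw; apply: cmeas_ext (kreg_meas H Dw) => p Dp; exact: E.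
- by apply: cmeas_ext (kreg_measa H) => p Dp; exact: Ea.
- by apply: cmeas_ext (kreg_measb H) => p Dp; exact: Eb.
- by move=> w x Dw Dx; rewrite -E //; exact: kreg_bound H _ _ Dw Dx.
- by move=> x Dx; rewrite -Ea //; exact: kreg_bounda H _ Dx.
- by move=> x Dx; rewrite -Eb //; exact: kreg_boundb H _ Dx.
- by move=> w x Dw Dx; rewrite -!E //; exact: kreg_lip H _ _ Dw Dx.
- move=> x Dx; rewrite -Ea // -Eb //; apply: wd_ext (kreg_wd H Dx) => // w Dw.
  exact: E.
Qed.

Lemma kdiff_common z K Ka Kb K' Ka' Kb' : kdiff z K Ka Kb -> kdiff z K' Ka' Kb' ->
  exists M, kdiff_with M z K Ka Kb /\ kdiff_with M z K' Ka' Kb'.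
Proof.
move=> [M H] [M' H']; exists (M + M'); have h := kdiff_M0 H; have h' := kdiff_M0 H'.
by split; [apply: kdiff_mono H|apply: kdiff_mono H']; lra.
Qed.

Lemma kdiffD z K Ka Kb K' Ka' Kb' : kdiff z K Ka Kb -> kdiff z K' Ka' Kb' ->
  kdiff z (fun w x => K w x + K' w x) (fun x => Ka x + Ka' x) (fun x => Kb x + Kb' x).
Proof.
move=> k k'; have [M [H H']] := kdiff_common k k'; exists (M + M).
have M0 := kdiff_M0 H; split; first lra.
- by move=> w Dw; apply: cmeasD; [exact: kdiff_meas H _ Dw|exact: kdiff_meas H' _ Dw].
- by apply: cmeasD; [exact: kdiff_measa H|exact: kdiff_measa H'].
- by apply: cmeasD; [exact: kdiff_measb H|exact: kdiff_measb H'].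
- move=> w x Dw Dx xw; rewrite mulrDl; apply: (le_trans (normcD _ _)).
  by apply: lerD; [exact: kdiff_bound H _ _ Dw Dx xw|exact: kdiff_bound H' _ _ Dw Dx xw].
- move=> x Dx xz; rewrite mulrDl; apply: (le_trans (normcD _ _)).
  by apply: lerD; [exact: kdiff_bounda H _ Dx xz|exact: kdiff_bounda H' _ Dx xz].
- move=> x Dx xz; rewrite mulrDl; apply: (le_trans (normcD _ _)).
  by apply: lerD; [exact: kdiff_boundb H _ Dx xz|exact: kdiff_boundb H' _ Dx xz].
- move=> w x Dw Dx xw xz; rewrite opprD addrACA !mulrDl; apply: (le_trans (normcD _ _)).
  by apply: lerD; rewrite -?mulrDl; [exact: kdiff_lip H _ _ Dw Dx xw xz|exact: kdiff_lip H' _ _ Dw Dx xw xz].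
- by move=> x Dx xz; apply: wdD; [exact: kdiff_wd H _ Dx xz|exact: kdiff_wd H' _ Dx xz].
Qed.

Lemma kdiffM z K Ka Kb S Sa Sb : D z -> kdiff z K Ka Kb -> kreg z S Sa Sb ->
  kdiff z (fun w x => K w x * S w x) (fun x => Ka x * S z x + K z x * Sa x)
   (fun x => Kb x * S z x + K z x * Sb x).
Proof.
move=> Dz [M1 H1] [M2 H2].
have M10 := kdiff_M0 H1; have M20 := kreg_M0 H2; set M := M1 + M2.
have H : kdiff_with M z K Ka Kb by apply: kdiff_mono H1; rewrite /M; lra.
have H' : kreg_with M z S Sa Sb by apply: kreg_mono H2; rewrite /M; lra.
have M0 := kdiff_M0 H; clearbody M; clear H1 H2 M10 M20; exists (M * M + M * M).
have bM a b t : normc a <= M * t -> normc b <= M -> normc (a * b) <= M * M * t.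
  by move=> ha hb; rewrite normcM mulrAC ler_pM ?normc_ge0.
have bMD a b c d t : normc a <= M * t -> normc b <= M -> normc c <= M * t -> normc d <= M ->
    normc (a * b + c * d) <= (M * M + M * M) * t.
  by move=> *; rewrite mulrDl; apply: (le_trans (normcD _ _)); apply: lerD; apply: bM.
have bS := kreg_bound H'; have bK := kdiff_bound H.
split.
- by rewrite addr_ge0 ?mulr_ge0.
- by move=> w Dw; apply: cmeasM; [exact: kdiff_meas H _ Dw|exact: kreg_meas H' _ Dw].
- apply: cmeasD; apply: cmeasM.
  + exact: kdiff_measa H.
  + exact: kreg_meas H' _ Dz.
  + exact: kdiff_meas H _ Dz.
  + exact: kreg_measa H'.
- apply: cmeasD; apply: cmeasM.
  + exact: kdiff_measb H.
  + exact: kreg_meas H' _ Dz.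
  + exact: kdiff_meas H _ Dz.
  + exact: kreg_measb H'.
- move=> w x Dw Dx xw; apply: le_trans (bM _ _ _ (bK _ _ Dw Dx xw) (bS _ _ Dw Dx)) _.
  by rewrite ler_wpM2r ?msing_ge0 // lerDl mulr_ge0.
- by move=> x Dx xz; apply: bMD; rewrite ?bS ?bK ?(kdiff_bounda H) ?(kreg_bounda H').
- by move=> x Dx xz; apply: bMD; rewrite ?bS ?bK ?(kdiff_boundb H) ?(kreg_boundb H').
- move=> w x Dw Dx xw xz.
  have -> : K w x * S w x - K z x * S z x =
    (K w x - K z x) * S w x + K z x * (S w x - S z x) by ring.
  apply: (le_trans (normcD _ _)); rewrite !normcM !mulrDl; apply: lerD.
    have -> : M * M * normc (w - z) * (m z x + m w x) =
      (M * normc (w - z) * (m z x + m w x)) * M by ring.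
    by apply: ler_pM; rewrite ?normc_ge0 ?(kdiff_lip H) ?bS.
  apply: (@le_trans _ _ ((M * m z x) * (M * normc (w - z)))).
    by apply: ler_pM; rewrite ?normc_ge0 ?(kreg_lip H') ?bK.
  rewrite (_ : M * m z x * (M * normc (w - z)) = M * M * normc (w - z) * m z x); last by ring.
  by rewrite ler_wpM2l ?mulr_ge0 ?normc_ge0 // lerDl msing_ge0.
- by move=> x Dx xz; apply: wdM; [exact: kdiff_wd H _ Dx xz|exact: kreg_wd H' _ Dx].
Qed.

Lemma kdiff_of_kreg z S Sa Sb : D z -> kreg z S Sa Sb -> kdiff z S Sa Sb.
Proof.
move=> Dz [M H]; have [c0 c00 cm] := msing_lower; have M0 := kreg_M0 H.
exists (M * c0).
have key w x t : D w -> D x -> x != w -> t <= M -> t <= M * c0 * m w x.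
  move=> Dw Dx xw /le_trans; apply; rewrite -[leLHS]mulr1 -mulrA.
  by rewrite ler_wpM2l ?cm.
split.
- exact: mulr_ge0.
- exact: kreg_meas H.
- exact: kreg_measa H.
- exact: kreg_measb H.
- by move=> w x Dw Dx xw; apply: key => //; exact: kreg_bound H _ _ Dw Dx.
- by move=> x Dx xz; apply: key => //; exact: kreg_bounda H _ Dx.
- by move=> x Dx xz; apply: key => //; exact: kreg_boundb H _ Dx.
- move=> w x Dw Dx xw xz; apply: le_trans (kreg_lip H Dw Dx) _.
  rewrite -!mulrA ler_wpM2l // mulrCA -[leLHS]mulr1 ler_wpM2l ?normc_ge0 //.
  by rewrite mulrDr; apply: le_trans (cm _ _ Dz Dx xz) _; rewrite lerDl mulr_ge0 ?msing_ge0.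
- by move=> x Dx _; exact: kreg_wd H _ Dx.
Qed.

Lemma kdiff_ext z K Ka Kb K' Ka' Kb' : D z ->
  (forall w x, D w -> D x -> x != w -> K w x = K' w x) ->
  (forall x, D x -> x != z -> Ka x = Ka' x) ->
  (forall x, D x -> x != z -> Kb x = Kb' x) ->
  kdiff z K Ka Kb -> kdiff z K' Ka' Kb'.
Proof.
move=> Dz E Ea Eb [M H]; exists M; split.
- exact: kdiff_M0 H.
- move=> w Dw; have Ew x : D x -> x != w -> K w x = K' w x by exact: E.
  exact: cmeas_offdiag Ew (kdiff_meas H Dw).
- exact: cmeas_offdiag Ea (kdiff_measa H).
- exact: cmeas_offdiag Eb (kdiff_measb H).
- by move=> w x Dw Dx xw; rewrite -E //; exact: kdiff_bound H _ _ Dw Dx xw.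
- by move=> x Dx xz; rewrite -Ea //; exact: kdiff_bounda H _ Dx xz.
- by move=> x Dx xz; rewrite -Eb //; exact: kdiff_boundb H _ Dx xz.
- by move=> w x Dw Dx xw xz; rewrite -!E //; exact: kdiff_lip H _ _ Dw Dx xw xz.
- move=> x Dx xz; rewrite -Ea // -Eb // => eps eps0.
  have [d d0 h] := kdiff_wd H Dx xz eps0.
  exists (Num.min d (normc (x - z))); first by rewrite lt_min d0 normc_gt0 subr_eq0.
  move=> w Dw; rewrite lt_min => /andP[wd wx].
  have xw : x != w by apply: contraTneq wx => ->; rewrite ltxx.
  by have := h _ Dw wd; rewrite !E.
Qed.

End KernelCalculus.

(** * Estimates for the logarithm and the arctangent *)

Section RealFunctions.
Variable R : realType.

Lemma ler_dist_atan (u v : R) : `|atan u - atan v| <= `|u - v|.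
Proof.
wlog uv : u v / u < v.
  move=> H; have [uv|vu|->] := ltgtP u v; last by rewrite !subrr.
    exact: H.
  by rewrite distrC [leRHS]distrC; exact: H.
have [|x _ E] := @MVT _ atan (fun x => (1 + x ^+ 2)^-1) u v uv (fun x _ => is_derive1_atan x).
  by apply: continuous_subspaceT => x; exact: continuous_atan.
rewrite distrC [leRHS]distrC E normrM ler_piMl //.
rewrite ger0_norm ?invr_ge0 ?addr_ge0 ?sqr_ge0 //.
by rewrite invf_le1 ?lerDl ?sqr_ge0 // ltr_pwDl ?sqr_ge0.
Qed.

Lemma ler_norm_atan (u : R) : `|atan u| <= pi.
Proof.
rewrite ler_norml; apply/andP; have := atan_gtNpi2 u; have := atan_ltpi2 u.
by have := pi_gt0 R; lra.
Qed.

Lemma ler_norm_ln (t : R) : 0 < t -> `|ln t| <= t + t^-1.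
Proof.
move=> t0; have h1 := ln_sublinear t0; have ti : 0 < t^-1 by rewrite invr_gt0.
by have := ln_sublinear ti; rewrite lnV ?posrE // ler_norml => h2; lra.
Qed.

Lemma ler_dist_ln (s t : R) : 0 < s -> 0 < t ->
  `|ln s - ln t| <= `|s - t| * (s^-1 + t^-1).
Proof.
have key (x y : R) : 0 < x -> 0 < y -> ln x - ln y <= `|x - y| * (x^-1 + y^-1).
  move=> x0 y0; rewrite -ln_div ?posrE //.
  have -> : x / y = 1 + (x - y) / y by field; exact: lt0r_neq0.
  apply: le_trans (le_ln1Dx _) _.
    by rewrite mulrBl divff ?lt0r_neq0 //; have := divr_gt0 x0 y0; lra.
  rewrite mulrDr; apply: (@le_trans _ _ (`|x - y| / y)).
    by rewrite ler_wpM2r ?invr_ge0 ?(ltW y0) // ler_norm.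
  by rewrite lerDr mulr_ge0 // invr_ge0 ltW.
move=> s0 t0; rewrite ler_norml; apply/andP; split; last exact: key.
by have := key _ _ t0 s0; rewrite distrC [t^-1 + _]addrC; lra.
Qed.

End RealFunctions.

(** * The principal logarithm on the right half-plane *)

Section HalfAngleLogarithm.
Variable R : realType.
Local Notation C := R[i].
Implicit Types (x y v z : C) (D : set C).

(** The half-angle formula arg v = 2 atan (Im v / (|v| + Re v)), valid on the
    right half-plane. Contrary to Im v / Re v, this quotient varies by at most
    a constant times |dv| / |v|, up to the imaginary axis. *)
Definition uarg v : R := complex.Im v / (normc v + complex.Re v).

Definition clnp v : C := (ln (normc v))%:C + 'i * (2 * atan (uarg v))%:C.

Lemma carg_uarg v : 0 < complex.Re v -> carg v = 2 * atan (uarg v).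
Proof.
move=> X0; set X := complex.Re v in X0 *; set Y := complex.Im v; set n := normc v.
have nXY : n ^+ 2 = X ^+ 2 + Y ^+ 2 by exact: sqr_normc_ReIm.
have n0 : 0 < n.
  rewrite /n normc_gt0; apply/eqP => v0; move: X0; rewrite /X v0 ltxx //.
have S0 : 0 < n + X by lra.
have cos2 (u : R) : u ^+ 2 = (Y / (n + X)) ^+ 2 -> cos (2 * atan u) = X / n.
  move=> uE; rewrite mulr_natl cos_mulr2n cos_atan exprVn sqr_sqrtr ?addr_ge0 ?sqr_ge0 // uE.
  have -> : 1 + (Y / (n + X)) ^+ 2 = 2 * n / (n + X).
    have YE : Y ^+ 2 = n ^+ 2 - X ^+ 2 by rewrite nXY; ring.
    by rewrite exprMn YE; field; exact: lt0r_neq0.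
  by rewrite -mulr_natl; field; rewrite !lt0r_neq0.
have acos2 (u : R) : 0 <= u -> u ^+ 2 = (Y / (n + X)) ^+ 2 -> acos (X / n) = 2 * atan u.
  move=> u0 /cos2 <-; rewrite cosK // in_itv /=.
  have a0 : 0 <= atan u by rewrite -atan0 le_atan.
  by have := atan_ltpi2 u; lra.
rewrite /carg /uarg -/X -/Y -/n; case: ifPn => Y0.
  by apply: acos2 => //; rewrite divr_ge0 // ltW.
rewrite -ltNge in Y0.
rewrite (acos2 (- (Y / (n + X)))) ?sqrrN //; first by rewrite atanN mulrN opprK.
by rewrite -mulNr divr_ge0 ?(ltW S0) // oppr_ge0 ltW.
Qed.

Lemma cln_clnp v (t : R) : 0 < t -> 0 < complex.Re v ->
  cln (v / t%:C) = clnp v - (ln t)%:C.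
Proof.
move=> t0 v0; rewrite /cln /clnp.
have vn0 : 0 < normc v.
  rewrite normc_gt0; apply/eqP => ve; move: v0; by rewrite ve ltxx.
have nvt : normc (v / t%:C) = normc v / t.
  by rewrite normcM normcV normc_real gtr0_norm.
have vt : v / t%:C = (complex.Re v / t) +i* (complex.Im v / t).
  by rewrite -fmorphV; case: (v) => a b; apply/eqP; rewrite eq_complex /= !mulr0 subr0 add0r !eqxx.
have -> : carg (v / t%:C) = carg v.
  rewrite /carg nvt vt /= pmulr_lge0 ?invr_gt0 //.
  have -> : complex.Re v / t / (normc v / t) = complex.Re v / normc v.
    by field; rewrite !lt0r_neq0.
  by [].
rewrite carg_uarg // nvt ln_div ?posrE //.
by rewrite -complexiE; apply/eqP; rewrite eq_complex /=; apply/andP; split; apply/eqP; ring.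
Qed.

Lemma ler_dist_uarg x y : 0 < complex.Re x -> 0 < complex.Re y ->
  `|uarg x - uarg y| <= 3 * (normc (x - y) / normc x).
Proof.
move=> x0 y0.
have nx : complex.Re x <= normc x := le_trans (ler_norm _) (ler_Re_normc x).
have ny : complex.Re y <= normc y := le_trans (ler_norm _) (ler_Re_normc y).
set A := normc x + complex.Re x; set B := normc y + complex.Re y.
have A0 : 0 < A by rewrite /A; lra.
have B0 : 0 < B by rewrite /B; lra.
have nx0 : 0 < normc x by lra.
have yB : `|complex.Im y| <= B by apply: le_trans (ler_Im_normc y) _; rewrite /B; lra.
have dI : `|complex.Im x - complex.Im y| <= normc (x - y).
  by apply: le_trans (ler_Im_normc _); case: (x) (y) => ? ? [].
have dR : `|complex.Re x - complex.Re y| <= normc (x - y).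
  by apply: le_trans (ler_Re_normc _); case: (x) (y) => ? ? [].
have dAB : `|B - A| <= 2 * normc (x - y).
  rewrite distrC /A /B (_ : _ - _ = (normc x - normc y) + (complex.Re x - complex.Re y)); last by ring.
  by apply: (le_trans (ler_normD _ _)); have := ler_dist_normc x y; lra.
have -> : uarg x - uarg y = ((complex.Im x - complex.Im y) + complex.Im y / B * (B - A)) / A.
  by rewrite /uarg -/A -/B; field; rewrite !lt0r_neq0.
rewrite normrM normrV ?unitfE ?lt0r_neq0 // (gtr0_norm A0) mulrA.
apply: ler_pM; rewrite ?invr_ge0 ?(ltW A0) //; last first.
  by rewrite lef_pV2 ?posrE // /A; lra.
apply: (le_trans (ler_normD _ _)).
have : `|complex.Im y / B * (B - A)| <= 1 * (2 * normc (x - y)).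
  rewrite normrM; apply: ler_pM => //.
  by rewrite normrM normrV ?unitfE ?lt0r_neq0 // (gtr0_norm B0) ler_pdivrMr ?mul1r.
by lra.
Qed.

Lemma Re_conj v : (complex.Re v)%:C = (v + v^*) / 2.
Proof. by rewrite ReJ_add. Qed.

Lemma Im_conj v : (complex.Im v)%:C = (v^* - v) / 2 * 'i.
Proof. by rewrite ImJ_sub complexiE. Qed.

(** The identities that make [clnp] holomorphic with derivative 1 / v, with
    N, V, W and I for |v|, v, the conjugate of v and the imaginary unit; X and
    Y are the real and imaginary parts of v, and q is the derivative of the
    arctangent at Y / (N + X). *)
Lemma half_angle_identity (N V W a b I : C) : N != 0 -> W != 0 ->
    N + (V + W) / 2 != 0 -> V * W = N ^+ 2 -> I * I = -1 ->
  let X := (V + W) / 2 in let Y := (W - V) / 2 * I in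
  let q := (1 + (Y / (N + X)) ^+ 2)^-1 in
  a / V / 2 + I * 2 * (q * (- a / 2 * I / (N + X) +
     Y * (- (a * W / (2 * N) + a / 2) / (N + X) ^+ 2))) = a / V /\
  b / W / 2 + I * 2 * (q * (b / 2 * I / (N + X) +
     Y * (- (V * b / (2 * N) + b / 2) / (N + X) ^+ 2))) = 0.
Proof.
move=> N0 W0 S0 NVW I2 X Y q.
have VE : V = N ^+ 2 / W by rewrite -NVW mulfK.
have S1 : N * (W * 2) + (N ^+ 2 + W * W) != 0.
  have -> : N * (W * 2) + (N ^+ 2 + W * W) = 2 * W * (N + (V + W) / 2) by rewrite VE; field.
  by rewrite !mulf_neq0 // pnatr_eq0.
have S2 : (N * (W * 2) + (N ^+ 2 + W * W)) ^+ 2 + -1 * (W * W - N ^+ 2) ^+ 2 != 0.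
  have -> : (N * (W * 2) + (N ^+ 2 + W * W)) ^+ 2 + -1 * (W * W - N ^+ 2) ^+ 2 =
    2 * 2 * N * W * (N * (W * 2) + (N ^+ 2 + W * W)) by ring.
  by rewrite !mulf_neq0 // pnatr_eq0.
have qE : q = (N + X) / (2 * N).
  rewrite /q; have -> : (Y / (N + X)) ^+ 2 = (I * I) * ((W - V) / 2 / (N + X)) ^+ 2.
    by rewrite /Y; ring.
  rewrite I2 /X VE; field.
  by rewrite N0 W0 S1.
rewrite qE; split.
- have -> : I * 2 * ((N + X) / (2 * N) * (- a / 2 * I / (N + X) +
     Y * (- (a * W / (2 * N) + a / 2) / (N + X) ^+ 2))) =
   (I * I) * (2 * ((N + X) / (2 * N) * (- a / 2 / (N + X) +
     (W - V) / 2 * (- (a * W / (2 * N) + a / 2) / (N + X) ^+ 2)))) by rewrite /Y; ring.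
  rewrite I2 /X VE; field.
  by rewrite N0 W0 S1.
- have -> : I * 2 * ((N + X) / (2 * N) * (b / 2 * I / (N + X) +
     Y * (- (V * b / (2 * N) + b / 2) / (N + X) ^+ 2))) =
   (I * I) * (2 * ((N + X) / (2 * N) * (b / 2 / (N + X) +
     (W - V) / 2 * (- (V * b / (2 * N) + b / 2) / (N + X) ^+ 2)))) by rewrite /Y; ring.
  rewrite I2 /X VE; field.
  by rewrite N0 W0 S1.
Qed.

Lemma wd_normc2 D v (g : C -> C) z a b : v = g z -> wd D g z a b ->
  wd D (fun w => (normc (g w) ^+ 2)%:C) z (a * v^* + v * b^*) (b * v^* + v * a^*).
Proof.
move=> -> H; have := wdM H (wd_conj H).
by congr (wd _ _ _ _ _); apply/funext => w; rewrite mulcJ.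
Qed.

Lemma wd_ln_normc2 D (g : C -> C) z a b : g z != 0 -> wd D g z a b ->
  wd D (fun w => (ln (normc (g w) ^+ 2))%:C) z (a / g z + (b / g z)^*) (b / g z + (a / g z)^*).
Proof.
move=> gz0 H; have H2 := wd_normc2 erefl H.
have n0 : 0 < normc (g z) ^+ 2 by rewrite exprn_gt0 // normc_gt0.
have := wd_comp_real H2 (is_derive1_ln n0).
have gz1 : (g z)^* != 0 by rewrite conjC_eq0.
have E c d : ((normc (g z) ^+ 2)^-1)%:C * (c * (g z)^* + g z * d^*) = c / g z + (d / g z)^*.
  have -> : (normc (g z) ^- 2)%:C = (g z * (g z)^*)^-1 by rewrite mulcJ fmorphV.
  rewrite conjcM conjcV; move: gz1 gz0; move: (g z)^* (g z) d^* => W V e W0 V0.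
  by field; apply/andP.
by rewrite !E.
Qed.

(** The chain rule through the real functions that compose [clnp], then
    [half_angle_identity]. *)
Lemma wd_clnp D (g : C -> C) z a : 0 < complex.Re (g z) -> wd D g z a 0 ->
  wd D (fun w => clnp (g w)) z (a / g z) 0.
Proof.
move=> X0 H; set V := g z in X0 *; set W := V^*.
have V0 : V != 0 by apply/eqP => ve; move: X0; rewrite ve ltxx.
have W0 : W != 0 by rewrite conjC_eq0.
have nV0 : 0 < normc V by rewrite normc_gt0.
set N : C := (normc V)%:C; have N2 : V * W = N ^+ 2 by rewrite mulcJ rmorphXn.
have N0 : N != 0 by rewrite -normc_eq0 normc_real gtr0_norm ?lt0r_neq0.
have hln : wd D (fun w => (ln (normc (g w)))%:C) z (a / V / 2) ((a / V)^* / 2).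
  have := wdZ 2^-1 (wd_ln_normc2 V0 H).
  have -> : (fun w => 2^-1 * (ln (normc (g w) ^+ 2))%:C) = (fun w => (ln (normc (g w)))%:C).
    apply/funext => w; have [->|gw0] := eqVneq (g w) 0.
      by rewrite normc0 expr0n /= ln0 // mulr0.
    by rewrite lnXn ?normc_gt0 // rmorphMn /= -mulr_natl; field.
  by rewrite !mul0r rmorph0 addr0 add0r !(mulrC 2^-1).
have hn : wd D (fun w => (normc (g w))%:C) z (a * W / (2 * N)) (V * a^* / (2 * N)).
  have n0 : 0 < normc V ^+ 2 by rewrite exprn_gt0.
  have := wd_comp_real (wd_normc2 erefl H) (is_derive1_sqrt n0).
  have -> : (fun w => (Num.sqrt (normc (g w) ^+ 2))%:C) = (fun w => (normc (g w))%:C).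
    by apply/funext => w; rewrite sqrtr_sqr ger0_norm ?normc_ge0.
  rewrite -/V sqrtr_sqr ger0_norm ?normc_ge0 // fmorphV rmorphM /= rmorph_nat -/N -/W.
  by rewrite rmorph0 mulr0 mul0r addr0 add0r !(mulrC (2 * N)^-1).
have hX : wd D (fun w => (complex.Re (g w))%:C) z (a / 2) (a^* / 2).
  have := wdZ 2^-1 (wdD H (wd_conj H)).
  have -> : (fun w => 2^-1 * (g w + (g w)^*)) = (fun w => (complex.Re (g w))%:C).
    by apply/funext => w; rewrite Re_conj mulrC.
  by rewrite rmorph0 addr0 add0r !(mulrC 2^-1).
have hY : wd D (fun w => (complex.Im (g w))%:C) z (- a / 2 * 'i) (a^* / 2 * 'i).
  have := wdZ ('i / 2) (wdB (wd_conj H) H).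
  have -> : (fun w => 'i / 2 * ((g w)^* - g w)) = (fun w => (complex.Im (g w))%:C).
    by apply/funext => w; rewrite Im_conj; ring.
  have E c : 'i / 2 * c = c / 2 * 'i by rewrite mulrC mulrA mulrAC.
  by rewrite rmorph0 sub0r subr0 !E.
set X : C := (complex.Re V)%:C; set Y : C := (complex.Im V)%:C.
have XE : X = (V + W) / 2 by rewrite /X Re_conj.
have YE : Y = (W - V) / 2 * 'i by rewrite /Y Im_conj.
have nX : complex.Re V <= normc V := le_trans (ler_norm _) (ler_Re_normc V).
have S0 : N + X != 0.
  by rewrite /N /X -rmorphD -normc_eq0 normc_real normr_eq0 lt0r_neq0 //; lra.
have hu := wdM hY (wdV (v := fun w => (normc (g w))%:C + (complex.Re (g w))%:C) S0 (wdD hn hX)).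
rewrite (_ : (fun w => _ * _) = (fun w => (uarg (g w))%:C)) in hu; last first.
  by apply/funext => w; rewrite /uarg rmorphM /= fmorphV rmorphD.
have ha := wd_comp_real hu (is_derive1_atan (uarg V)).
have := wdD hln (wdZ ('i * 2) ha).
have -> : (fun w => (ln (normc (g w)))%:C + 'i * 2 * (atan (uarg (g w)))%:C) = (fun w => clnp (g w)).
  by apply/funext => w; rewrite /clnp -mulrA rmorphM /= rmorph_nat.
rewrite fmorphV rmorphD rmorph1 rmorphXn /= /uarg rmorphM /= fmorphV rmorphD /= -/N -/X -/Y.
have i2 : ('i : C) * 'i = -1 by rewrite -expr2; exact: sqrCi.
have S1 : N + (V + W) / 2 != 0 by rewrite -XE.
have [e1 e2] := half_angle_identity a a^* N0 W0 S1 N2 i2.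
by rewrite XE YE e1 conjcM conjcV e2.
Qed.

End HalfAngleLogarithm.

(** * Three weakly singular kernels *)

Section BaseKernels.
Variables (R : realType) (r be : R).
Hypotheses (r0 : 0 < r) (be0 : 0 < be) (be2 : be < 1 / 2).
Local Notation C := R[i].
Local Notation D := (cdisk r).
Local Notation D2 := [set p : R * R | cdisk r (pc p)].
Local Notation m := (msing be).
Local Notation kdiff := (kdiff r be).
Implicit Types (z w x : C).

(** Twice this real part is (r^2 - |w|^2) + (r^2 - |x|^2) + |w - x|^2. *)
Lemma Re_reflected_gt0 w x : D w -> D x -> x != w ->
  0 < complex.Re ((r ^+ 2)%:C - w * x^*).
Proof.
rewrite -[w]pcK -[x]pcK /= !cdisk_pcE //=.
case: w x => a b [c d] /= Dw Dx; rewrite eq_sym => xw.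
have : 0 < (a - c) ^+ 2 + (b - d) ^+ 2.
  rewrite lt0r addr_ge0 ?sqr_ge0 // andbT paddr_eq0 ?sqr_ge0 // !sqrf_eq0 !subr_eq0.
  by apply: contra xw => /andP[/eqP -> /eqP ->].
by nra.
Qed.

(** |r^2 - w conj x|^2 - r^2 |x - w|^2 = (r^2 - |w|^2) (r^2 - |x|^2). Up to the
    boundary, the logarithm of the reflected distance is therefore no more
    singular than that of the distance. *)
Lemma normc_reflected_ge w x : D w -> D x ->
  r * normc (x - w) <= normc ((r ^+ 2)%:C - w * x^*).
Proof.
rewrite -[w]pcK -[x]pcK /= !cdisk_pcE //= => Dw Dx.
rewrite -(ler_pXn2r (n := 2)) ?nnegrE ?normc_ge0 ?mulr_ge0 ?normc_ge0 ?(ltW r0) //.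
rewrite exprMn !sqr_normc_ReIm; move: Dw Dx; case: w x => a b [c d] /= Dw Dx.
have h1 : 0 <= r ^+ 2 - (a ^+ 2 + b ^+ 2) by rewrite subr_ge0.
have h2 : 0 <= r ^+ 2 - (c ^+ 2 + d ^+ 2) by rewrite subr_ge0.
have := mulr_ge0 h1 h2; nra.
Qed.

Let nsub w x : x != w -> 0 < normc (x - w).
Proof. by rewrite normc_gt0 subr_eq0. Qed.

Let sub_neq0 w x : x != w -> w - x != 0.
Proof. by rewrite subr_eq0 eq_sym. Qed.

Let cm_sub w : cmeas D2 (fun x => w - x).
Proof. by apply: cmeasB; [exact: cmeas_cst|exact: cmeas_id]. Qed.

(** The kernel has modulus 1 and its derivatives have modulus 1 / |z - x|. *)
Lemma kdiff_beurling z : D z ->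
  kdiff z (fun w x => (w - x)^* / (w - x)) (fun x => - (z - x)^* / (z - x) ^+ 2)
    (fun x => (z - x)^-1).
Proof.
move=> Dz; have [c0 c00 cm] := msing_lower r0 be2; have [c1 c10 ci] := inv_le_msing r0 be2.
have nq w x : x != w -> normc ((w - x)^* / (w - x)) = 1.
  move=> xw; rewrite normcM normcV normc_conj divff // lt0r_neq0 //.
  by rewrite normcB nsub.
exists (c0 + 2 * c1).
have M1 w x t : D w -> D x -> x != w -> t <= c1 * m w x -> t <= (c0 + 2 * c1) * m w x.
  move=> Dw Dx xw; have := msing_ge0 be w x; have := cm _ _ Dw Dx xw.
  have : 0 <= c1 * m w x by rewrite mulr_ge0 ?msing_ge0. 
  have : 0 <= c0 * m w x by rewrite mulr_ge0 ?msing_ge0.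
  by rewrite mulrDl -mulrA; lra.
split.
- by rewrite addr_ge0 // mulr_ge0.
- by move=> w Dw; apply: cmeasM; [exact: cmeas_conj|exact: cmeasV].
- apply: cmeasM; first by apply: cmeasN; exact: cmeas_conj.
  by apply: cmeasV; exact: cmeasX.
- exact: cmeasV.
- move=> w x Dw Dx xw; rewrite nq //; apply: le_trans (cm _ _ Dw Dx xw) _.
  by rewrite ler_wpM2r ?msing_ge0 // lerDl mulr_ge0.
- move=> x Dx xz; apply: M1 => //; apply: le_trans (ci _ _ Dz Dx xz).
  rewrite normcM normcN normc_conj normcV normcX normcB.
  by rewrite expr2 invfM mulrA divff ?mul1r // lt0r_neq0 // nsub.
- move=> x Dx xz; apply: M1 => //; apply: le_trans (ci _ _ Dz Dx xz).
  by rewrite normcV normcB.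
- move=> w x Dw Dx xw xz.
  have -> : (w - x)^* / (w - x) - (z - x)^* / (z - x) =
    ((w - z)^* - (z - x)^* / (z - x) * (w - z)) / (w - x).
    rewrite [(w - z)^*](_ : _ = (w - x)^* - (z - x)^*); last by rewrite -conjcB; congr (_^*); ring.
    move: (sub_neq0 xw) (sub_neq0 xz); move: (w - x)^* (z - x)^* => A B; move=> h1 h2.
    by field; rewrite h1 h2.
  rewrite normcM normcV [normc (w - x)]normcB.
  apply: (@le_trans _ _ (2 * normc (w - z) * (c1 * m w x))).
    apply: ler_pM; rewrite ?invr_ge0 ?normc_ge0 ?ci //.
    apply: (le_trans (normcD _ _)); rewrite normcN normcM nq // normc_conj; lra.
  have a1 : 0 <= normc (w - z) * (c0 * (m z x + m w x)).
    by rewrite !mulr_ge0 ?normc_ge0 ?addr_ge0 ?msing_ge0.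
  have a2 : 0 <= normc (w - z) * (c1 * m z x).
    by rewrite !mulr_ge0 ?normc_ge0 ?msing_ge0.
  by lra.
- move=> x Dx xz; have q0 := sub_neq0 xz.
  have hp : wd D (fun w => w - x) z (1 - 0) (0 - 0) := wdB (wd_id D z) (wd_cst D x z).
  rewrite !subr0 in hp.
  have := wdM (wd_conj hp) (wdV (v := fun w => w - x) q0 hp).
  by congr wd; rewrite ?rmorph0 ?rmorph1; field.
Qed.

Lemma kdiff_ln z : D z ->
  kdiff z (fun w x => (ln (normc (w - x) ^+ 2))%:C) (fun x => (z - x)^-1)
    (fun x => ((z - x)^-1)^*).
Proof.
move=> Dz; have [c0 c00 cm] := msing_lower r0 be2; have [c1 c10 ci] := inv_le_msing r0 be2.
have lnE w x : x != w -> (ln (normc (w - x) ^+ 2))%:C = (2 * ln (normc (x - w)))%:C :> C.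
  by move=> xw; rewrite normcB lnXn ?nsub // mulr_natl.
exists (4 * r * c0 + 2 * c1).
have M1 w x t : D w -> D x -> x != w -> t <= c1 * m w x -> t <= (4 * r * c0 + 2 * c1) * m w x.
  move=> Dw Dx xw.
  have : 0 <= c1 * m w x by rewrite mulr_ge0 ?msing_ge0. 
  have : 0 <= r * (c0 * m w x) by rewrite !mulr_ge0 ?msing_ge0 // ltW.
  by rewrite mulrDl -!mulrA; lra.
split.
- by rewrite addr_ge0 // !mulr_ge0 // ltW.
- move=> w Dw; apply: cmeas_real; apply: measurableT_comp (@measurable_ln R) _.
  by apply: measurable_funX; exact: (measurable_normc (cm_sub w)).
- exact: cmeasV.
- by apply: cmeas_conj; exact: cmeasV.
- move=> w x Dw Dx xw; rewrite lnE // normc_real normrM ger0_norm //.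
  have h := ler_norm_ln (nsub xw); have h2 := cdisk_dist Dw Dx.
  have h3 := ci _ _ Dw Dx xw; have h4 := cm _ _ Dw Dx xw.
  have h5 : 2 * r <= 2 * r * (c0 * m w x) by rewrite -[leLHS]mulr1 ler_wpM2l // mulr_ge0 // ltW.
  by rewrite mulrDl; lra.
- by move=> x Dx xz; apply: M1 => //; rewrite normcV normcB ci.
- by move=> x Dx xz; apply: M1 => //; rewrite normc_conj normcV normcB ci.
- move=> w x Dw Dx xw xz; rewrite !lnE // -rmorphB normc_real -mulrBr normrM ger0_norm //.
  have h := ler_dist_ln (nsub xw) (nsub xz).
  have h1 : `|normc (x - w) - normc (x - z)| <= normc (w - z).
    apply: le_trans (ler_dist_normc _ _) _; rewrite normcB.
    by rewrite (_ : x - z - (x - w) = w - z) //; ring.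
  have h2 := ci _ _ Dw Dx xw; have h3 := ci _ _ Dz Dx xz.
  have h4 : `|ln (normc (x - w)) - ln (normc (x - z))| <= normc (w - z) * (c1 * m w x + c1 * m z x).
    apply: le_trans h _; apply: ler_pM => //; last exact: lerD.
    by rewrite addr_ge0 // invr_ge0 normc_ge0.
  have h5 : 0 <= r * c0 * (normc (w - z) * (m z x + m w x)).
    by rewrite !mulr_ge0 ?normc_ge0 ?addr_ge0 ?msing_ge0 // ltW.
  by lra.
- move=> x Dx xz; have q0 := sub_neq0 xz.
  have hp : wd D (fun w => w - x) z (1 - 0) (0 - 0) := wdB (wd_id D z) (wd_cst D x z).
  rewrite !subr0 in hp.
  have := wd_ln_normc2 (g := fun w => w - x) q0 hp.
  by rewrite !mul0r !mul1r rmorph0 addr0 add0r.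
Qed.

(** [normc_reflected_ge] bounds the derivative by the singularity 1 / |z - x|,
    uniformly up to the boundary of the disk. *)
Lemma kdiff_clnp z : D z ->
  kdiff z (fun w x => clnp ((r ^+ 2)%:C - w * x^*))
    (fun x => - x^* / ((r ^+ 2)%:C - z * x^*)) (fun=> 0).
Proof.
move=> Dz; have [c0 c00 cm] := msing_lower r0 be2; have [c1 c10 ci] := inv_le_msing r0 be2.
pose Y w x : C := (r ^+ 2)%:C - w * x^*.
have Y0 w x : D w -> D x -> x != w -> 0 < normc (Y w x).
  move=> Dw Dx xw; apply: lt_le_trans (normc_reflected_ge Dw Dx).
  by rewrite mulr_gt0 // nsub.
have YV w x : D w -> D x -> x != w -> (normc (Y w x))^-1 <= r^-1 * c1 * m w x.
  move=> Dw Dx xw; apply: (@le_trans _ _ (r * normc (x - w))^-1).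
    by rewrite lef_pV2 ?posrE ?Y0 ?mulr_gt0 ?nsub // normc_reflected_ge.
  by rewrite invfM -mulrA ler_wpM2l ?invr_ge0 ?(ltW r0) // ci.
have Yle w x : D w -> D x -> normc (Y w x) <= 2 * r ^+ 2.
  move=> Dw Dx; apply: (le_trans (normcD _ _)).
  rewrite normcN normcM normc_conj normc_real ger0_norm ?sqr_ge0 //.
  have : normc w * normc x <= r * r by apply: ler_pM; rewrite ?normc_ge0.
  by rewrite -expr2; lra.
have nS (a b : R) : normc (a%:C + 'i * b%:C) <= `|a| + `|b|.
  apply: (le_trans (normcD _ _)); rewrite normcM !normc_real.
  have -> : normc ('i : C) = 1 by rewrite -complexiE /normc /= expr0n expr1n add0r sqrtr1.
  by rewrite mul1r.
pose M := (2 * r ^+ 2 + 2 * pi) * c0 + 14 * c1 + r^-1 * c1.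
exists M.
have p0 := pi_gt0 R.
have rV0 : 0 <= r^-1 by rewrite invr_ge0 ltW.
have cc : 0 <= (2 * r ^+ 2 + 2 * pi) * c0 by rewrite mulr_ge0 // addr_ge0 ?mulr_ge0 ?sqr_ge0 // ltW.
have rc : 0 <= r^-1 * c1 by rewrite mulr_ge0.
have M1 w x t : t <= ((2 * r ^+ 2 + 2 * pi) * c0 + r^-1 * c1) * m w x -> t <= M * m w x.
  move/le_trans; apply; rewrite ler_wpM2r ?msing_ge0 // /M; lra.
have M2 w x t : t <= c1 * m w x -> t <= M * m w x.
  move/le_trans; apply; rewrite ler_wpM2r ?msing_ge0 // /M; lra.
have mY w : cmeas D2 (Y w).
  by apply: cmeasB; [exact: cmeas_cst|apply: cmeasM; [exact: cmeas_cst|apply: cmeas_conj; exact: cmeas_id]].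
split.
- by rewrite /M; lra.
- move=> w Dw; apply: cmeasD; first exact: (cmeas_ln (mY w)).
  apply: cmeasM; first exact: cmeas_cst.
  apply: (cmeas_real (h := fun x => 2 * atan (uarg (Y w x)))); apply: measurable_funM => //.
  apply: measurableT_comp; first by apply: continuous_measurable_fun => t; exact: continuous_atan.
  have [mR mI] := mY w; apply: measurable_funM => //.
  apply: measurable_fun_inv; apply: measurable_funD => //; exact: (measurable_normc (mY w)).
- apply: cmeasM; last exact: (cmeasV (mY z)).
  by apply: cmeasN; apply: cmeas_conj; exact: cmeas_id.
- exact: cmeas_cst.
- move=> w x Dw Dx xw; apply: M1; apply: (le_trans (nS _ _)).
  have h1 := ler_norm_ln (Y0 _ _ Dw Dx xw); rewrite -/(Y w x).
  have h2 := ler_norm_atan (uarg (Y w x)).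
  have h3 := YV _ _ Dw Dx xw; have h4 := cm _ _ Dw Dx xw; have h5 := Yle _ _ Dw Dx.
  rewrite (_ : `|2 * atan (uarg (Y w x))| = 2 * `|atan (uarg (Y w x))|); last by rewrite normrM ger0_norm.
  have h6 : 2 * r ^+ 2 + 2 * pi <= (2 * r ^+ 2 + 2 * pi) * (c0 * m w x).
    by rewrite -[leLHS]mulr1 ler_wpM2l // addr_ge0 ?mulr_ge0 ?sqr_ge0 // ltW.
  by lra.
- move=> x Dx xz; apply: M2; rewrite normcM normcN normc_conj normcV.
  apply: (@le_trans _ _ (r * (r^-1 * c1 * m z x))).
    by apply: ler_pM; rewrite ?invr_ge0 ?normc_ge0 ?YV.
  by rewrite !mulrA divff ?lt0r_neq0 // mul1r.
- by move=> x Dx xz; rewrite normc0 mulr_ge0 ?msing_ge0 // /M; lra.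
- move=> w x Dw Dx xw xz; rewrite -/(Y w x) -/(Y z x).
  have dY : normc (Y w x - Y z x) <= r * normc (w - z).
    rewrite (_ : Y w x - Y z x = - (w - z) * x^*); last by rewrite /Y; ring.
    by rewrite normcM normcN normc_conj mulrC ler_wpM2r ?normc_ge0.
  have -> : clnp (Y w x) - clnp (Y z x) = (ln (normc (Y w x)) - ln (normc (Y z x)))%:C +
     'i * (2 * (atan (uarg (Y w x)) - atan (uarg (Y z x))))%:C.
    rewrite /clnp mulrBr !rmorphB /=; move: ('i : C) => I; ring.
  apply: (le_trans (nS _ _)).
  have Yw := YV _ _ Dw Dx xw; have Yz := YV _ _ Dz Dx xz.
  have h1 : `|ln (normc (Y w x)) - ln (normc (Y z x))| <=
      (r * normc (w - z)) * (r^-1 * c1 * m w x + r^-1 * c1 * m z x).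
    apply: le_trans (ler_dist_ln (Y0 _ _ Dw Dx xw) (Y0 _ _ Dz Dx xz)) _.
    apply: ler_pM => //.
    - by rewrite addr_ge0 // invr_ge0 normc_ge0.
    - exact: le_trans (ler_dist_normc _ _) dY.
    - exact: lerD.
  have h2 : `|atan (uarg (Y w x)) - atan (uarg (Y z x))| <=
      3 * ((r * normc (w - z)) * (r^-1 * c1 * m w x)).
    apply: le_trans (ler_dist_atan _ _) _.
    apply: le_trans (ler_dist_uarg (Re_reflected_gt0 Dw Dx xw) (Re_reflected_gt0 Dz Dx xz)) _.
    by rewrite ler_wpM2l //; apply: ler_pM; rewrite ?invr_ge0 ?normc_ge0.
  have rE t : r * normc (w - z) * (r^-1 * c1 * t) = normc (w - z) * (c1 * t).
    by field; exact: lt0r_neq0.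
  rewrite mulrDr !rE in h1; rewrite rE in h2.
  rewrite [`|2 * _|]normrM [`|2|]ger0_norm //.
  have k1 : 0 <= normc (w - z) * (c1 * m w x) by rewrite !mulr_ge0 ?normc_ge0 ?msing_ge0.
  have k2 : 0 <= normc (w - z) * (c1 * m z x) by rewrite !mulr_ge0 ?normc_ge0 ?msing_ge0.
  have -> : M * normc (w - z) * (m z x + m w x) =
    ((2 * r ^+ 2 + 2 * pi) * c0 + r^-1 * c1) * (normc (w - z) * (m z x + m w x)) +
    14 * (normc (w - z) * (c1 * m w x)) + 14 * (normc (w - z) * (c1 * m z x)).
    by rewrite /M; ring.
  have k3 : 0 <= ((2 * r ^+ 2 + 2 * pi) * c0 + r^-1 * c1) * (normc (w - z) * (m z x + m w x)).
    by rewrite !mulr_ge0 ?normc_ge0 ?addr_ge0 ?msing_ge0 //; lra.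
  by lra.
- move=> x Dx xz.
  have hY : wd D (fun w => Y w x) z (- x^*) 0.
    have := wdB (wd_cst D (r ^+ 2)%:C z) (wdM (wd_id D z) (wd_cst D x^* z)).
    by rewrite !mul0r !mulr0 !mul1r !add0r !addr0 oppr0.
  exact: (wd_clnp (g := fun w => Y w x) (Re_reflected_gt0 Dz Dx xz) hY).
Qed.

End BaseKernels.

(** * The Cauchy transform and its iterates *)

Section CauchyTransform.
Variables (R : realType) (r be : R).
Hypotheses (r0 : 0 < r) (be0 : 0 < be) (be2 : be < 1 / 2).
Local Notation C := R[i].
Local Notation mu := (@lebesgue_measure R).
Local Notation mu2 := (mu \x mu)%E.
Local Notation D := (cdisk r).
Local Notation D2 := [set p : R * R | cdisk r (pc p)].
Local Notation m := (msing be).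
Local Notation kdiff := (kdiff r be).
Local Notation cint := (cint r).
Implicit Types (z w x : C) (phi : C -> C).

Let mD2 : measurable (D2 : set (measurableTypeR R * measurableTypeR R)) := measurable_D2 r.

Lemma cintegrable_inv w : D w -> cintegrable r (fun x => (x - w)^-1).
Proof.
move=> Dw; have [c1 c10 ci] := inv_le_msing r0 be2.
apply: (kbound_cintegrable r0 be0 be2 (M := c1) (c := w)).
  by apply: cmeasV; apply: cmeasB; [exact: cmeas_id|exact: cmeas_cst].
by move=> x Dx xw; rewrite normcV ci.
Qed.

Lemma integral_swap (F G : R * R -> \bar R) : mu2.-integrable setT F ->
  mu2.-integrable setT G -> (forall p, G p = F (p.2, p.1)) ->
  (\int[mu2]_p G p = \int[mu2]_p F p)%E.
Proof.
move=> iF iG E.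
rewrite -(integral12_prod_meas1 iG) -(integral21_prod_meas1 iF).
by apply: eq_integral => x _; apply: eq_integral => y _; rewrite E.
Qed.

(** The imaginary part follows from the real part by exchanging the coordinates. *)
Lemma cint_inv w : D w -> cint (fun x => (x - w)^-1) = - (pi%:C * w^*).
Proof.
move=> Dw; have [iR iI] := cintegrable_inv Dw.
have Dw' : D (complex.Im w +i* complex.Re w).
  move: Dw; rewrite -[w]pcK /= !cdisk_pcE //= => h.
  by rewrite (cdisk_pcE r0 (complex.Im w, complex.Re w)) /= addrC.
have [iR' _] := cintegrable_inv Dw'.
have HR (v : C) : D v -> (\int[mu2]_(p in D2) (complex.Re (pc p - v)^-1)%:E = (- (pi * complex.Re v))%:E)%E.
  move=> Dv; have := @integral_Re_inv_disk R r r0 (complex.Re v) (complex.Im v).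
  rewrite (_ : complex.Re v +i* complex.Im v = v); last by case: (v).
  by apply; move: Dv; rewrite -[v]pcK cdisk_pcE.
have HI : (\int[mu2]_(p in D2) (complex.Im (pc p - w)^-1)%:E = (pi * complex.Im w)%:E)%E.
  have iN := integrableZl mD2 (-1) iR'.
  have -> : (pi * complex.Im w)%:E = (\int[mu2]_(p in D2) ((-1)%:E * (complex.Re (pc p - (complex.Im w +i* complex.Re w))^-1)%:E))%E.
    by rewrite integralZl // HR //= -EFinM; congr EFin; ring.
  rewrite integral_mkcond [RHS]integral_mkcond; apply: integral_swap.
  - exact/(integrable_mkcond _ mD2).1.
  - exact/(integrable_mkcond _ mD2).1.
  - move=> [x y]; rewrite !patchE /=.
    have -> : ((x, y) \in D2) = ((y, x) \in D2).
      by apply/idP/idP; rewrite !inE /= !cdisk_pcE //= addrC.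
    case: ifP => // _; rewrite -EFinM; congr EFin.
    by case: (w) => a b /=; rewrite mulN1r; congr (- (_ / _)); rewrite addrC.
rewrite /cint; apply/eqP; rewrite eq_complex /=; apply/andP; split; apply/eqP.
  by rewrite /Rintegral HR //; case: (w) => a b /=; ring.
by rewrite /Rintegral HI; case: (w) => a b /=; ring.
Qed.

(** Continuity with exponent [2 * be] at a single point, with a constant that may
    depend on the point: this is what differentiable functions have. *)
Definition pholder phi z := exists2 H : R, 0 <= H & forall x, D x ->
  normc (phi x - phi z) <= H * normc (x - z) `^ (2 * be).

(** Conditions under which the Cauchy transform is differentiable, boundary points
    included. *)
Record density phi : Prop := Density {
  density_meas : cmeas D2 phi;
  density_bound : exists B : R, forall x, D x -> normc (phi x) <= B;
  density_holder : forall z, D z -> pholder phi z }.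

Lemma density_kreg phi z : density phi -> kreg r z (fun _ => phi) (fun=> 0) (fun=> 0).
Proof. by move=> [mphi bphi _]; exact: kreg_fun. Qed.

Lemma density_conj phi : density phi -> density (fun x => (phi x)^*).
Proof.
move=> [mp [B bp] hp]; split.
- exact: cmeas_conj.
- by exists B => x Dx; rewrite normc_conj bp.
- move=> z /hp [H H0 h]; exists H => // x Dx.
  by rewrite -conjcB normc_conj h.
Qed.

(** The vanishing of [phi] at [z] lowers the singularity of the derivative from
    |x - z|^-2 to the integrable |x - z|^(2 be - 2). *)
Lemma kdiff_cauchy_holder phi z : D z -> cmeas D2 phi ->
  (exists B : R, forall x, D x -> normc (phi x) <= B) ->
  (exists2 H : R, 0 <= H & forall x, D x -> normc (phi x) <= H * normc (x - z) `^ (2 * be)) ->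
  kdiff z (fun w x => phi x / (w - x)) (fun x => - (phi x / (z - x) ^+ 2)) (fun=> 0).
Proof.
move=> Dz mphi [B bphi] [H H0 hphi].
have [c1 c10 ci] := inv_le_msing r0 be2.
have B0 : 0 <= `|B| by [].
have bphi' x : D x -> normc (phi x) <= `|B| by move=> /bphi /le_trans; apply; exact: ler_norm.
pose M := `|B| * c1 + H; exists M.
have M0 : 0 <= `|B| * c1 by rewrite mulr_ge0.
have nsub w x : x != w -> 0 < normc (x - w) by rewrite normc_gt0 subr_eq0.
have cm_sub w : cmeas D2 (fun x => w - x).
  by apply: cmeasB; [exact: cmeas_cst|exact: cmeas_id].
have b2 := be2.
split.
- by rewrite addr_ge0.
- by move=> w Dw; apply: cmeasM => //; exact: cmeasV.
- by apply: cmeasN; apply: cmeasM => //; apply: cmeasV; exact: cmeasX.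
- exact: cmeas_cst.
- move=> w x Dw Dx xw; rewrite normcM normcV normcB.
  apply: (@le_trans _ _ (`|B| * (c1 * m w x))).
    by apply: ler_pM; rewrite ?invr_ge0 ?normc_ge0 ?bphi' ?ci.
  by rewrite mulrA ler_wpM2r ?msing_ge0 // /M; lra.
- move=> x Dx xz; rewrite normcN normcM normcV normcX normcB.
  have n0 := nsub _ _ xz.
  apply: (@le_trans _ _ (H * m z x)); last by rewrite ler_wpM2r ?msing_ge0 // /M; lra.
  rewrite ler_pdivrMr ?exprn_gt0 //; apply: le_trans (hphi _ Dx) _.
  rewrite -mulrA ler_wpM2l // /msing -powR_mulrn ?normc_ge0 // -powRD; last first.
    by rewrite (gt_eqF n0) implybT.
  by rewrite (_ : 2 * be - 2 + 2%:R = 2 * be) //; ring.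
- by move=> x Dx xz; rewrite normc0 mulr_ge0 ?msing_ge0 // addr_ge0.
- move=> w x Dw Dx xw xz; have t0 := nsub _ _ xz; have s0 := nsub _ _ xw.
  have -> : phi x / (w - x) - phi x / (z - x) = - (w - z) * (phi x / ((w - x) * (z - x))).
    by field; rewrite !subr_eq0 ![_ == x]eq_sym xw xz.
  rewrite normcM normcN [M * _]mulrC -mulrA ler_wpM2l ?normc_ge0 //.
  rewrite normcM normcV normcM [normc (w - x)]normcB [normc (z - x)]normcB.
  set t := normc (x - z) in t0 *; set s := normc (x - w) in s0 *.
  apply: (@le_trans _ _ (H * (m z x + m w x))); last first.
    by rewrite ler_wpM2r ?addr_ge0 ?msing_ge0 // /M; lra.
  apply: (@le_trans _ _ (H * t `^ (2 * be) * (s * t)^-1)).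
    by rewrite ler_wpM2r ?hphi // invr_ge0 mulr_ge0 ?ltW.
  rewrite -mulrA ler_wpM2l //.
  have tt : t `^ (2 * be) * t^-1 = t `^ (2 * be - 1).
    by rewrite -powR_inv1 ?(ltW t0) // -powRD // (gt_eqF t0) implybT.
  rewrite invfM mulrA mulrAC tt.
  have pw (a : R) : 0 < a -> a `^ (2 * be - 1) / a = a `^ (2 * be - 2).
    move=> a0; rewrite -powR_inv1 ?(ltW a0) // -powRD; last by rewrite (gt_eqF a0) implybT.
    by congr (_ `^ _); ring.
  rewrite /msing -/t -/s; have [ts|st] := leP t s.
    apply: (@le_trans _ _ (t `^ (2 * be - 1) / t)).
      by rewrite ler_wpM2l ?powR_ge0 // lef_pV2.
    by rewrite pw // lerDl powR_ge0.
  apply: (@le_trans _ _ (s `^ (2 * be - 1) / s)).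
    rewrite ler_wpM2r ?invr_ge0 ?(ltW s0) //.
    rewrite (_ : 2 * be - 1 = - (1 - 2 * be)); last by ring.
    rewrite !powRN lef_pV2 ?posrE ?powR_gt0 //.
    by apply: ge0_ler_powR; rewrite ?nnegrE ?(ltW s0) ?(ltW t0) ?(ltW st) //; lra.
  by rewrite pw // lerDr powR_ge0.
- move=> x Dx xz; have q0 : z - x != 0 by rewrite subr_eq0 eq_sym.
  have hp : wd D (fun w => w - x) z (1 - 0) (0 - 0) := wdB (wd_id D z) (wd_cst D x z).
  rewrite !subr0 in hp.
  have := wdZ (phi x) (wdV (v := fun w => w - x) q0 hp).
  by rewrite oppr0 mul0r mulr0 mulNr div1r mulrN.
Qed.

(** Replace [phi] by [phi - phi z], whose transform can be differentiated under
    the integral sign and contributes nothing to the derivative in the conjugate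
    variable. The constant [phi z] contributes everything, because by [cint_inv]
    the transform of 1 is [pi] times the conjugate of [w] on the whole disk. *)
Lemma cauchy_wd phi z : density phi -> D z ->
  exists a, wd D (fun w => cint (fun x => phi x / (w - x))) z a (pi%:C * phi z).
Proof.
move=> [mp [B bp] hp] Dz; have [H H0 hz] := hp _ Dz.
pose k x := phi x - phi z.
have mk : cmeas D2 k by apply: cmeasB => //; exact: cmeas_cst.
have kk := kdiff_cauchy_holder Dz mk.
have {}kk : kdiff z (fun w x => k x / (w - x)) (fun x => - (k x / (z - x) ^+ 2)) (fun=> 0).
  apply: kk; last by exists H.
  exists (B + normc (phi z)) => x Dx; apply: (le_trans (normcD _ _)).
  by rewrite normcN lerD2r bp.
have := cint_wd r0 be0 be2 Dz kk.
set A := cint _; have -> : cint (fun=> 0) = 0.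
  rewrite (@cint_ext _ _ _ (fun=> 0 * 0)); last by move=> x _; rewrite mul0r.
  by rewrite cintZ ?mul0r //; exact: cintegrable_cst.
move=> Hk; exists (A + phi z * (pi%:C * 0)).
have W : wd D (fun w => phi z * (pi%:C * w^*)) z (phi z * (pi%:C * 0)) (phi z * (pi%:C * 1)).
  apply: wdZ; apply: wdZ; have := wd_conj (wd_id D z).
  by rewrite rmorph0 rmorph1.
have := wdD Hk W; rewrite add0r mulr1 [phi z * pi%:C]mulrC.
apply: wd_ext => // w Dw.
have -> : phi z * (pi%:C * w^*) = cint (fun x => - phi z * (x - w)^-1).
  rewrite cintZ ?cint_inv //; first by ring.
  exact: cintegrable_inv.
rewrite -cintD //.
- apply: cint_ext => x _; rewrite /k.
  have -> : (x - w)^-1 = - (w - x)^-1 by rewrite -invrN opprB.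
  ring.
- exact: (kdiff_cintegrable r0 be0 be2 Dw kk).
- by apply: cintegrableZ; exact: cintegrable_inv.
Qed.

(** Up to the factor 1 / (pi n!), the kernel of a right inverse of the (n+1)-st
    power of delbar. *)
Definition pker n w x : C := (w - x)^* ^+ n / (w - x).

Lemma kreg_subconj z : kreg r z (fun w x => (w - x)^*) (fun=> 0) (fun=> 1).
Proof.
have := kreg_conj (kregD (kreg_var r0 z) (kreg_fun z (cmeasN (cmeas_id D2)) _)).
rewrite addr0 rmorph0 addr0 rmorph1; apply.
by exists r => x Dx; rewrite normcN.
Qed.

Lemma kreg_subconjX z n : D z ->
  kreg r z (fun w x => (w - x)^* ^+ n) (fun=> 0) (fun x => n%:R * (z - x)^* ^+ n.-1).
Proof.
move=> Dz; elim: n => [|n IH].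
  by apply: kreg_ext (kreg_cst r z 1) => // x _; rewrite mul0r.
apply: kreg_ext (kregM Dz (kreg_subconj z) IH) => //.
- by move=> w x _ _; rewrite exprS.
- by move=> x _; rewrite mul0r mulr0 addr0.
- move=> x _; rewrite mul1r; case: n {IH} => [|n]; first by rewrite !mul0r mulr0 addr0 mul1r.
  by rewrite /= [n.+2%:R]mulrSr mulrDl mul1r addrC; congr (_ + _); rewrite exprS; ring.
Qed.

Lemma kdiff_pker n z : D z ->
  exists Ka, kdiff z (pker n.+1) Ka (fun x => n.+1%:R * pker n z x).
Proof.
move=> Dz.
have := kdiffM Dz (kdiff_beurling r0 be2 Dz) (kreg_subconjX n Dz).
set Ka := (X in kdiff _ _ X _) => H; exists Ka; apply: kdiff_ext H => //.
  by move=> w x _ _ _; rewrite /pker exprS mulrAC.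
move=> x Dx xz; rewrite /pker; have q0 : z - x != 0 by rewrite subr_eq0 eq_sym.
case: n {Ka} => [|n]; first by rewrite !expr0 mul0r mulr0 addr0 mul1r mulr1 div1r.
rewrite /= [n.+2%:R]mulrSr mulrDl mul1r addrC mulrC; congr (_ + _); last exact: mulrC.
by rewrite exprS; field.
Qed.

Definition cauchy_iter n phi : C -> C :=
  if n is n'.+1 then
    fun z => ((pi%:C * n'`!%:R)^-1 : C) * cint (fun x => pker n' z x * phi x)
  else phi.

Lemma pi_neq0 : (pi : R)%:C != 0 :> C.
Proof. by rewrite -normc_eq0 normc_real normr_eq0 lt0r_neq0 // pi_gt0. Qed.

Lemma fact_neq0 n : n`!%:R != 0 :> C.
Proof. by rewrite pnatr_eq0 -lt0n fact_gt0. Qed.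

(** For [n = 0] this is the Cauchy transform; the kernels of higher order are
    bounded, and differentiating [pker n.+1] gives [pker n]. *)
Lemma cauchy_iterS n phi z : density phi -> D z ->
  exists a, wd D (cauchy_iter n.+1 phi) z a (cauchy_iter n phi z).
Proof.
move=> nphi Dz; case: n => [|n] /=.
  have [a Ha] := cauchy_wd nphi Dz; have := wdZ (pi%:C * 0`!%:R)^-1 Ha.
  have -> : (pi%:C * 0`!%:R)^-1 * (pi%:C * phi z) = phi z.
    by rewrite fact0 mulr1 mulrA mulVf ?pi_neq0 ?mul1r.
  move=> H; eexists; apply: wd_ext H => // w Dw; congr (_ * _).
  by apply: cint_ext => x _; rewrite /pker expr0 mul1r mulrC.
have [Ka H] := kdiff_pker n Dz.
have := kdiffM Dz H (density_kreg z nphi).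
set Ka' := (X in kdiff _ _ X _) => kH.
have := cint_wd r0 be0 be2 Dz kH => /(wdZ (pi%:C * n.+1`!%:R)^-1).
set c := (X in wd _ _ _ _ X) => Hw; exists ((pi%:C * (n.+1)`!%:R)^-1 * cint Ka').
suff <- : c = (pi%:C * n`!%:R)^-1 * cint (fun x => pker n z x * phi x) by exact: Hw.
rewrite /c.
have ik := kdiff_cintegrableb r0 be0 be2 kH.
have -> : (pi%:C * n`!%:R)^-1 = (pi%:C * n.+1`!%:R)^-1 * n.+1%:R :> C.
  rewrite factS natrM [n.+1%:R * _]mulrC mulrA [in RHS]invfM -mulrA.
  by rewrite mulVf ?mulr1 // pnatr_eq0.
rewrite -[RHS]mulrA; congr (_ * _); rewrite -cintZ; first by apply: cint_ext => x _; ring.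
have := cintegrableZ n.+1%:R^-1 ik; apply: cintegrable_ext => x _.
by rewrite mulr0 addr0 -mulrA mulKf // pnatr_eq0.
Qed.

End CauchyTransform.

(** * Continuous functions on the disk *)

Section ContinuousOnDisk.
Variables (R : realType) (r be : R).
Hypotheses (r0 : 0 < r) (be0 : 0 < be) (be2 : be < 1 / 2).
Local Notation C := R[i].
Local Notation D := (cdisk r).
Local Notation D2 := [set p : R * R | cdisk r (pc p)].
Implicit Types (z w x : C) (f : C -> C).

Definition continuous_disk f := forall z, D z -> forall eps : R, 0 < eps ->
  exists2 d : R, 0 < d & forall x, D x -> normc (x - z) < d -> normc (f x - f z) <= eps.

Let pc_dist (p q : R * R) : normc (pc p - pc q) <= `|p.1 - q.1| + `|p.2 - q.2|.
Proof. exact: normc_le_ReIm. Qed.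

(** A superlevel set is the trace on the disk of a countable union of squares with
    rational centres, namely of those on which the function stays above the
    level. *)
Let measurable_real (h : C -> R) :
  (forall z, D z -> forall eps : R, 0 < eps -> exists2 d : R, 0 < d &
    forall x, D x -> normc (x - z) < d -> `|h x - h z| <= eps) ->
  measurable_fun D2 (fun p => h (pc p)).
Proof.
move=> ch mD; apply: (measurability _ (RGenOInfty.measurableE R)) => //.
move=> /= _ [_ [a ->] <-]; rewrite preimage_itvoy.
pose Box (k : nat) (q1 q2 : rat) : set (R * R) :=
  [set p | `|p.1 - ratr q1| < k.+1%:R^-1] `&` [set p | `|p.2 - ratr q2| < k.+1%:R^-1].
pose F k q1 q2 : set (R * R) :=
  if `[< forall p, D2 p -> Box k q1 q2 p -> a < h (pc p) >] then Box k q1 q2 else set0.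
have mF k q1 q2 : measurable (F k q1 q2).
  rewrite /F; case: asboolP => // _; apply: measurableI.
    rewrite (_ : [set p | _] = fst @^-1` (ball (ratr q1 : R) k.+1%:R^-1)); last first.
      by apply/seteqP; split => p; rewrite /= /ball /= distrC.
    by rewrite -[X in measurable X]setTI; apply: measurable_fst => //; exact: measurable_ball.
  rewrite (_ : [set p | _] = snd @^-1` (ball (ratr q2 : R) k.+1%:R^-1)); last first.
    by apply/seteqP; split => p; rewrite /= /ball /= distrC.
  by rewrite -[X in measurable X]setTI; apply: measurable_snd => //; exact: measurable_ball.
rewrite (_ : _ `&` _ = D2 `&` \bigcup_k \bigcup_q1 \bigcup_q2 F k q1 q2); last first.
  apply/seteqP; split => p /= [Dp ap]; split=> //.
    have e0 : 0 < (h (pc p) - a) / 2 by move: ap; lra.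
    have [d d0 hd] := ch _ Dp _ e0.
    have d4 : 0 < d / 4 by lra.
    have [k kd] : exists k : nat, k.+1%:R^-1 < d / 4.
      by near \oo => k; exists k; near: k; exact: near_infty_natSinv_lt (PosNum d4).
    have k0 : 0 < k.+1%:R^-1 :> R by rewrite invr_gt0 ltr0n.
    have lt2 (t : R) : t - k.+1%:R^-1 < t + k.+1%:R^-1.
      by move: (k.+1%:R^-1) k0 => s s0; lra.
    have [q1 q1P] := @rat_in_itvoo _ (p.1 - k.+1%:R^-1) (p.1 + k.+1%:R^-1) (lt2 _).
    have [q2 q2P] := @rat_in_itvoo _ (p.2 - k.+1%:R^-1) (p.2 + k.+1%:R^-1) (lt2 _).
    move: q1P q2P; rewrite !in_itv /= => /andP[a1 a2] /andP[b1 b2].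
    have pB : Box k q1 q2 p.
      by split; rewrite /= ltr_norml; apply/andP; move: a1 a2 b1 b2; move: (k.+1%:R^-1) => *; lra.
    exists k => //; exists q1 => //; exists q2 => //; rewrite /F.
    case: asboolP => // -[]; move=> p' Dp' [/= c1 c2].
    have : `|h (pc p') - h (pc p)| <= (h (pc p) - a) / 2.
      apply: hd => //.
      apply: le_lt_trans (pc_dist _ _) _; case: pB => /= e1 e2.
      have : `|p'.1 - p.1| <= `|p'.1 - ratr q1| + `|p.1 - ratr q1|.
        by rewrite [`|p.1 - _|]distrC; exact: ler_distD.
      have : `|p'.2 - p.2| <= `|p'.2 - ratr q2| + `|p.2 - ratr q2|.
        by rewrite [`|p.2 - _|]distrC; exact: ler_distD.
      by move: c1 c2 e1 e2 kd; move: (k.+1%:R^-1) => *; lra.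
    by rewrite ler_norml => /andP[]; lra.
  by move: ap => [k _ [q1 _ [q2 _]]]; rewrite /F; case: asboolP => // H Bp; exact: H.
apply: measurableI => //; apply: bigcup_measurable => k _.
apply: bigcupT_measurable_rat => q1; apply: bigcupT_measurable_rat => q2.
exact: mF.
Unshelve. all: by end_near. Qed.

Lemma continuous_disk_cmeas f : continuous_disk f -> cmeas D2 f.
Proof.
move=> cf; split; apply: (@measurable_real (fun x => _ (f x))) => z Dz eps eps0;
  have [d d0 hd] := cf _ Dz _ eps0; exists d => // x Dx xd;
  apply: le_trans (hd _ Dx xd).
  by apply: le_trans (ler_Re_normc _); case: (f x) (f z) => ? ? [].
by apply: le_trans (ler_Im_normc _); case: (f x) (f z) => ? ? [].
Qed.

(** Compactness is applied to the square around the disk; a point off the disk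
    has a neighbourhood off the disk, where there is nothing to bound. *)
Lemma continuous_disk_bounded f : continuous_disk f ->
  exists B : R, forall x, D x -> normc (f x) <= B.
Proof.
move=> cf; pose Q : set (R * R) := `[- r, r]%classic `*` `[- r, r]%classic.
have cQ : compact Q by apply: compact_setX; exact: segment_compact.
move/compact_near_coveringP: cQ => /(_ nat \oo (fun n p => D2 p -> normc (f (pc p)) <= n%:R)).
move=> /(_ _) [] //.
  move=> p _.
  have [d d0 [B HB]] : exists2 d : R, 0 < d & exists B : R, forall q : R * R,
     normc (pc q - pc p) < d -> D2 q -> normc (f (pc q)) <= B.
    have [Dp|nDp] := pselect (D2 p).
      have [d d0 hd] := cf _ Dp _ ltr01; exists d => //; exists (1 + normc (f (pc p))) => q qd Dq.
      have := hd _ Dq qd; have := normcD (f (pc q) - f (pc p)) (f (pc p)).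
      by rewrite subrK; lra.
    exists (normc (pc p) - r).
      by rewrite subr_gt0 ltNge; apply/negP.
    exists 0 => q qd Dq; exfalso; apply: nDp; rewrite /cdisk /=.
    have Dq' : normc (pc q) <= r by [].
    by have := normcD (pc p - pc q) (pc q); rewrite subrK normcB; lra.
  have d2 : 0 < d / 2 by lra.
  exists (ball p (d / 2), [set n | B <= n%:R]) => /=.
    split; first exact: nbhsx_ballx.
    by near=> n => /=; near: n; exact: nbhs_infty_ger.
  move=> [q n] /= [qb nB] Dq; apply: le_trans nB; apply: HB => //.
  apply: le_lt_trans (pc_dist _ _) _; case: qb; rewrite /ball /= => b1 b2.
  by rewrite [`|q.1 - _|]distrC [`|q.2 - _|]distrC; lra.
move=> n _ /(_ n (leqnn n)) H; exists n%:R => x Dx.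
rewrite -[x]pcK; apply: (H (complex.Re x, complex.Im x)); last by rewrite /= pcK.
have nx : normc x <= r by [].
split; rewrite /= in_itv /= -ler_norml.
  exact: le_trans (ler_Re_normc x) nx.
exact: le_trans (ler_Im_normc x) nx.
Unshelve. all: by end_near. Qed.

Let powR_ge_lin (t : R) : 0 <= t -> t <= 2 * r -> t <= (2 * r) `^ (1 - 2 * be) * t `^ (2 * be).
Proof.
move=> t0 tr; have b2 := be2; have b0 := be0; move: t0; rewrite le_eqVlt => /predU1P[<-|t0].
  by rewrite mulr_ge0 ?powR_ge0.
rewrite -{1}[t]powRr1 ?(ltW t0) // [X in _ `^ X](_ : 1 = (1 - 2 * be) + 2 * be); last by ring.
rewrite powRD; last by rewrite (gt_eqF t0) implybT.
rewrite ler_wpM2r ?powR_ge0 //; apply: ge0_ler_powR; rewrite ?nnegrE ?(ltW t0) //; lra.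
Qed.

(** Differentiability gives a Lipschitz bound near the point, boundedness a bound
    away from it. *)
Lemma wd_density f : (forall z, D z -> exists a b, wd D f z a b) -> density r be f.
Proof.
move=> H.
have cf : continuous_disk f.
  move=> z /H[a [b /wd_lip [K [d [K0 d0 h]]]]] eps eps0.
  have K1 : 0 < K + 1 by lra.
  exists (Num.min d (eps / (K + 1))); first by rewrite lt_min d0 divr_gt0.
  move=> x Dx; rewrite lt_min => /andP[x1]; rewrite ltr_pdivlMr // => x2.
  by apply: le_trans (h _ Dx x1) _; have := normc_ge0 (x - z); nra.
have [B hB] := continuous_disk_bounded cf.
split; [exact: continuous_disk_cmeas|by exists B|].
move=> z Dz; have [a [b /wd_lip [K [d [K0 d0 h]]]]] := H _ Dz.
have B0 : 0 <= B by apply: le_trans (hB _ Dz); exact: normc_ge0.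
pose H1 := K * (2 * r) `^ (1 - 2 * be); pose H2 := 2 * B / d `^ (2 * be).
have H10 : 0 <= H1 by rewrite mulr_ge0 ?powR_ge0.
have H20 : 0 <= H2 by rewrite divr_ge0 ?powR_ge0 // mulr_ge0.
exists (H1 + H2) => [|x Dx]; first exact: addr_ge0.
rewrite mulrDl; have [xd|dx] := ltP (normc (x - z)) d.
  apply: le_trans (h _ Dx xd) _.
  apply: (@le_trans _ _ (H1 * normc (x - z) `^ (2 * be))); last first.
    by rewrite lerDl mulr_ge0 ?powR_ge0.
  by rewrite /H1 -mulrA ler_wpM2l // powR_ge_lin ?normc_ge0 // cdisk_dist.
apply: (@le_trans _ _ (2 * B)).
  by apply: (le_trans (normcD _ _)); rewrite normcN mulr_natl mulr2n lerD ?hB.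
apply: (@le_trans _ _ (H2 * normc (x - z) `^ (2 * be))); last first.
  by rewrite lerDr mulr_ge0 ?powR_ge0.
rewrite /H2 -mulrA -[leLHS]mulr1 ler_wpM2l ?mulr_ge0 // mulrC ler_pdivlMr ?powR_gt0 // mul1r.
apply: ge0_ler_powR; rewrite ?nnegrE ?normc_ge0 ?(ltW d0) //.
by rewrite mulr_ge0 // ltW.
Qed.

Lemma holomorphic_density f : holomorphic_on D f -> density r be f.
Proof. by move=> /holomorphic_onP H; apply: wd_density => z /H[l Hl]; exists l, 0. Qed.

Lemma holder_on_density f : holder_on D (2 * be) f -> density r be f.
Proof.
move=> [B hB]; have b0 := be0.
have H0 : 0 <= `|B| by [].
have key z x : D z -> D x -> normc (f x - f z) <= `|B| * normc (x - z) `^ (2 * be).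
  move=> Dz Dx; have [->|xz] := eqVneq x z.
    by rewrite subrr normc0 mulr_ge0 ?powR_ge0.
  have n0 : 0 < normc (x - z) `^ (2 * be) by rewrite powR_gt0 // normc_gt0 subr_eq0.
  rewrite -ler_pdivrMr //; apply: le_trans (ler_norm B); apply: hB.
  by exists x, z.
have cf : continuous_disk f.
  move=> z Dz eps eps0; have B1 : 0 < `|B| + 1 by lra.
  have e1 : 0 < eps / (`|B| + 1) by rewrite divr_gt0.
  have b20 : 2 * be != 0 by rewrite mulf_neq0 // lt0r_neq0.
  exists ((eps / (`|B| + 1)) `^ (2 * be)^-1); first by rewrite powR_gt0.
  move=> x Dx xd; apply: le_trans (key _ _ Dz Dx) _.
  have : normc (x - z) `^ (2 * be) <= eps / (`|B| + 1).
    have -> : eps / (`|B| + 1) = ((eps / (`|B| + 1)) `^ (2 * be)^-1) `^ (2 * be).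
      by rewrite -powRrM mulVf // powRr1 // ltW.
    by apply: ge0_ler_powR; rewrite ?nnegrE ?normc_ge0 ?powR_ge0 ?(ltW xd) // mulr_ge0 // ltW.
  rewrite ler_pdivlMr // mulrDr mulr1; have := powR_ge0 (normc (x - z)) (2 * be).
  by lra.
split; [exact: continuous_disk_cmeas|exact: continuous_disk_bounded|].
by move=> z Dz; exists `|B| => // x Dx; exact: key.
Qed.

End ContinuousOnDisk.

(** * Iterated differentiation of kernels *)

Section KernelIteration.
Variables (R : realType) (r be : R).
Hypotheses (r0 : 0 < r) (be0 : 0 < be) (be2 : be < 1 / 2).
Local Notation C := R[i].
Local Notation D := (cdisk r).
Local Notation D2 := [set p : R * R | cdisk r (pc p)].
Local Notation m := (msing be).
Local Notation kdiff := (kdiff r be).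
Local Notation kreg := (kreg r).
Local Notation cint := (cint r).
Implicit Types (z w x c : C) (phi : C -> C) (K S H : C -> C -> C) (n : nat).

Definition kint w (F : C -> C) := cmeas D2 F /\
  exists M : R, forall x, D x -> x != w -> normc (F x) <= M * m w x.

(** The relation delbar^n K = K' between kernels, with every differentiation
    valid under the integral sign, and identities required off the diagonal
    only. *)
Fixpoint kiter n K K' : Prop :=
  if n is n'.+1 then exists K1,
    (forall z, D z -> exists Ka, kdiff z K Ka (K1 z)) /\ kiter n' K1 K'
  else (forall w, D w -> kint w (K w)) /\
    forall w x, D w -> D x -> x != w -> K w x = K' w x.

(** Regular kernels that are holomorphic in the first variable: these commute with
    delbar. *)
Definition khol H := forall z, D z -> exists Ha, kreg z H Ha (fun=> 0).

Lemma kint_cintegrable w F : kint w F -> cintegrable r F.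
Proof. by move=> [mF [M FM]]; exact: (kbound_cintegrable r0 be0 be2 mF FM). Qed.

Lemma kintD w F G : kint w F -> kint w G -> kint w (fun x => F x + G x).
Proof.
move=> [mF [M FM]] [mG [N GN]]; split; first exact: cmeasD.
exists (M + N) => x Dx xw; apply: (le_trans (normcD _ _)).
by rewrite mulrDl lerD ?FM ?GN.
Qed.

Lemma kintM w F G : kint w F -> cmeas D2 G -> (exists B : R, forall x, D x -> normc (G x) <= B) ->
  kint w (fun x => F x * G x).
Proof.
move=> [mF [M FM]] mG [B GB]; split; first exact: cmeasM.
exists (M * B) => x Dx xw; rewrite normcM mulrAC.
by apply: ler_pM; rewrite ?normc_ge0 ?FM ?GB.
Qed.

Lemma kint_ext w F G : (forall x, D x -> x != w -> F x = G x) -> kint w F -> kint w G.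
Proof.
move=> E [mF [M FM]]; split; first exact: cmeas_offdiag E mF.
by exists M => x Dx xw; rewrite -E // FM.
Qed.

Lemma kdiff_kintb z K Ka Kb : kdiff z K Ka Kb -> kint z Kb.
Proof.
move=> [M HM]; split; first exact: kdiff_measb HM.
by exists M; exact: kdiff_boundb HM.
Qed.

Lemma kiter_is_iter n K K' phi : density r be phi -> kiter n K K' ->
  is_iter D (is_delbar D) n (fun w => cint (fun x => K w x * phi x))
    (fun w => cint (fun x => K' w x * phi x)).
Proof.
move=> nphi; elim: n K => [|n IH] K /=.
  move=> [iK E] z Dz; have [mphi bphi _] := nphi.
  apply: (@cint_offdiag _ _ r0 z); last exact: kint_cintegrable (kintM (iK _ Dz) mphi bphi).
  by move=> x Dx xz; rewrite E.
move=> [K1 [kK iK]]; exists (fun w => cint (fun x => K1 w x * phi x)); split; last exact: IH.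
move=> z Dz; have [Ka kz] := kK _ Dz.
have kM := kdiffM Dz kz (density_kreg z nphi).
exists (cint (fun x => Ka x * phi x + K z x * 0)); apply/is_wirtingerP.
have := cint_wd r0 be0 be2 Dz kM; congr wd.
by apply: cint_ext => x _; rewrite mulr0 addr0.
Qed.

Lemma kiter_ext n K L K' L' :
  (forall w x, D w -> D x -> x != w -> K w x = L w x) ->
  (forall w x, D w -> D x -> x != w -> K' w x = L' w x) ->
  kiter n K K' -> kiter n L L'.
Proof.
move=> E E'; case: n => [|n] /=.
  move=> [iK EK]; split=> [w Dw|w x Dw Dx xw]; last by rewrite -E // -E' // EK.
  by apply: kint_ext (iK _ Dw) => x Dx xw; exact: E.
move=> [K1 [kK iK]]; exists K1; split.
  by move=> z Dz; have [Ka kz] := kK _ Dz; exists Ka; apply: kdiff_ext kz.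
elim: n K1 {kK} iK => [|n IH] K1 /=.
  by move=> [iK EK]; split=> // w x Dw Dx xw; rewrite -E' // EK.
by move=> [K2 [kK iK]]; exists K2; split => //; exact: IH.
Qed.

Lemma kiterD n K L K' L' : kiter n K K' -> kiter n L L' ->
  kiter n (fun w x => K w x + L w x) (fun w x => K' w x + L' w x).
Proof.
elim: n K L => [|n IH] K L /=.
  move=> [iK EK] [iL EL]; split=> [w Dw|w x Dw Dx xw]; last by rewrite EK // EL.
  by apply: kintD; [exact: iK|exact: iL].
move=> [K1 [kK iK]] [L1 [kL iL]]; exists (fun w x => K1 w x + L1 w x); split; last exact: IH.
move=> z Dz; have [Ka kz] := kK _ Dz; have [La lz] := kL _ Dz.
by exists (fun x => Ka x + La x); exact: kdiffD.
Qed.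

Lemma kiter_hol n K K' H : khol H -> kiter n K K' ->
  kiter n (fun w x => K w x * H w x) (fun w x => K' w x * H w x).
Proof.
move=> hH; elim: n K => [|n IH] K /=.
  move=> [iK EK]; split=> [w Dw|w x Dw Dx xw]; last by rewrite EK.
  have [Ha [M kM]] := hH _ Dw; apply: kintM (iK _ Dw) _ _; first exact: kreg_meas kM _ Dw.
  by exists M => x Dx; exact: kreg_bound kM _ _ Dw Dx.
move=> [K1 [kK iK]]; exists (fun w x => K1 w x * H w x); split; last exact: IH.
move=> z Dz; have [Ka kz] := kK _ Dz; have [Ha hz] := hH _ Dz.
eexists; apply: kdiff_ext (kdiffM Dz kz hz) => //.
by move=> x _ _; rewrite mulr0 addr0.
Qed.

Lemma kiter0 n : kiter n (fun _ _ => 0) (fun _ _ => 0).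
Proof.
elim: n => [|n IH] /=.
  split => // w Dw; split; first exact: cmeas_cst.
  by exists 0 => x _ _; rewrite normc0 mul0r.
exists (fun _ _ => 0); split => // z Dz; exists (fun=> 0).
exact: kdiff_of_kreg r0 be2 _ _ _ _ Dz (kreg_cst r z 0).
Qed.

Lemma kiter_zero n K : (forall w x, D w -> D x -> x != w -> K w x = 0) ->
  kiter n K (fun _ _ => 0).
Proof. by move=> E; apply: kiter_ext (kiter0 n) => // w x Dw Dx xw; rewrite E. Qed.

Lemma kiter_null_S n K : kiter n K (fun _ _ => 0) -> kiter n.+1 K (fun _ _ => 0).
Proof.
elim: n K => [|n IH] K; first by move=> [_ E]; exact: kiter_zero.
by move=> [K1 [kK iK]]; exists K1; split => //; exact: IH.
Qed.

Lemma kiter_null_conj n K : kiter n K (fun _ _ => 0) ->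
  kiter n.+1 (fun w x => K w x * (w - x)^*) (fun _ _ => 0).
Proof.
elim: n K => [|n IH] K.
  by move=> [_ E]; apply: kiter_zero => w x Dw Dx xw; rewrite E ?mul0r.
move=> kn; have [K1 [kK iK]] := kn; exists (fun w x => K1 w x * (w - x)^* + K w x); split.
  move=> z Dz; have [Ka kz] := kK _ Dz; eexists.
  apply: kdiff_ext (kdiffM Dz kz (kreg_subconj r0 z)) => // x _ _.
  by rewrite mulr1.
apply: kiter_ext (kiterD (IH _ iK) kn) => // w x _ _ _.
by rewrite addr0.
Qed.

(** This disposes of every term of the kernels but the logarithmic one: they are
    polynomials in the conjugate of [w], of degree too small to survive. *)
Lemma kiter_null_poly n k H : khol H -> (k <= n)%N ->
  kiter n.+1 (fun w x => H w x * (w - x)^* ^+ k) (fun _ _ => 0).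
Proof.
move=> hH; elim: n k => [|n IH] k.
  rewrite leqn0 => /eqP ->; exists (fun _ _ => 0); split; last exact: kiter0.
  move=> z Dz; have [Ha hz] := hH _ Dz; exists Ha.
  apply: kdiff_ext (kdiff_of_kreg r0 be2 Dz hz) => // w x _ _ _.
  by rewrite expr0 mulr1.
rewrite leq_eqVlt => /predU1P[->|]; last by rewrite ltnS => /IH /kiter_null_S.
apply: kiter_ext (kiter_null_conj (IH n (leqnn n))) => // w x _ _ _.
by rewrite exprSr mulrA.
Qed.

Lemma khol_ext H H' : (forall w x, H w x = H' w x) -> khol H -> khol H'.
Proof.
by move=> E; rewrite (_ : H' = H) //; apply/funext => w; apply/funext => x.
Qed.

Lemma khol_fun (F : C -> C) : cmeas D2 F -> (exists M : R, forall x, D x -> normc (F x) <= M) ->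
  khol (fun _ => F).
Proof. by move=> mF bF z Dz; exists (fun=> 0); exact: kreg_fun. Qed.

Lemma khol_cst c : khol (fun _ _ => c).
Proof. by move=> z Dz; exists (fun=> 0); exact: kreg_cst. Qed.

Lemma khol_point : khol (fun _ x => x).
Proof. by move=> z Dz; exists (fun=> 0); exact: kreg_point. Qed.

Lemma khol_pointJ : khol (fun _ x => x^*).
Proof.
apply: khol_fun; first by apply: cmeas_conj; exact: cmeas_id.
by exists r => x Dx; rewrite normc_conj.
Qed.

Lemma khol_var : khol (fun w _ => w).
Proof. by move=> z Dz; exists (fun=> 1); exact: kreg_var. Qed.

Lemma kholD H H' : khol H -> khol H' -> khol (fun w x => H w x + H' w x).
Proof.
move=> h h' z Dz; have [Ha k] := h _ Dz; have [Ha' k'] := h' _ Dz.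
by eexists; apply: kreg_ext (kregD k k') => // x _; rewrite addr0.
Qed.

Lemma kholM H H' : khol H -> khol H' -> khol (fun w x => H w x * H' w x).
Proof.
move=> h h' z Dz; have [Ha k] := h _ Dz; have [Ha' k'] := h' _ Dz.
by eexists; apply: kreg_ext (kregM Dz k k') => // x _; rewrite mul0r mulr0 addr0.
Qed.

Lemma kholN H : khol H -> khol (fun w x => - H w x).
Proof.
move=> h; apply: khol_ext (kholM (khol_cst (-1)) h) => w x.
by rewrite mulN1r.
Qed.

Lemma kholX H n : khol H -> khol (fun w x => H w x ^+ n).
Proof.
move=> h; elim: n => [|n IH]; first exact: khol_cst.
by apply: khol_ext (kholM h IH) => w x; rewrite exprS.
Qed.

Lemma khol_sum (s : seq nat) (P : pred nat) (H : nat -> C -> C -> C) :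
  (forall i, khol (H i)) -> khol (fun w x => \sum_(i <- s | P i) H i w x).
Proof.
move=> h; elim: s => [|i s IH].
  by apply: khol_ext (khol_cst 0) => w x; rewrite big_nil.
have [Pi|nPi] := boolP (P i).
  by apply: khol_ext (kholD (h i) IH) => w x; rewrite big_cons Pi.
by apply: khol_ext IH => w x; rewrite big_cons (negbTE nPi).
Qed.

Lemma kiter_sum n (s : seq nat) (H : nat -> C -> C -> C) :
  (forall i, i \in s -> kiter n (H i) (fun _ _ => 0)) ->
  kiter n (fun w x => \sum_(i <- s) H i w x) (fun _ _ => 0).
Proof.
elim: s => [|i s IH] h; first by apply: kiter_zero => w x _ _ _; rewrite big_nil.
have hi := h i (mem_head _ _).
have hs : forall j, j \in s -> kiter n (H j) (fun _ _ => 0).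
  by move=> j js; apply: h; rewrite in_cons js orbT.
apply: kiter_ext (kiterD hi (IH hs)) => w x _ _ _; last by rewrite addr0.
by rewrite big_cons.
Qed.

Lemma khol_sub : khol (fun w x => w - x).
Proof. by apply: kholD; [exact: khol_var|apply: kholN; exact: khol_point]. Qed.

Lemma khol_C1 k : khol (fun w x => C1 w x k).
Proof.
rewrite /C1; apply: khol_sum => l; apply: kholM.
  by apply: kholN; apply: kholM; [apply: kholX; exact: khol_point|exact: khol_cst].
apply: khol_sum => j; apply: kholM; last by apply: kholX; apply: kholN; exact: khol_point.
by apply: kholM; [exact: khol_cst|apply: kholX; exact: khol_var].
Qed.

Lemma khol_C2 l k : khol (fun w x => C2 r w x l k).
Proof.
rewrite /C2; apply: khol_sum => p; apply: khol_sum => q.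
apply: kholM; last by apply: kholX; exact: khol_var.
apply: kholM; last by apply: kholX; apply: kholN; exact: khol_point.
apply: kholM; last by apply: kholX; apply: kholN; exact: khol_pointJ.
exact: khol_cst.
Qed.

(** The logarithm of (r^2 - w conj x) / |w - x|^2, split so that delbar sees the
    denominator only: the numerator is holomorphic in w. *)
Definition log_kernel (w x : R[i]) : R[i] :=
  (clnp ((r ^+ 2)%:C - w * x^*) : R[i]) - (ln (normc (w - x) ^+ 2))%:C.

Lemma kdiff_log_kernel z : D z ->
  exists Ka, kdiff z log_kernel Ka (fun x => - ((z - x)^-1)^*).
Proof.
move=> Dz; have kc := kdiff_clnp r0 be2 Dz.
have kl := kdiffM Dz (kdiff_ln r0 be2 Dz) (kreg_cst r z (-1)).
eexists; apply: kdiff_ext (kdiffD kc kl) => // [w x _ _ _|x _ _].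
  by rewrite mulrN1.
by rewrite mulrN1 mulr0 addr0 add0r.
Qed.

(** Each differentiation lowers the power of the conjugate of [w - x] by one, and
    that of the logarithm leaves a polynomial term which joins the null part
    [S]. The last one turns [log_kernel] into its
    derivative. *)
Lemma kiter_log_kernel n S : kiter n.+1 S (fun _ _ => 0) ->
  kiter n.+1 (fun w x => log_kernel w x * ((w - x)^* ^+ n / n`!%:R) + S w x)
    (fun w x => - ((w - x)^-1)^*).
Proof.
elim: n S => [|n IH] S [S1 [kS iS]].
  exists (fun w x => - ((w - x)^-1)^* + S1 w x); split.
    move=> z Dz; have [Ka kg] := kdiff_log_kernel Dz; have [Sa ks] := kS _ Dz.
    eexists; apply: kdiff_ext (kdiffD kg ks) => // w x _ _ _.
    by rewrite expr0 fact0 divr1 mulr1.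
  have [iS1 ES1] := iS; split; last by move=> w x Dw Dx xw; rewrite ES1 // addr0.
  move=> w Dw; apply: kintD; last exact: iS1.
  by have [Ka kg] := kdiff_log_kernel Dw; exact: kdiff_kintb kg.
(* up to sign, the factor of the polynomial term that the first differentiation produces *)
pose c : C := (n.+1`!%:R)^-1.
have kp : kiter n.+1 (fun w x => - c * (w - x)^* ^+ n) (fun _ _ => 0).
  by apply: kiter_null_poly => //; exact: khol_cst.
have kpS : kiter n.+1 (fun w x => - c * (w - x)^* ^+ n + S1 w x) (fun _ _ => 0).
  by apply: kiter_ext (kiterD kp iS) => // w x _ _ _; rewrite addr0.
have iG := IH _ kpS.
exists (fun w x => log_kernel w x * ((w - x)^* ^+ n / n`!%:R) + (- c * (w - x)^* ^+ n + S1 w x)).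
split; last exact: iG.
move=> z Dz; have [Ka kg] := kdiff_log_kernel Dz; have [Sa ks] := kS _ Dz.
have kx := kregM Dz (kreg_subconjX r0 n.+1 Dz) (kreg_cst r z c).
eexists; apply: kdiff_ext (kdiffD (kdiffM Dz kg kx) ks) => //.
move=> x Dx xz; rewrite addrA; congr (_ + _); rewrite /= mulr0 addr0 addrC.
have q0 : z - x != 0 by rewrite subr_eq0 eq_sym.
have q1 : (z - x)^* != 0 by rewrite conjC_eq0.
have f0 : n`!%:R != 0 :> C by exact: fact_neq0.
have n0 : n.+1%:R != 0 :> C by rewrite pnatr_eq0.
rewrite conjcV /c factS natrM exprS; congr (_ + _).
  by move: (n.+1%:R) n0 ((z - x)^*) q1 => N N0 q q1; field; rewrite q1 N0 f0.
by move: (n.+1%:R) n0 ((z - x)^*) => N N0 q; field; rewrite N0 f0.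
Qed.

(** Only the logarithmic term of the kernel contributes, for the other ones are
    of degree at most [n] in the conjugate of [w]. *)
Lemma kiter_G2 n j :
  kiter n.+1 (fun w x => 2 * 'i * G2 r w x n.+1 j.+1)
    (fun w x => (pi%:C * j`!%:R)^-1 * ((w - x) ^+ j / (w - x)^*)).
Proof.
pose c : C := (-1) ^+ n.+1 / (pi%:C * n`!%:R * j`!%:R).
(* the part of the kernel without logarithm *)
pose T w x : C := c * ((x^* - w^*) ^+ n * C1 w x j.+1 +
  \sum_(1 <= l < n.+1) 'C(n, l)%:R * (x^* - w^*) ^+ (n - l) *
    (- 1 / l%:R * (w^* - x^*) ^+ l * (w - x) ^+ j - 1 / l%:R * C2 r w x l j.+1)).
have sg w x k : (x^* - w^*) ^+ k = (-1) ^+ k * (w - x)^* ^+ k.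
  by rewrite -exprMn mulN1r conjcB opprB.
have kT : kiter n.+1 T (fun _ _ => 0).
  have k1 : kiter n.+1 (fun w x => (x^* - w^*) ^+ n * C1 w x j.+1) (fun _ _ => 0).
    apply: kiter_ext (kiter_null_poly (kholM (khol_cst ((-1) ^+ n)) (khol_C1 j.+1)) (leqnn n)) => // w x _ _ _.
    by rewrite sg; ring.
  have k2 : kiter n.+1 (fun w x => \sum_(1 <= l < n.+1) 'C(n, l)%:R * (x^* - w^*) ^+ (n - l) *
    (- 1 / l%:R * (w^* - x^*) ^+ l * (w - x) ^+ j - 1 / l%:R * C2 r w x l j.+1)) (fun _ _ => 0).
    apply: kiter_sum => l; rewrite mem_index_iota => /andP[_ ln].
    pose e : C := 'C(n, l)%:R * (-1) ^+ (n - l) / l%:R.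
    have h1 : khol (fun w x => - e * (w - x) ^+ j).
      by apply: kholM; [exact: khol_cst|apply: kholX; exact: khol_sub].
    have h2 : khol (fun w x => - e * C2 r w x l j.+1).
      by apply: kholM; [exact: khol_cst|exact: khol_C2].
    have p1 := kiter_null_poly h1 (leqnn n).
    have p2 := kiter_null_poly h2 (leq_subr l n).
    apply: kiter_ext (kiterD p1 p2) => w x _ _ _; last by rewrite addr0.
    have -> : (w - x)^* ^+ n = (w - x)^* ^+ (n - l) * (w - x)^* ^+ l.
      by rewrite -exprD subnK.
    rewrite sg -conjcB /e.
    move: ((w - x)^* ^+ (n - l)) ((w - x)^* ^+ l) => A B; ring.
  apply: kiter_ext (kiter_hol (khol_cst c) (kiterD k1 k2)) => w x _ _ _.
    by rewrite /T mulrC.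
  by rewrite addr0 mul0r.
pose d : C := - (pi%:C * j`!%:R)^-1.
have hd : khol (fun w x => d * (w - x) ^+ j).
  by apply: kholM; [exact: khol_cst|apply: kholX; exact: khol_sub].
have kL := kiter_hol hd (kiter_log_kernel (kiter0 n.+1)).
have pi0 := pi_neq0 R; have fn0 := fact_neq0 R n; have fj0 := fact_neq0 R j.
have i0 : 'i != 0 :> C by exact: neq0Ci.
apply: kiter_ext (kiterD kL kT) => w x Dw Dx xw; last first.
  by rewrite addr0 conjcV /d; ring.
have n0 : 0 < normc (w - x) ^+ 2 by rewrite exprn_gt0 // normc_gt0 subr_eq0 eq_sym.
rewrite /G2 /C3 /= (cln_clnp n0 (Re_reflected_gt0 r0 Dw Dx xw)) -/(log_kernel w x).
rewrite /T addr0 sg; set sm := \sum_(1 <= l < n.+1) _.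
have cE : 2 * 'i * ((-1) ^+ n.+1 / (2 * pi%:C * 'i * n`!%:R * j`!%:R)) = c.
  rewrite /c; move: ('i : C) i0 (pi%:C : C) pi0 (n`!%:R : C) fn0 (j`!%:R : C) fj0.
  by move=> I I0 P P0 F F0 G G0; field; rewrite P0 F0 G0 I0.
rewrite [RHS]mulrA cE /c /d exprS.
have s1 : (-1 : C) ^+ n * (-1) ^+ n = 1 by rewrite -expr2 sqrr_sign.
have -> : -1 * (-1) ^+ n / (pi%:C * n`!%:R * j`!%:R) *
   ((-1) ^+ n * (w - x)^* ^+ n * (C1 w x j.+1 + (w - x) ^+ j * log_kernel w x) + sm) =
   -1 * (-1) ^+ n / (pi%:C * n`!%:R * j`!%:R) *
     ((-1) ^+ n * (w - x)^* ^+ n * C1 w x j.+1 + sm) -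
   ((-1) ^+ n * (-1) ^+ n) / (pi%:C * n`!%:R * j`!%:R) * ((w - x)^* ^+ n * ((w - x) ^+ j * log_kernel w x)) by ring.
rewrite s1 addrC; congr (_ + _).
move: (pi%:C : C) pi0 (n`!%:R : C) fn0 (j`!%:R : C) fj0.
by move=> P P0 F F0 G G0; field; rewrite P0 F0 G0.
Qed.

End KernelIteration.

(** * Iterates of the Wirtinger operators *)

Section IteratedOperators.
Variables (R : realType) (D : set R[i]).
Local Notation C := R[i].
Local Notation dbar := (is_iter D (is_delbar D)).
Implicit Types (u v w : C -> C) (n : nat).

Lemma is_delbarP v w : is_delbar D v w <-> forall z, D z -> exists a, wd D v z a (w z).
Proof. by split=> H z Dz; have [a Ha] := H z Dz; exists a; apply/is_wirtingerP. Qed.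

Lemma is_delbar_ext v v' w w' : (forall z, D z -> v z = v' z) ->
  (forall z, D z -> w z = w' z) -> is_delbar D v w -> is_delbar D v' w'.
Proof.
move=> Ev Ew /is_delbarP H; apply/is_delbarP => z Dz; have [a Ha] := H z Dz.
by exists a; rewrite -Ew //; exact: wd_ext Ha.
Qed.

Lemma dbar_ext n v v' w w' : (forall z, D z -> v z = v' z) ->
  (forall z, D z -> w z = w' z) -> dbar n v w -> dbar n v' w'.
Proof.
move=> + Ew; elim: n v v' => [|n IH] v v' Ev /=; first by move=> H z Dz; rewrite -Ev // -Ew // H.
by move=> [v1 [H1 H2]]; exists v1; split; [exact: is_delbar_ext H1|exact: IH H2].
Qed.

Lemma dbar1 v w : is_delbar D v w -> dbar 1 v w.
Proof. by exists w. Qed.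

Lemma dbarD n v v' w w' : dbar n v w -> dbar n v' w' ->
  dbar n (fun z => v z + v' z) (fun z => w z + w' z).
Proof.
elim: n v v' => [|n IH] v v' /=; first by move=> H H' z Dz; rewrite H // H'.
move=> [v1 [/is_delbarP H1 H2]] [v1' [/is_delbarP H1' H2']].
exists (fun z => v1 z + v1' z); split; last exact: IH.
apply/is_delbarP => z Dz; have [a Ha] := H1 z Dz; have [a' Ha'] := H1' z Dz.
by exists (a + a'); exact: wdD.
Qed.

Lemma dbarN n v w : dbar n v w -> dbar n (fun z => - v z) (fun z => - w z).
Proof.
elim: n v => [|n IH] v /=; first by move=> H z Dz; rewrite H.
move=> [v1 [/is_delbarP H1 H2]]; exists (fun z => - v1 z); split; last exact: IH.
by apply/is_delbarP => z Dz; have [a Ha] := H1 z Dz; exists (- a); exact: wdN.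
Qed.

Lemma dbar0 n : dbar n (fun=> 0) (fun=> 0).
Proof.
elim: n => [|n IH] //=; exists (fun=> 0); split => //.
by apply/is_delbarP => z Dz; exists 0; exact: wd_cst.
Qed.

Lemma dbar_sum n (s : seq nat) (v w : nat -> C -> C) :
  (forall j, j \in s -> dbar n (v j) (w j)) ->
  dbar n (fun z => \sum_(j <- s) v j z) (fun z => \sum_(j <- s) w j z).
Proof.
elim: s => [|j s IH] H.
  by apply: dbar_ext (dbar0 n) => z _; rewrite big_nil.
apply: dbar_ext (dbarD (H j (mem_head _ _)) (IH _)) => [z _|z _|i si].
- by rewrite big_cons.
- by rewrite big_cons.
by apply: H; rewrite in_cons si orbT.
Qed.

Lemma holomorphic_onE v : holomorphic_on D v <-> is_delbar D v (fun=> 0).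
Proof. by rewrite holomorphic_onP is_delbarP. Qed.

Lemma dbar_null n m v : (n <= m)%N -> dbar n v (fun=> 0) -> dbar m v (fun=> 0).
Proof.
elim: n m v => [|n IH] m v.
  by move=> _ H; apply: dbar_ext (dbar0 m) => // z Dz; rewrite H.
case: m => // m nm /= [v1 [H1 H2]]; exists v1; split => //; exact: IH H2.
Qed.

Lemma dbar_holomorphic n m v w : (n < m)%N -> dbar n v w -> holomorphic_on D w ->
  dbar m v (fun=> 0).
Proof.
move=> nm H /holomorphic_onE hw; apply: (dbar_null nm); elim: n v H {nm} => [|n IH] v.
  by move=> /= E; exists (fun=> 0); split => //; apply: is_delbar_ext hw => // z Dz; rewrite E.
by move=> [v1 [H1 H2]]; exists v1; split => //; exact: IH.
Qed.

(** Conjugation exchanges del and delbar, so that only delbar has to be studied. *)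
Lemma del_conj n v w : is_iter D (is_del D) n v w <->
  dbar n (fun z => (v z)^*) (fun z => (w z)^*).
Proof.
elim: n v => [|n IH] v.
  by split=> H z Dz; [rewrite H|rewrite -[LHS]conjCK H // conjCK].
split=> [[v1 [H1 /IH H2]]|[v1 [/is_delbarP H1 H2]]].
  exists (fun z => (v1 z)^*); split => //; apply/is_delbarP => z Dz.
  by have [b /is_wirtingerP Hb] := H1 z Dz; exists b^*; exact: wd_conj.
exists (fun z => (v1 z)^*); split; last by apply/IH; apply: dbar_ext H2 => // z _; rewrite conjCK.
move=> z Dz; have [a /wd_conj Ha] := H1 z Dz; exists a^*; apply/is_wirtingerP.
by apply: wd_ext Ha => // x _; rewrite conjCK.
Qed.

End IteratedOperators.

(** * Decomposition and representation *)

Section Representation.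
Variables (R : realType) (r be : R).
Hypotheses (r0 : 0 < r) (be0 : 0 < be) (be2 : be < 1 / 2).
Local Notation C := R[i].
Local Notation D := (cdisk r).
Local Notation D2 := [set p : R * R | cdisk r (pc p)].
Local Notation dbar := (is_iter D (is_delbar D)).
Local Notation density := (density r be).
Local Notation CI := (cauchy_iter r).
Implicit Types (u v w phi A : C -> C) (f g : nat -> C -> C) (z x : C) (n : nat).

Lemma integral_formE F : integral_form D F = 2 * 'i * cint r F.
Proof. by []. Qed.

Lemma density0 : density (fun=> 0).
Proof. by apply: (wd_density be0 be2) => z _; exists 0, 0; exact: wd_cst. Qed.

Lemma cauchy_iter_dbar n phi : density phi -> dbar n (CI n phi) phi.
Proof.
move=> nphi; elim: n => [|n IH] //; exists (CI n phi); split => //.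
by apply/is_delbarP => z Dz; exact: (cauchy_iterS r0 be0 be2).
Qed.

Lemma cauchy_iter0 n z : CI n (fun=> 0) z = 0.
Proof.
case: n => [|n] //=; rewrite (cint_ext (G := fun x => 0 * 0)); last by move=> x _; rewrite !mulr0.
by rewrite cintZ ?mul0r ?mulr0 //; exact: cintegrable_cst r0 _.
Qed.

(** By induction delbar u = sum_j T_j g_j + T_n w, where T_j stands for
    [cauchy_iter r j]. Raising every index by one gives a function U with the same
    delbar as u, and the difference u - U is the new holomorphic term. *)
Lemma dbar_decomposition n u w : density w -> dbar n u w -> exists2 g,
  (forall j, (j < n)%N -> holomorphic_on D (g j)) &
  forall z, D z -> u z = \sum_(0 <= j < n) CI j (g j) z + CI n w z.
Proof.
move=> nw; elim: n u => [|n IH] u.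
  by move=> E; exists (fun _ _ => 0) => // z Dz; rewrite big_geq // add0r E.
move=> [v [uv /IH[g hg Ev]]].
pose U z := \sum_(0 <= j < n) CI j.+1 (g j) z + CI n.+1 w z.
have step phi k : density phi -> dbar 1 (CI k.+1 phi) (CI k phi).
  move=> nphi; apply: dbar1; apply/is_delbarP => z Dz.
  exact: (cauchy_iterS r0 be0 be2).
have Uv : dbar 1 U (fun z => \sum_(0 <= j < n) CI j (g j) z + CI n w z).
  apply: dbarD; last exact: step.
  apply: (@dbar_sum _ _ _ _ (fun j => CI j.+1 (g j)) (fun j => CI j (g j))) => j.
  rewrite mem_index_iota => /andP[_ jn]; apply: step.
  by apply: (holomorphic_density be0 be2); exact: hg.
exists (fun j => if j is j'.+1 then g j' else fun z => u z - U z).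
  case=> [_|j]; last exact: hg.
  apply/holomorphic_onE; have [v1 [H1 H2]] := dbarD (dbar1 uv) (dbarN Uv).
  by apply: is_delbar_ext H1 => // z Dz; rewrite H2 // Ev // subrr.
move=> z Dz; rewrite big_nat_recl // -addrA.
by rewrite -/(U z) [CI 0 _ _]/= subrK.
Qed.

Lemma cintegrable_pker n phi z : density phi -> D z ->
  cintegrable r (fun x => pker n z x * phi x).
Proof.
move=> nphi Dz; have [Ka H] := kdiff_pker r0 be2 n Dz.
have ik := kdiff_cintegrableb r0 be0 be2 (kdiffM Dz H (density_kreg z nphi)).
apply: cintegrable_ext (cintegrableZ n.+1%:R^-1 ik) => x _.
by rewrite mulr0 addr0 -mulrA mulKf // pnatr_eq0.
Qed.

Let c2i_neq0 : 2 * 'i != 0 :> C.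
Proof. by rewrite mulf_neq0 ?neq0Ci ?pnatr_eq0. Qed.

Lemma G1_pker n z x : x != z ->
  2 * 'i * G1 z x n.+1 = (pi%:C * n`!%:R)^-1 * pker n z x.
Proof.
move=> xz; rewrite /G1 /pker /=.
have -> : (x^* - z^*) ^+ n = (-1) ^+ n * (z - x)^* ^+ n.
  by rewrite -exprMn mulN1r conjcB opprB.
have q0 : z - x != 0 by rewrite subr_eq0 eq_sym.
have -> : x - z = - (z - x) by rewrite opprB.
rewrite exprS mulrA -[_ * (-1) ^+ n]mulrA -expr2 sqrr_sign mulr1.
move: ('i : C) (neq0Ci C) (pi%:C : C) (pi_neq0 R) (n`!%:R : C) (fact_neq0 R n) => I I0 P P0 F F0.
by move: (z - x) q0 => q q0; field; rewrite I0 P0 F0 q0.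
Qed.

Lemma cauchy_iter_G1 n phi z : density phi -> D z ->
  cintegrable r (fun x => G1 z x n.+1 * phi x) /\
  integral_form D (fun x => G1 z x n.+1 * phi x) = CI n.+1 phi z.
Proof.
move=> nphi Dz; have ik := cintegrable_pker n nphi Dz.
pose c : C := (2 * 'i)^-1 * (pi%:C * n`!%:R)^-1.
have E x : D x -> x != z -> c * (pker n z x * phi x) = G1 z x n.+1 * phi x.
  move=> Dx xz; rewrite -[G1 _ _ _](mulKf c2i_neq0) G1_pker //.
  by rewrite /c -!mulrA.
split; first exact: (cintegrable_offdiag r0 E) (cintegrableZ c ik).
rewrite integral_formE -(cint_offdiag r0 E); last exact: cintegrableZ.
by rewrite cintZ // /c -[X in _ * X]mulrA mulVKf //.
Qed.

Definition kernel_potential n m phi z : C := integral_form D (fun x => G2 r z x n m * phi x).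

Lemma cintegrable_G2 n j phi z : density phi -> D z ->
  cintegrable r (fun x => G2 r z x n.+1 j.+1 * phi x).
Proof.
move=> nphi Dz; have [K1 [kK _]] := kiter_G2 r0 be2 n j; have [Ka kz] := kK z Dz.
have ik := kdiff_cintegrable r0 be0 be2 Dz (kdiffM Dz kz (density_kreg z nphi)).
apply: cintegrable_ext (cintegrableZ (2 * 'i)^-1 ik) => x _.
by rewrite -[2 * 'i * _ * _]mulrA mulKf.
Qed.

(** The power of delbar leaves (w - x)^j over the conjugate of w - x, which is the
    conjugate of a Cauchy kernel. *)
Lemma kernel_potential_dbar n j phi : density phi ->
  dbar n.+1 (kernel_potential n.+1 j.+1 phi) (fun z => (CI j.+1 (fun x => (phi x)^*) z)^*).
Proof.
move=> nphi; apply: dbar_ext (kiter_is_iter r0 be0 be2 nphi (kiter_G2 r0 be2 n j)) => z Dz.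
  rewrite /kernel_potential integral_formE -cintZ; last exact: cintegrable_G2.
  by apply: cint_ext => x _; rewrite mulrA.
have ik := cintegrable_pker j (density_conj nphi) Dz.
have piJ : (pi%:C : C)^* = pi%:C by exact: conjc_real.
rewrite /= conjcM -cint_conj // conjcV conjcM piJ rmorph_nat.
rewrite -cintZ.
  apply: cint_ext => x _; rewrite -mulrA; congr (_ * _).
  by rewrite conjcM /pker conjcM conjcV conjcX !conjCK.
exact: cintegrable_conj ik.
Qed.

(** All terms of the representation but those with the functions g_j, which
    delbar^nu annihilates. *)
Definition potential_part nu mu A f z : C :=
  CI nu (fun x => (f 0%N x)^*) z +
  \sum_(1 <= i < mu) kernel_potential nu i (fun x => (f i x)^*) z + kernel_potential nu mu A z.

Definition conj_cauchy_part mu A f z : C :=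
  \sum_(0 <= i < mu) (CI i (f i) z)^* + (CI mu (fun x => (A x)^*) z)^*.

Lemma conj_conj phi : (fun x => ((phi x)^*)^*) = phi.
Proof. by apply/funext => x; rewrite conjCK. Qed.

Lemma potential_part_dbar n k A f : density A ->
  (forall i, (i < k.+1)%N -> holomorphic_on D (f i)) ->
  dbar n.+1 (potential_part n.+1 k.+1 A f) (conj_cauchy_part k.+1 A f).
Proof.
move=> nA hf; have nf i : (i < k.+1)%N -> density (fun x => (f i x)^*).
  by move=> ik; apply: density_conj; apply: (holomorphic_density be0 be2); exact: hf.
apply: (@dbar_ext _ _ _ _ (potential_part n.+1 k.+1 A f) (fun z => (f 0%N z)^* +
  \sum_(1 <= i < k.+1) (CI i (fun x => ((f i x)^*)^*) z)^* + (CI k.+1 (fun x => (A x)^*) z)^*)) => //.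
  move=> z Dz; rewrite /conj_cauchy_part [in RHS]big_nat_recl //; congr (_ + _); congr (_ + _).
  by rewrite big_add1; apply: eq_bigr => i _; rewrite conj_conj.
apply: dbarD; last exact: kernel_potential_dbar.
apply: dbarD; first by apply: cauchy_iter_dbar; exact: nf.
apply: (@dbar_sum _ _ _ _ (fun i => kernel_potential n.+1 i (fun x => (f i x)^*))
  (fun i z => (CI i (fun x => ((f i x)^*)^*) z)^*)) => -[|i]; rewrite mem_index_iota => /andP[] // _ ik.
by apply: kernel_potential_dbar; exact: nf.
Qed.

Lemma conj_cauchy_part_del k A f : density A ->
  (forall i, (i < k)%N -> holomorphic_on D (f i)) ->
  is_iter D (is_del D) k (conj_cauchy_part k A f) A.
Proof.
move=> nA hf; apply/del_conj.
have H : dbar k (fun z => \sum_(0 <= i < k) CI i (f i) z + CI k (fun x => (A x)^*) z)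
    (fun z => \sum_(0 <= i < k) 0 + (A z)^*).
  apply: dbarD; last by apply: cauchy_iter_dbar; exact: density_conj.
  apply: (@dbar_sum _ _ _ _ (fun i => CI i (f i)) (fun _ _ => 0)) => i.
  rewrite mem_index_iota => /andP[_ ik].
  apply: (dbar_holomorphic ik) (hf _ ik); apply: cauchy_iter_dbar.
  by apply: (holomorphic_density be0 be2); exact: hf.
apply: dbar_ext H => z Dz; last by rewrite big1 // add0r.
rewrite /conj_cauchy_part conjcD conjCK rmorph_sum; congr (_ + _).
by apply: eq_bigr => i _; rewrite /= conjCK.
Qed.

Lemma cintegrable_sum (s : seq nat) (F : nat -> C -> C) :
  (forall j, j \in s -> cintegrable r (F j)) -> cintegrable r (fun x => \sum_(j <- s) F j x).
Proof.
elim: s => [|j s IH] H.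
  by apply: cintegrable_ext (cintegrable_cst r0 0) => x _; rewrite big_nil.
apply: cintegrable_ext (cintegrableD (H j (mem_head _ _)) (IH _)) => [x _|i si].
  by rewrite big_cons.
by apply: H; rewrite in_cons si orbT.
Qed.

Lemma integral_formD F G : cintegrable r F -> cintegrable r G ->
  integral_form D (fun x => F x + G x) = integral_form D F + integral_form D G.
Proof. by move=> iF iG; rewrite !integral_formE cintD // mulrDr. Qed.

Lemma integral_form_sum (s : seq nat) (F : nat -> C -> C) :
  (forall j, j \in s -> cintegrable r (F j)) ->
  integral_form D (fun x => \sum_(j <- s) F j x) = \sum_(j <- s) integral_form D (F j).
Proof.
elim: s => [|j s IH] H.
  rewrite big_nil integral_formE (cint_ext (G := fun x => 0 * 0)).
    by rewrite cintZ ?mul0r ?mulr0 //; exact: cintegrable_cst r0 _.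
  by move=> x _; rewrite big_nil mul0r.
have Hs i : i \in s -> cintegrable r (F i) by move=> si; apply: H; rewrite in_cons si orbT.
rewrite big_cons -IH // -integral_formD; [|exact: H (mem_head _ _)|exact: cintegrable_sum].
by rewrite !integral_formE; congr (_ * _); apply: cint_ext => x _; rewrite big_cons.
Qed.

Lemma representationE n k A f g z : density A ->
  (forall i, (i < k.+1)%N -> holomorphic_on D (f i)) ->
  (forall j, (j < n.+1)%N -> holomorphic_on D (g j)) -> D z ->
  g 0%N z + integral_form D (fun zeta =>
            (\sum_(1 <= j < n.+1) G1 z zeta j * g j zeta)
            + G1 z zeta n.+1 * (f 0%N zeta)^*
            + (\sum_(1 <= i < k.+1) G2 r z zeta n.+1 i * (f i zeta)^*)
            + G2 r z zeta n.+1 k.+1 * A zeta) =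
  \sum_(0 <= j < n.+1) CI j (g j) z + potential_part n.+1 k.+1 A f z.
Proof.
move=> nA hf hg Dz.
have nf i : (i < k.+1)%N -> density (fun x => (f i x)^*).
  by move=> ik; apply: density_conj; apply: (holomorphic_density be0 be2); exact: hf.
have ng j : (j < n.+1)%N -> density (g j).
  by move=> jn; apply: (holomorphic_density be0 be2); exact: hg.
have [iF0 EF0] := cauchy_iter_G1 n (nf 0%N isT) Dz.
have iG j : j \in index_iota 1 n.+1 -> cintegrable r (fun x => G1 z x j * g j x).
  case: j => [|j]; rewrite mem_index_iota => /andP[] // _ jn.
  by have [] := cauchy_iter_G1 j (ng _ jn) Dz.
have iF i : i \in index_iota 1 k.+1 -> cintegrable r (fun x => G2 r z x n.+1 i * (f i x)^*).
  case: i => [|i]; rewrite mem_index_iota => /andP[] // _ ik.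
  by apply: cintegrable_G2 => //; exact: nf.
have iA := cintegrable_G2 n k nA Dz.
have sG := cintegrable_sum iG; have sF := cintegrable_sum iF.
have i1 := cintegrableD sG iF0; have i2 := cintegrableD i1 sF.
rewrite (integral_formD i2 iA) (integral_formD i1 sF) (integral_formD sG iF0).
rewrite (integral_form_sum iG) (integral_form_sum iF) EF0 [in RHS]big_nat_recl //.
rewrite /potential_part -!addrA; congr (_ + (_ + _)).
rewrite big_add1 /=; apply: eq_big_nat => j /andP[_ jn].
by have [_ ->] := cauchy_iter_G1 j (ng j.+1 jn) Dz.
Qed.

End Representation.

Theorem theorem4p2 (R : realType) (r alpha : R) (mu nu : nat)
    (A : R[i] -> R[i])
    (hr : 0 < r) (halpha0 : 0 < alpha) (halpha1 : alpha < 1)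
    (hmu : (0 < mu)%N) (hnu : (0 < nu)%N)
    (hA : holder_on (cdisk r) alpha A) (u : R[i] -> R[i]) :
  is_solution (cdisk r) mu nu A u <->
  exists f g : nat -> R[i] -> R[i],
    [/\ forall i, (i < mu)%N -> holomorphic_on (cdisk r) (f i),
        forall j, (j < nu)%N -> holomorphic_on (cdisk r) (g j) &
        forall z, cdisk r z ->
          u z = g 0%N z + integral_form (cdisk r) (fun zeta =>
            (\sum_(1 <= j < nu) G1 z zeta j * g j zeta)
            + G1 z zeta nu * (f 0%N zeta)^*
            + (\sum_(1 <= i < mu) G2 r z zeta nu i * (f i zeta)^*)
            + G2 r z zeta nu mu * A zeta)].
Proof.
case: mu hmu => // k _; case: nu hnu => // n _.
pose be := alpha / 2.
have be0 : 0 < be by rewrite /be; lra.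
have be2 : be < 1 / 2 by rewrite /be; lra.
have nA : density r be A.
  by apply: (holder_on_density be0); rewrite /be mulrC divfK // pnatr_eq0.
split=> [[w [uw wA]]|[f [g [hf hg Eu]]]].
  move/del_conj: wA => /(dbar_decomposition hr be0 be2 (density_conj nA))[f hf Ew].
  have wE z : cdisk r z -> conj_cauchy_part r k.+1 A f z = w z.
    move=> Dz; rewrite -[RHS]conjCK Ew // conjcD rmorph_sum; congr (_ + _).
  have := potential_part_dbar hr be0 be2 n nA hf.
  move=> /(dbar_ext (fun _ _ => erefl) wE)/dbarN/(dbarD uw) uv.
  have uv0 : is_iter (cdisk r) (is_delbar (cdisk r)) n.+1
      (fun z => u z - potential_part r n.+1 k.+1 A f z) (fun=> 0).
    by apply: dbar_ext uv => // z _; rewrite subrr.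
  have [g hg Eg] := dbar_decomposition hr be0 be2 (density0 r be0 be2) uv0.
  exists f, g; split => // z Dz; rewrite (representationE hr be0 be2) //.
  by apply/eqP; rewrite -subr_eq Eg // cauchy_iter0 // addr0.
exists (conj_cauchy_part r k.+1 A f); split; last exact: (conj_cauchy_part_del hr be0 be2).
have gz : is_iter (cdisk r) (is_delbar (cdisk r)) n.+1
    (fun z => \sum_(0 <= j < n.+1) cauchy_iter r j (g j) z) (fun=> \sum_(0 <= j < n.+1) 0).
  apply: (@dbar_sum _ _ _ _ (fun j => cauchy_iter r j (g j)) (fun _ _ => 0)) => j.
  rewrite mem_index_iota => /andP[_ jn]; apply: (dbar_holomorphic jn) (hg _ jn).
  apply: (cauchy_iter_dbar hr be0 be2); apply: (holomorphic_density be0 be2); exact: hg.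
apply: dbar_ext (dbarD gz (potential_part_dbar hr be0 be2 n nA hf)) => z Dz.
  by rewrite Eu // (representationE hr be0 be2).
by rewrite big1 // add0r.
Qed.
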